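(* Let $X_1,X_2,\ldots$ be independent identically distributed random isometries of $\mathbb{R}^d$, let $x_0\in\mathbb{R}^d$, and let $Y_0=x_0$, $Y_l=X_l(X_{l-1}(\cdots X_1(x_0)))$ for $l\ge 1$. Suppose that $Y_1$ has finite second moments and that the law of $X_i$ is non-degenerate. Then there is a vector $v_0\in\mathbb{R}^d$ such that the distribution of $(Y_l-lv_0)/\sqrt{l}$ converges weakly to a Gaussian distribution as $l\to\infty$.
   Context: The law of $X_i$ is called degenerate if there are a proper closed subset $A\subsetneq\mathbb{R}^d$ and an isometry $\gamma\in\mathrm{Isom}(\mathbb{R}^d)$ such that, for all $l$, $Y_l$ is almost surely contained in $\gamma^l(A)$, where $(Y_l)$ is the walk started from $x_0$. It is non-degenerate if it is not degenerate. *)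

(* Defs.v *)
From HB Require Import structures.
From mathcomp Require Import all_boot all_order all_algebra finmap.
From mathcomp Require Import all_classical all_reals all_analysis.

Set Implicit Arguments.
Unset Strict Implicit.
Unset Printing Implicit Defensive.

Import Order.TTheory GRing.Theory Num.Theory.
Import numFieldNormedType.Exports.

Local Open Scope classical_set_scope.
Local Open Scope ring_scope.

Definition borel (T : ptopologicalType) := g_sigma_algebraType (@open T).

(* The library's norm on 'cV[R]_d is the sup norm; it induces the usual topology
   but not the Euclidean metric, hence the next two definitions. *)
Definition dotcv (R : realType) (d : nat) (u v : 'cV[R]_d) : R :=
  \sum_(i < d) u i 0 * v i 0.

Definition enorm (R : realType) (d : nat) (v : 'cV[R]_d) : R :=
  Num.sqrt (dotcv v v).

Definition isometries (R : realType) (d : nat) :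
    set {ptws 'cV[R]_d -> 'cV[R]_d} :=
  [set f | bijective f /\ forall x y, enorm (f x - f y) = enorm (x - y)].
Arguments isometries : clear implicits.

(* As a set_type, Isom R d carries the subspace topology of the topology of
   pointwise convergence, which is the usual (Lie group) topology of
   Isom(R^d). *)
Definition Isom (R : realType) (d : nat) := set_type (isometries R d).
Arguments Isom : clear implicits.

HB.instance Definition _ (R : realType) (d : nat) :=
  Topological.on (Isom R d).

Lemma isometries_id (R : realType) (d : nat) : isometries R d id.
Proof. by split => //; exists id. Qed.

HB.instance Definition _ (R : realType) (d : nat) :=
  isPointed.Build (Isom R d) (SigSub (mem_set (@isometries_id R d))).

Definition isom_fun (R : realType) (d : nat) (g : Isom R d) :
  'cV[R]_d -> 'cV[R]_d := \val g.

Definition mutually_independent (dT : measure_display) (T : measurableType dT)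
    (dS : measure_display) (S : measurableType dS)
    (R : realType) (P : probability T R) (X : nat -> {RV P >-> S}) : Prop :=
  forall (J : {fset nat}) (A : nat -> set S), (forall j, measurable (A j)) ->
    P (\bigcap_(j in [set` J]) (X j @^-1` A j)) =
    (\prod_(j <- J) P (X j @^-1` A j))%E.

Definition identically_distributed (dT : measure_display)
    (T : measurableType dT) (dS : measure_display) (S : measurableType dS)
    (R : realType) (P : probability T R) (X : nat -> {RV P >-> S}) : Prop :=
  forall (i j : nat) (A : set S), measurable A ->
    distribution P (X i) A = distribution P (X j) A.

(* Steps are indexed from 0: X l plays the role of the step X_{l+1}. *)
Fixpoint walk (R : realType) (d : nat) (T : Type) (X : nat -> T -> Isom R d)
    (x0 : 'cV[R]_d) (l : nat) (w : T) : 'cV[R]_d :=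
  if l is l'.+1 then isom_fun (X l' w) (walk X x0 l' w) else x0.

Definition degenerate (dT : measure_display) (T : measurableType dT)
    (R : realType) (P : probability T R) (d : nat) (X : nat -> T -> Isom R d)
    (x0 : 'cV[R]_d) : Prop :=
  exists (A : set 'cV[R]_d) (g : Isom R d),
    [/\ closed A, A != setT &
      forall l : nat,
        {ae P, forall w, (iter l (isom_fun g) @` A) (walk X x0 l w)}].

Definition weak_cvg (T : ptopologicalType) (R : realType)
    (nu : nat -> set (borel T) -> \bar R) (mu : set (borel T) -> \bar R) : Prop :=
  forall f : T -> R, continuous f -> (exists M : R, forall x, `|f x| <= M) ->
    (\int[nu l]_x (f x)%:E)%E @[l --> \oo] --> (\int[mu]_x (f x)%:E)%E.

(* A law on R^d is Gaussian when all its one-dimensional projections are normal;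
   0 < s makes it a law with a density (positive definite covariance). *)
Definition gaussian (R : realType) (d : nat)
    (mu : probability (borel 'cV[R]_d) R) : Prop :=
  forall u : 'cV[R]_d, u != 0 ->
    exists m s : R, 0 < s /\
      forall B : set R, measurable B ->
        pushforward mu (dotcv u) B = normal_prob m s B.

(* Main.v *)
(* Write X_l(x) = th_l x + v_l with th_l orthogonal. The mean ergodic
   decomposition of E v under the contraction M = E th gives E v = v0 + (c - M c)
   with M v0 = v0, hence th v0 = v0 almost surely; so y_l = Y_l - l v0 - c
   satisfies y_{l+1} = th_l y_l + w_l with w_l i.i.d. and centred. The same
   decomposition for conjugation Q |-> E[th Q th^T], applied to Cov w, yields
   Cov w = C0 + (D - E[th D th^T]) with th C0 th^T = C0 almost surely. Composing
   the steps in reverse order, a Taylor expansion of one step shows that the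
   characteristic function at u, corrected by D, is multiplied by
   exp(-<u, C0 u> / 2n) up to o(1/n). Together with a second moment bound this
   gives convergence to the Gaussian law of covariance C0, because trigonometric
   polynomials approximate continuous functions on cubes (Bernstein).
   If <u, C0 u> = 0 with u <> 0, the projection S of u u^T onto the fixed
   points of the conjugation is positive semidefinite and nonzero, with S w = 0
   almost surely, so the walk stays in translates by l v0 of a level set of the
   form <x - c, S (x - c)>, and its law is degenerate. *)

Require Import Defs.
From HB Require Import structures.
From mathcomp Require Import all_boot all_order all_algebra finmap.
From mathcomp Require Import all_classical all_reals all_analysis.
From mathcomp Require Import measurable_realfun lra.
Import Order.TTheory GRing.Theory Num.Theory.
Import numFieldNormedType.Exports.
Local Open Scope classical_set_scope.
Local Open Scope ring_scope.

Set Implicit Arguments.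
Unset Strict Implicit.
Unset Printing Implicit Defensive.

(** * Expectations *)

(** The powers of the contraction M need not converge: the law of th may be periodic. What every
    contraction of a finite-dimensional Euclidean space has is the splitting into ker(1 - M) and
    im(1 - M). The fixed part survives averaging, while the coboundary part telescopes and is
    absorbed by a change of origin c for the mean, by a bounded corrector built from D for the
    covariance. The errors of the n steps add up, so each must be o(1/n). Second moments give no
    cubic Taylor bound; the remainder b^2 min(1, |b|), with b of size 1/sqrt n, is integrable and
    averages to o(1/n) by dominated convergence. Characteristic functions are kept real: the
    functions cos(<u, x> + a) with a free phase a carry the information of exp(i <u, x>) and span an
    algebra. The approximation from this algebra is uniform on a cube and bounded everywhere, and
    second moments control the mass outside the cube. *)

Notation L1 P f := (P.-integrable setT (EFin \o f)).

Section expectation_toolkit.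
Context {dT : measure_display} {T : measurableType dT} {R : realType}.
Variable P : probability T R.
Implicit Types f g : T -> R.

Lemma L1_measurable f : L1 P f -> measurable_fun setT f.
Proof. by move=> /measurable_int /measurable_EFinP. Qed.

Lemma L1_bounded f (K : R) :
  measurable_fun setT f -> (forall x, `|f x| <= K) -> L1 P f.
Proof.
move=> mf fK; apply: measurable_bounded_integrable => //.
  by rewrite (le_lt_trans (probability_le1 P measurableT)) ?ltry.
exists K; split; first exact: num_real.
by move=> M KM x _ /=; rewrite (le_trans (fK x))// ltW.
Qed.

Lemma L1_le f g : measurable_fun setT f -> (forall x, `|f x| <= g x) ->
  L1 P g -> L1 P f.
Proof.
move=> mf fg ig; apply: le_integrable ig => //; first exact/measurable_EFinP.
by move=> x _ /=; rewrite lee_fin (le_trans (fg x)) ?ler_norm.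
Qed.

Lemma L1_cst (c : R) : L1 P (fun=> c).
Proof. by apply: (@L1_bounded _ `|c|). Qed.

Lemma L1D f g : L1 P f -> L1 P g -> L1 P (fun x => f x + g x).
Proof. by move=> fi gi; exact: integrableD fi gi. Qed.

Lemma L1B f g : L1 P f -> L1 P g -> L1 P (fun x => f x - g x).
Proof. by move=> fi gi; exact: integrableB fi gi. Qed.

Lemma L1Z (c : R) f : L1 P f -> L1 P (fun x => c * f x).
Proof. by move=> fi; exact: integrableZl fi. Qed.

Lemma L1Zr (c : R) f : L1 P f -> L1 P (fun x => f x * c).
Proof. by move=> fi; exact: integrableZr fi. Qed.

Lemma L1_sum (I : Type) (s : seq I) (h : I -> T -> R) :
  (forall i, L1 P (h i)) -> L1 P (fun x => \sum_(i <- s) h i x).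
Proof.
move=> hi; rewrite [X in P.-integrable _ X](_ : _ = (fun x => \sum_(i <- s) (h i x)%:E)%E).
  by apply: integrable_sum => // i _; exact: hi.
by apply/funext => x /=; rewrite sumEFin.
Qed.

Lemma L1_mul f g : measurable_fun setT f -> measurable_fun setT g ->
  L1 P (fun x => f x ^+ 2) -> L1 P (fun x => g x ^+ 2) ->
  L1 P (fun x => f x * g x).
Proof.
move=> mf mg f2 g2; apply: (@L1_le _ (fun x => f x ^+ 2 + g x ^+ 2)).
- exact: measurable_funM.
- move=> x; rewrite normrM -(real_normK (num_real (f x))) -(real_normK (num_real (g x))).
  have := sqr_ge0 (`|f x| - `|g x|); have := normr_ge0 (f x); have := normr_ge0 (g x).
  nra.
- exact: L1D.
Qed.

Lemma L1_of_sqr f : measurable_fun setT f -> L1 P (fun x => f x ^+ 2) -> L1 P f.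
Proof.
move=> mf f2; rewrite [X in _.-integrable _ X](_ : _ = EFin \o (fun x => 1 * f x)).
  apply: (@L1_mul (fun=> 1)) => //; exact: L1_cst.
by apply/funext => x /=; rewrite mul1r.
Qed.

Lemma ErD f g : L1 P f -> L1 P g ->
  \int[P]_x (f x + g x) = \int[P]_x f x + \int[P]_x g x.
Proof. by move=> fi gi; rewrite RintegralD. Qed.

Lemma ErB f g : L1 P f -> L1 P g ->
  \int[P]_x (f x - g x) = \int[P]_x f x - \int[P]_x g x.
Proof. by move=> fi gi; rewrite RintegralB. Qed.

Lemma ErZ (c : R) f : L1 P f -> \int[P]_x (c * f x) = c * \int[P]_x f x.
Proof. by move=> fi; rewrite RintegralZl. Qed.

Lemma ErZr (c : R) f : L1 P f -> \int[P]_x (f x * c) = (\int[P]_x f x) * c.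
Proof. by move=> fi; rewrite RintegralZr. Qed.

Lemma Er_cst (c : R) : \int[P]_x c = c.
Proof. by rewrite Rintegral_cst// [X in fine X](@probability_setT _ _ _ P) mulr1. Qed.

Lemma Er_sum (I : Type) (s : seq I) (h : I -> T -> R) :
  (forall i, L1 P (h i)) ->
  \int[P]_x (\sum_(i <- s) h i x) = \sum_(i <- s) \int[P]_x h i x.
Proof.
move=> hi; elim: s => [|i s IHs].
  by rewrite big_nil; under eq_Rintegral do rewrite big_nil; rewrite Er_cst.
rewrite big_cons -IHs -ErD//; last exact: L1_sum.
by under eq_Rintegral do rewrite big_cons.
Qed.

Lemma Er_le f g : L1 P f -> L1 P g -> (forall x, f x <= g x) ->
  \int[P]_x f x <= \int[P]_x g x.
Proof. by move=> fi gi fg; apply: le_Rintegral. Qed.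

Lemma Er_ge0 f : (forall x, 0 <= f x) -> 0 <= \int[P]_x f x.
Proof. by move=> f0; apply: Rintegral_ge0. Qed.

Lemma Er_norm_le f g : measurable_fun setT f -> L1 P g ->
  (forall x, `|f x| <= g x) -> `|\int[P]_x f x| <= \int[P]_x g x.
Proof.
move=> mf gi fg; have fi := L1_le mf fg gi.
apply: (le_trans (le_normr_Rintegral _ _)) => //; apply: Er_le => //.
exact: integrable_norm fi.
Qed.

Lemma Er_bound f (K : R) : measurable_fun setT f -> (forall x, `|f x| <= K) ->
  `|\int[P]_x f x| <= K.
Proof.
move=> mf fK; rewrite -[leRHS]Er_cst; apply: Er_norm_le => //; exact: L1_cst.
Qed.

Lemma Er_EFin f : L1 P f -> (\int[P]_x (f x)%:E)%E = (\int[P]_x f x)%:E.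
Proof. by move=> fi; rewrite fineK//; exact: integrable_fin_num. Qed.

Lemma Er_ae_eq f g : measurable_fun setT f -> measurable_fun setT g ->
  {ae P, forall x, f x = g x} -> \int[P]_x f x = \int[P]_x g x.
Proof.
move=> mf mg fg; congr fine; apply: ae_eq_integral => //.
- exact/measurable_EFinP.
- exact/measurable_EFinP.
- by apply: filterS fg => x -> _.
Qed.

Lemma Er_eq0 f : L1 P f -> (forall x, 0 <= f x) -> \int[P]_x f x = 0 ->
  {ae P, forall x, f x = 0}.
Proof.
move=> fi f0 E0.
have : ae_eq P setT (EFin \o f) (cst 0%E).
  apply/(ae_eq_integral_abs P measurableT (measurable_int P fi)).
  transitivity (\int[P]_x (f x)%:E)%E.
    by apply: eq_integral => x _ /=; rewrite ger0_norm.
  by rewrite Er_EFin// E0.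
by apply: filterS => x /(_ I) [].
Qed.

Lemma Er_sqr f : measurable_fun setT f -> L1 P (fun x => f x ^+ 2) ->
  (\int[P]_x f x) ^+ 2 <= \int[P]_x (f x ^+ 2).
Proof.
move=> mf f2; have fi := L1_of_sqr mf f2.
set m := \int[P]_x f x.
have : 0 <= \int[P]_x ((f x - m) ^+ 2) by apply: Er_ge0 => x; exact: sqr_ge0.
have -> : \int[P]_x ((f x - m) ^+ 2) =
  \int[P]_x ((f x ^+ 2 + (- (2 * m)) * f x) + m ^+ 2).
  by apply: eq_Rintegral => x _; lra.
have i2 : L1 P (fun x => (- (2 * m)) * f x) by exact: L1Z.
have i3 := L1D f2 i2.
rewrite (ErD i3 (L1_cst _)) (ErD f2 i2) ErZ// Er_cst.
rewrite -/m; lra.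
Qed.

Lemma Er_cvg (f_ : nat -> T -> R) f g :
  (forall n, measurable_fun setT (f_ n)) -> measurable_fun setT f ->
  (forall x, f_ n x @[n --> \oo] --> f x) -> L1 P g ->
  (forall n x, `|f_ n x| <= g x) ->
  \int[P]_x f_ n x @[n --> \oo] --> \int[P]_x f x.
Proof.
move=> mf_ mf cf gi fg.
have [] := @dominated_convergence _ _ _ P setT measurableT
  (fun n => EFin \o f_ n) (EFin \o f) (EFin \o g).
- by move=> n; exact/measurable_EFinP.
- exact/measurable_EFinP.
- by apply: aeW => x _ /=; apply/fine_cvgP; split; [exact: nearW|exact: cf].
- exact: gi.
- by apply: aeW => x n _ /=; rewrite lee_fin.
by move=> fi _ /= h; apply: fine_cvg; rewrite -Er_EFin.
Qed.

End expectation_toolkit.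

(** * Euclidean geometry and measurability *)

Lemma continuous_borel_measurable (T : ptopologicalType) (R : realType)
  (f : T -> R) : continuous f -> measurable_fun setT (f : borel T -> R).
Proof.
move=> cf; apply: (measurability _ (RGenOpens.measurableE R)).
move=> _ [_ [a [b ->]] <-]; rewrite setTI; apply: sub_sigma_algebra.
by apply: open_comp; [move=> x _; exact: cf|exact: interval_open].
Qed.

(** Second countability made explicit: an open set is the union of the countably many boxes with
    rational centre and radius [1 / (k + 1)] that it contains, and the preimage of a box is a finite
    intersection of conditions on coordinates. *)
Lemma measurable_cV (dT : measure_display) (T : measurableType dT)
    (R : realType) (d : nat) (f : T -> 'cV[R]_d) :
  (forall i, measurable_fun setT (fun w => f w i 0)) ->
  measurable_fun setT (f : T -> borel 'cV[R]_d).
Proof.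
move=> mf; apply: (@measurability _ _ T (borel 'cV[R]_d) setT f (@open 'cV[R]_d)) => //.
move=> _ [U oU <-]; rewrite setTI.
pose box (p : 'cV[rat]_d * nat) : set 'cV[R]_d :=
  [set y | forall i, `|y i 0 - ratr (p.1 i 0)| < p.2.+1%:R^-1].
have -> : U = \bigcup_(p in [set p | box p `<=` U]) box p.
  apply/seteqP; split; last by move=> y [p pU]; exact: pU.
  move=> x Ux; have /nbhs_ballP[e /= e0 xeU] := open_nbhs_nbhs (conj oU Ux).
  have [k ke] : exists k : nat, k.+1%:R^-1 < e / 2.
    have /ltr_add_invr[k] : (0:R) < e / 2 by rewrite divr_gt0.
    by rewrite add0r => ?; exists k.
  have k0 : (0 : R) < k.+1%:R^-1 by rewrite invr_gt0.
  have q_ i : {q : rat | `|x i 0 - ratr q| < (k.+1%:R^-1 : R)}.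
    apply: cid.
    have [|q] := @rat_in_itvoo R (x i 0 - k.+1%:R^-1) (x i 0 + k.+1%:R^-1).
      by rewrite ltrD2l gtrN.
    by rewrite in_itv /= => /andP[h1 h2]; exists q; rewrite ltr_norml;
      move: (k.+1%:R^-1 : R) (ratr q : R) (x i 0) h1 h2 => r rq y *; apply/andP; split; lra.
  exists (\col_i sval (q_ i), k) => /=.
    move=> y yb; apply: xeU; split => // i j; rewrite (ord1 j).
    have := yb i; have := svalP (q_ i); rewrite mxE /=.
    move: (k.+1%:R^-1 : R) (ratr (sval (q_ i)) : R) ke => r q re h1 h2.
    rewrite -ball_normE /ball_ /=.
    rewrite (_ : x i 0 - y i 0 = (x i 0 - q) - (y i 0 - q)); last by lra.
    rewrite (le_lt_trans (ler_normB _ _))//; lra.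
  by move=> i /=; rewrite mxE; exact: svalP (q_ i).
rewrite bigcup_mkcond preimage_bigcup.
apply: countable_bigcupT_measurable => [|p]; first exact: countableP.
case: ifPn => _; last by rewrite preimage_set0.
have -> : f @^-1` box p = \bigcap_(i in [set: 'I_d])
    ((fun w => `|f w i 0 - ratr (p.1 i 0)|) @^-1` `]-oo, p.2.+1%:R^-1[).
  by apply/seteqP; split => w /= h i; [move=> _|]; have := h i; rewrite /= in_itv; auto.
apply: fin_bigcap_measurable => // i _; rewrite -[X in measurable X]setTI.
have : measurable_fun setT (fun w => `|f w i 0 - ratr (p.1 i 0)|).
  by apply: measurableT_comp => //; exact: measurable_funB.
by apply => //; exact: measurable_itv.
Qed.

Section dot_product.
Context {R : realType} {d : nat}.
Implicit Types u v w : 'cV[R]_d.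

Lemma dotcvE u v : dotcv u v = (u^T *m v) 0 0.
Proof. by rewrite mxE; apply: eq_bigr => i _; rewrite mxE. Qed.

Lemma dotcvC u v : dotcv u v = dotcv v u.
Proof. by apply: eq_bigr => i _; rewrite mulrC. Qed.

Lemma dotcvDr u v w : dotcv u (v + w) = dotcv u v + dotcv u w.
Proof. by rewrite !dotcvE mulmxDr mxE. Qed.

Lemma dotcvNr u v : dotcv u (- v) = - dotcv u v.
Proof. by rewrite !dotcvE mulmxN mxE. Qed.

Lemma dotcvBr u v w : dotcv u (v - w) = dotcv u v - dotcv u w.
Proof. by rewrite dotcvDr dotcvNr. Qed.

Lemma dotcvZr u (c : R) v : dotcv u (c *: v) = c * dotcv u v.
Proof. by rewrite !dotcvE -scalemxAr mxE. Qed.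

Lemma dotcvDl u v w : dotcv (v + w) u = dotcv v u + dotcv w u.
Proof. by rewrite !(dotcvC _ u) dotcvDr. Qed.

Lemma dotcvBl u v w : dotcv (v - w) u = dotcv v u - dotcv w u.
Proof. by rewrite !(dotcvC _ u) dotcvBr. Qed.

Lemma dotcvZl u (c : R) v : dotcv (c *: v) u = c * dotcv v u.
Proof. by rewrite !(dotcvC _ u) dotcvZr. Qed.

Lemma dotcv0r u : dotcv u 0 = 0.
Proof. by rewrite dotcvE mulmx0 mxE. Qed.

Lemma dotcv0l u : dotcv 0 u = 0.
Proof. by rewrite dotcvC dotcv0r. Qed.

Lemma dotcv_mull (A : 'M[R]_d) u v : dotcv (A *m u) v = dotcv u (A^T *m v).
Proof. by rewrite !dotcvE trmx_mul mulmxA. Qed.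

Lemma dotcv_ge0 u : 0 <= dotcv u u.
Proof. by apply: sumr_ge0 => i _; rewrite -expr2 sqr_ge0. Qed.

Lemma dotcvD_le u v : dotcv (u + v) (u + v) <= 2 * dotcv u u + 2 * dotcv v v.
Proof.
have := dotcv_ge0 (u - v).
by rewrite !(dotcvBl, dotcvBr) !(dotcvDl, dotcvDr) (dotcvC v u); lra.
Qed.

Lemma sqr_coord_le u i : u i 0 ^+ 2 <= dotcv u u.
Proof.
rewrite /dotcv (bigD1 i)//= expr2 lerDl sumr_ge0// => j _.
by rewrite -expr2 sqr_ge0.
Qed.

Lemma dotcv_eq0 u : dotcv u u = 0 -> u = 0.
Proof.
move=> u0; apply/matrixP => i j; rewrite (ord1 j) mxE; apply/eqP.
by rewrite -sqrf_eq0 eq_le sqr_ge0 andbT -u0 sqr_coord_le.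
Qed.

Lemma dotcv_delta u (i : 'I_d) : dotcv u (delta_mx i 0) = u i 0.
Proof.
rewrite /dotcv (bigD1 i)//= mxE !eqxx mulr1 big1 ?addr0// => j ji.
by rewrite mxE (negPf ji) mulr0.
Qed.

Lemma mulmx_delta_col (A : 'M[R]_d) (i j : 'I_d) :
  (A *m (delta_mx j 0 : 'cV_d)) i 0 = A i j.
Proof.
rewrite mxE (bigD1 j)//= mxE !eqxx mulr1 big1 ?addr0// => k kj.
by rewrite mxE (negPf kj) mulr0.
Qed.

Lemma enorm_ge0 u : 0 <= enorm u. Proof. exact: sqrtr_ge0. Qed.

Lemma enorm_sqr u : enorm u ^+ 2 = dotcv u u.
Proof. by rewrite sqr_sqrtr// dotcv_ge0. Qed.

Lemma cauchy_schwarz u v : dotcv u v ^+ 2 <= dotcv u u * dotcv v v.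
Proof.
have := dotcv_ge0 u; rewrite le_eqVlt => /predU1P[/esym/dotcv_eq0->|u0].
  by rewrite !dotcv0l expr0n mul0r.
have := dotcv_ge0 (dotcv u u *: v - dotcv u v *: u).
rewrite !(dotcvBl, dotcvBr, dotcvZl, dotcvZr) (dotcvC v u).
rewrite (_ : _ - _ = dotcv u u * (dotcv u u * dotcv v v - dotcv u v ^+ 2)); last by lra.
by rewrite pmulr_rge0// subr_ge0.
Qed.

Lemma normr_dotcv_le u v : `|dotcv u v| <= enorm u * enorm v.
Proof.
rewrite -(@ler_pXn2r _ 2)// ?nnegrE ?mulr_ge0 ?enorm_ge0//.
by rewrite real_normK ?num_real// exprMn !enorm_sqr cauchy_schwarz.
Qed.

End dot_product.

Lemma isometries_translation (R : realType) d (v : 'cV[R]_d) :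
  isometries R d (fun x => x + v).
Proof.
split; first by exists (fun x => x - v) => x; rewrite ?addrK ?subrK.
by move=> x y; congr enorm; rewrite opprD addrACA subrr addr0.
Qed.

(** * Isometries are affine with orthogonal linear part *)

Section isometry_affine.
Context {R : realType} {d : nat}.
Implicit Types g : Isom R d.

Definition isom_lin g : 'M[R]_d :=
  \matrix_(i, j) (isom_fun g (delta_mx j 0) i 0 - isom_fun g 0 i 0).

Lemma isom_dist g x y : let g' := isom_fun g in
  dotcv (g' x - g' y) (g' x - g' y) = dotcv (x - y) (x - y).
Proof.
have [_ /(_ x y) h] := set_mem (valP g); rewrite /= -!enorm_sqr.
by congr (_ ^+ 2); exact: h.
Qed.

(** Polarization: the inner product is a combination of the three squared distances between [x], [y]
    and [0]. *)
Lemma isom_dot g x y : let g' := isom_fun g in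
  dotcv (g' x - g' 0) (g' y - g' 0) = dotcv x y.
Proof.
move=> g'; have h1 := isom_dist g x y; have h2 := isom_dist g x 0.
have h3 := isom_dist g y 0; move: h1 h2 h3; rewrite /= -/g'.
rewrite !(dotcvBl, dotcvBr, dotcv0r, dotcv0l).
rewrite !(dotcvC _ (g' x)) (dotcvC (g' 0)) (dotcvC y x); lra.
Qed.

Lemma isom_lin_orthl g : (isom_lin g)^T *m isom_lin g = 1%:M.
Proof.
apply/matrixP => i j; rewrite mxE [RHS]mxE.
have := isom_dot g (delta_mx i 0) (delta_mx j 0); rewrite dotcv_delta mxE eqxx andbT /=.
by rewrite (eq_sym i j) => <-; apply: eq_bigr => k _; rewrite !mxE.
Qed.

Lemma isom_lin_orthr g : isom_lin g *m (isom_lin g)^T = 1%:M.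
Proof. exact: mulmx1C (isom_lin_orthl g). Qed.

(** Linearity is a consequence: [g x - g 0] has inner product [x i 0] with the [i]-th column of
    [isom_lin g], and these columns are an orthonormal basis. *)
Lemma isom_funE g x : isom_fun g x = isom_lin g *m x + isom_fun g 0.
Proof.
apply/eqP; rewrite -subr_eq; apply/eqP.
rewrite -[LHS]mul1mx -(isom_lin_orthr g) -mulmxA; congr (_ *m _).
apply/matrixP => i j; rewrite (ord1 j) mxE -[RHS]dotcv_delta -(isom_dot g) dotcvC.
by apply: eq_bigr => k _; rewrite !mxE.
Qed.

Lemma isom_lin_dot g x y : dotcv (isom_lin g *m x) (isom_lin g *m y) = dotcv x y.
Proof. by rewrite dotcv_mull mulmxA isom_lin_orthl mul1mx. Qed.

(** Evaluation at [x] is continuous for the topology of pointwise convergence. *)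
Lemma measurable_isom_fun (x : 'cV[R]_d) i :
  measurable_fun setT (fun g : borel (Isom R d) => isom_fun g x i 0).
Proof.
apply: (@continuous_borel_measurable (Isom R d) R (fun g => isom_fun g x i 0)) => g.
apply: (@continuous_comp (Isom R d) 'cV[R]_d R (fun g => isom_fun g x) (fun y => y i 0)).
  apply: (@continuous_comp (Isom R d) {ptws 'cV[R]_d -> 'cV[R]_d} 'cV[R]_d
     val (fun f => f x)).
    exact: (@initial_continuous (Isom R d) {ptws 'cV[R]_d -> 'cV[R]_d} val).
  exact: (@proj_continuous 'cV[R]_d (fun=> 'cV[R]_d) x).
exact: coord_continuous.
Qed.

Lemma measurable_isom_lin i j :
  measurable_fun setT (fun g : borel (Isom R d) => isom_lin g i j).
Proof.
rewrite (_ : (fun _ => _) = fun g : borel (Isom R d) =>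
  isom_fun g (delta_mx j 0) i 0 - isom_fun g 0 i 0).
  by apply: measurable_funB; exact: measurable_isom_fun.
by apply/funext => g; rewrite mxE.
Qed.

End isometry_affine.

Section measurable_matrix.
Context {dT : measure_display} {T : measurableType dT} {R : realType}.

Definition mx_measurable m n (f : T -> 'M[R]_(m, n)) :=
  forall i j, measurable_fun setT (fun w => f w i j).

Lemma mx_measurable_cst m n (A : 'M[R]_(m, n)) : mx_measurable (fun=> A).
Proof. by move=> i j; exact: measurable_cst. Qed.

Lemma mx_measurable_tr m n (f : T -> 'M[R]_(m, n)) :
  mx_measurable f -> mx_measurable (fun w => (f w)^T).
Proof.
move=> mf i j; rewrite (_ : (fun _ => _) = (fun w => f w j i)); first exact: mf.
by apply/funext => w; rewrite mxE.
Qed.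

Lemma mx_measurableD m n (f g : T -> 'M[R]_(m, n)) :
  mx_measurable f -> mx_measurable g -> mx_measurable (fun w => f w + g w).
Proof.
move=> mf mg i j.
rewrite (_ : (fun _ => _) = (fun w => f w i j + g w i j)); first exact: measurable_funD.
by apply/funext => w; rewrite mxE.
Qed.

Lemma mx_measurableZ m n (c : R) (f : T -> 'M[R]_(m, n)) :
  mx_measurable f -> mx_measurable (fun w => c *: f w).
Proof.
move=> mf i j.
rewrite (_ : (fun _ => _) = (fun w => c * f w i j)); first exact: measurable_funM.
by apply/funext => w; rewrite mxE.
Qed.

Lemma mx_measurableM m n p (f : T -> 'M[R]_(m, n)) (g : T -> 'M[R]_(n, p)) :
  mx_measurable f -> mx_measurable g -> mx_measurable (fun w => f w *m g w).
Proof.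
move=> mf mg i j.
rewrite (_ : (fun _ => _) = (fun w => \sum_k f w i k * g w k j)).
  by apply: measurable_sum => k; exact: measurable_funM.
by apply/funext => w; rewrite mxE.
Qed.

Lemma measurable_dotcv d (f g : T -> 'cV[R]_d) : mx_measurable f ->
  mx_measurable g -> measurable_fun setT (fun w => dotcv (f w) (g w)).
Proof.
by move=> mf mg; apply: measurable_sum => i; exact: measurable_funM.
Qed.

Lemma measurable_enorm d (f : T -> 'cV[R]_d) : mx_measurable f ->
  measurable_fun setT (fun w => enorm (f w)).
Proof.
move=> mf; apply: (measurableT_comp (continuous_measurable_fun (@sqrt_continuous R))).
exact: measurable_dotcv.
Qed.

End measurable_matrix.

(** * Independence of the past *)

Lemma measurable_preimage (d1 d2 : measure_display) (T1 : measurableType d1)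
  (T2 : measurableType d2) (f : T1 -> T2) (A : set T2) :
  measurable_fun setT f -> measurable A -> measurable (f @^-1` A).
Proof. by move=> mf mA; rewrite -[X in measurable X]setTI; exact: mf. Qed.

Section product_of_independent.
Context {dT : measure_display} {T : measurableType dT} {R : realType}.
Variable P : probability T R.
Variables U V : T -> R.
Hypotheses (mU : measurable_fun setT U) (mV : measurable_fun setT V).
Hypothesis UV : forall A B : set R, measurable A -> measurable B ->
  P (U @^-1` A `&` V @^-1` B) = (P (U @^-1` A) * P (V @^-1` B))%E.
Hypotheses (iU : L1 P U) (iV : L1 P V).

Let U' : {RV P >-> R} := HB.pack U (isMeasurableFun.Build _ _ _ _ U mU).
Let V' : {RV P >-> R} := HB.pack V (isMeasurableFun.Build _ _ _ _ V mV).
Let mu : probability R R := distribution P U'.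
Let nu : probability R R := distribution P V'.
Let mUV : measurable_fun setT (fun w => (U w, V w)).
Proof. exact: measurable_fun_pair. Qed.
Let W : {RV P >-> (R * R)%type} :=
  HB.pack (fun w => (U w, V w)) (isMeasurableFun.Build _ _ _ _ _ mUV).

Let prodE (A : set (R * R)) : measurable A -> (mu \x nu)%E A = distribution P W A.
Proof. by apply: product_measure_unique => B C mB mC; rewrite /= -UV. Qed.

Let mM : measurable_fun setT (fun z : R * R => z.1 * z.2).
Proof. exact: measurable_funM. Qed.

Let integral_prod (f : R * R -> \bar R) : measurable_fun setT f ->
  (forall z, (0 <= f z)%E) ->
  (\int[(mu \x nu)%E]_z f z = \int[P]_w f (U w, V w))%E.
Proof.
move=> mf f0; rewrite (eq_measure_integral (distribution P W)); last first.
  by move=> A mA _; exact: prodE.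
by rewrite ge0_integral_distribution.
Qed.
Let L1mu : mu.-integrable setT (EFin : R -> \bar R).
Proof.
have := @integrable_pushforward _ _ _ _ _ _ mU P setT EFin.
by apply => //; exact: iU.
Qed.

Let L1nu : nu.-integrable setT (EFin : R -> \bar R).
Proof.
have := @integrable_pushforward _ _ _ _ _ _ mV P setT EFin.
by apply => //; exact: iV.
Qed.

Let Emu : \int[mu]_x x = \int[P]_w U w.
Proof. by rewrite /Rintegral integral_distribution. Qed.

Let Enu : \int[nu]_x x = \int[P]_w V w.
Proof. by rewrite /Rintegral integral_distribution. Qed.

Let L1prod : (mu \x nu)%E.-integrable setT (fun z : R * R => (z.1 * z.2)%:E).
Proof.
have mf : measurable_fun setT (fun z : R * R => (z.1 * z.2)%:E).
  exact/measurable_EFinP.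
apply/(integrable12ltyP _ _ mf).
have -> : (fun x : R => \int[nu]_y `|(x * y)%:E|)%E =
          (fun x : R => `|x|%:E * (\int[nu]_y `|y|)%:E)%E.
  apply/funext => x; rewrite -(Er_EFin (integrable_norm L1nu)).
  rewrite -(integralZl measurableT (integrable_norm L1nu)).
  by apply: eq_integral => y _ /=; rewrite normrM EFinM.
have iN : mu.-integrable setT (fun x : R => `|x|%:E) := integrable_norm L1mu.
by rewrite (integralZr measurableT iN) (Er_EFin iN) -EFinM ltry.
Qed.

(** By [prodE] the joint law of [U] and [V] is the product of their laws, so Tonelli and Fubini
    apply on the plane. *)
Lemma L1_indep : L1 P (fun w => U w * V w).
Proof.
have /integrableP[m1 m2] := L1prod; apply/integrableP; split.
  by apply/measurable_EFinP; exact: measurable_funM.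
rewrite -(integral_prod (f := fun z : R * R => `|(z.1 * z.2)%:E|%E))//.
by apply: measurableT_comp => //; exact/measurable_EFinP.
Qed.

Lemma Er_indep : \int[P]_w (U w * V w) = (\int[P]_w U w) * (\int[P]_w V w).
Proof.
rewrite -Emu -Enu /Rintegral.
transitivity (fine (\int[(mu \x nu)%E]_z (z.1 * z.2)%:E)%E).
  congr fine; rewrite (eq_measure_integral (distribution P W)); last first.
    by move=> A mA _; exact: prodE.
  rewrite integral_distribution//; last exact: L1_indep.
  exact/measurable_EFinP.
rewrite -(integral12_prod_meas1 L1prod).
have -> : fubini_F nu (fun z : R * R => (z.1 * z.2)%:E) =
          (fun x : R => x%:E * (\int[nu]_y y)%:E)%E.
  apply/funext => x; rewrite -(Er_EFin L1nu) -(integralZl measurableT L1nu).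
  by apply: eq_integral => y _ /=; rewrite EFinM.
rewrite (integralZr measurableT L1mu) fineM//.
exact: integrable_fin_num L1mu.
Qed.

End product_of_independent.

(** A pi-system generating the sigma-algebra of the steps with index in [J]. *)
Definition cylinders (dT : measure_display) (T : measurableType dT)
    (dS : measure_display) (S : measurableType dS) (R : realType)
    (P : probability T R) (X : nat -> {RV P >-> S}) (J : {fset nat}) :
  set (set T) :=
  [set B | exists2 A : nat -> set S, (forall j, measurable (A j)) &
     B = \bigcap_(j in [set` J]) (X j @^-1` A j)].

(** Measurability on [past X J] expresses dependence on the steps [X j], [j \in J], alone. *)
Notation past X J := (g_sigma_algebraType (cylinders X J)).

Section independence_from_the_past.
Context {dT : measure_display} {T : measurableType dT} {dS : measure_display}
  {S : measurableType dS} {R : realType} {P : probability T R}.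
Variable X : nat -> {RV P >-> S}.
Hypothesis Xindep : mutually_independent X.

Let mX j (A : set S) : measurable A -> measurable (X j @^-1` A).
Proof. by move=> mA; exact: measurable_preimage. Qed.

Lemma cylinders_measurable J : cylinders X J `<=` measurable.
Proof.
move=> _ [A mA ->]; apply: fin_bigcap_measurable; first exact: finite_fset.
by move=> j _; exact: mX.
Qed.

Lemma cylinders_setI J : setI_closed (cylinders X J).
Proof.
move=> _ _ [A mA ->] [B mB ->]; exists (fun j => A j `&` B j).
  by move=> j; exact: measurableI.
by rewrite -bigcapI; apply: eq_bigcapr => j _; rewrite preimage_setI.
Qed.

(** As functions of [B] both sides are finite measures; mutual independence makes them agree on
    cylinders, hence on the generated sigma-algebra. *)
Lemma indep_cylinders (J : {fset nat}) m (B : set T) (C : set S) :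
  m \notin J -> <<s cylinders X J>> B -> measurable C ->
  P (B `&` X m @^-1` C) = (P B * P (X m @^-1` C))%E.
Proof.
move=> mJ sB mC; pose C' := X m @^-1` C; have mC' : measurable C' by exact: mX.
have PC' : P C' \is a fin_num by exact: fin_num_measure.
pose r : {nonneg R} := NngNum (fine_ge0 (measure_ge0 P C')).
rewrite -(fineK PC') muleC.
apply: (@g_sigma_algebra_measure_unique _ R T (cylinders X J)
  (@cylinders_measurable J) (fun=> setT) _ _ (mrestr P mC') (mscale r P)
  (@cylinders_setI J) _ _ B sB).
- move=> _; exists (fun=> setT) => //.
  by apply/seteqP; split => // w _ j _.
- by rewrite bigcup_const.
- move=> _ [A mA ->]; rewrite /mrestr.
  set B' := \bigcap_(j in _) _.
  suff h : P (B' `&` C') = (P B' * P C')%E.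
    by apply: (etrans h); rewrite -[in LHS](fineK PC') muleC.
  rewrite {}/B'.
  pose A' j := if j == m then C else A j.
  have := Xindep (m |` J)%fset (A := A').
  rewrite big_fsetU1//= /A' eqxx => h.
  have -> : \bigcap_(j in [set` J]) (X j @^-1` A j) `&` C' =
    \bigcap_(j in [set` (m |` J)%fset]) (X j @^-1` A' j).
    apply/seteqP; split => w.
      move=> [h1 h2] j /=; rewrite in_fset1U /A' => /orP[/eqP->|jJ].
        by rewrite eqxx.
      by case: ifPn => [/eqP->//|_]; exact: h1.
    move=> h1; split => [j jJ|].
      have := h1 j; rewrite /= in_fset1U jJ orbT /A' => /(_ isT).
      by case: eqP jJ mJ => // -> ->.
    by have := h1 m; rewrite /= in_fset1U eqxx /A' eqxx; apply.
  rewrite h => [|j]; last by rewrite /A'; case: ifP.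
  rewrite muleC; congr (_ * _)%E.
  rewrite Xindep//; apply: eq_big_seq => j jJ.
  by case: eqP jJ mJ => // -> ->.
- move=> k; change (P (setT `&` C') < +oo)%E.
  by rewrite setTI -ge0_fin_numE ?measure_ge0.
Qed.

Lemma past_measurable J (f : T -> R) :
  measurable_fun setT (f : past X J -> R) -> measurable_fun setT f.
Proof.
move=> mf _ A mA; rewrite setTI.
have := mf measurableT A mA; rewrite setTI.
by apply: smallest_sub; [exact: sigma_algebra_measurable|exact: cylinders_measurable].
Qed.

Lemma pastS (J K : {fset nat}) (f : T -> R) : {subset J <= K} ->
  measurable_fun setT (f : past X J -> R) -> measurable_fun setT (f : past X K -> R).
Proof.
move=> JK mf _ A mA; have := mf measurableT A mA.
apply: smallest_sub; first exact: smallest_sigma_algebra.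
move=> _ [B mB ->]; apply: sub_sigma_algebra.
exists (fun j => if j \in J then B j else setT) => [j|]; first by case: ifP.
apply/seteqP; split => w h j /=.
  by move=> jK; case: ifPn => // jJ; exact: h.
by move=> jJ; have := h j (JK _ jJ); rewrite jJ.
Qed.

Lemma past_comp (J : {fset nat}) j (f : S -> R) : j \in J ->
  measurable_fun setT f ->
  measurable_fun setT ((fun w => f (X j w)) : past X J -> R).
Proof.
move=> jJ mf _ A mA; rewrite setTI; apply: sub_sigma_algebra.
exists (fun k => if k == j then f @^-1` A else setT) => [k|].
  by case: ifP => // _; exact: measurable_preimage.
apply/seteqP; split => w /= h; first by move=> k _; case: eqP => // ->.
by have := h j jJ; rewrite eqxx.
Qed.

Section expectation_of_product.
Variables (J : {fset nat}) (m : nat) (f : T -> R) (g : S -> R).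
Hypotheses (mJ : m \notin J) (mf : measurable_fun setT (f : past X J -> R)).
Hypotheses (mg : measurable_fun setT g) (fi : L1 P f)
  (gi : L1 P (fun w => g (X m w))).

Let mgX : measurable_fun setT (fun w => g (X m w)).
Proof. by apply: measurableT_comp. Qed.

Let indep (A B : set R) : measurable A -> measurable B ->
  P (f @^-1` A `&` (fun w => g (X m w)) @^-1` B) =
  (P (f @^-1` A) * P ((fun w => g (X m w)) @^-1` B))%E.
Proof.
move=> mA mB; apply: (@indep_cylinders J m (f @^-1` A) (g @^-1` B)) => //.
  by have := mf measurableT mA; rewrite setTI.
exact: measurable_preimage.
Qed.

Lemma L1_past : L1 P (fun w => f w * g (X m w)).
Proof. by apply: L1_indep => //; exact: past_measurable mf. Qed.

Lemma Er_past : \int[P]_w (f w * g (X m w)) =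
  (\int[P]_w f w) * \int[P]_w g (X m w).
Proof. by apply: Er_indep => //; exact: past_measurable mf. Qed.

End expectation_of_product.
End independence_from_the_past.

(** * Mean ergodic decomposition *)

Section contraction.
Context {R : realType} {N : nat}.
Implicit Types (M : 'M[R]_N) (x y z : 'cV[R]_N).

Lemma archi_le0 (a b : R) : (forall k : nat, k%:R * a <= b) -> a <= 0.
Proof.
move=> h; rewrite leNgt; apply/negP => a0.
have := h (Num.truncn (b / a)).+1; rewrite -ler_pdivlMr//.
by rewrite leNgt truncnS_gt.
Qed.

(** Here [M] maps [z - k y] to [z - (k + 1) y], so the iterates of [z] drift linearly along [y],
    which a contraction forbids unless [y = 0]. *)
Lemma contraction_ker_im M y z :
  (forall x, dotcv (M *m x) (M *m x) <= dotcv x x) ->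
  M *m y = y -> y = z - M *m z -> y = 0.
Proof.
move=> cM My yz.
have Mz : M *m z = z - y by rewrite yz opprB addrC subrK.
have iterM (k : nat) : dotcv (z - k%:R *: y) (z - k%:R *: y) <= dotcv z z.
  elim: k => [|k IHk]; first by rewrite scale0r subr0.
  have -> : z - k.+1%:R *: y = M *m (z - k%:R *: y).
    by rewrite mulmxBr -scalemxAr My Mz -natr1 scalerDl scale1r opprD addrA addrAC.
  exact: le_trans (cM _) IHk.
apply: dotcv_eq0; apply/eqP; rewrite eq_le dotcv_ge0 andbT.
apply: (@archi_le0 _ (2 * dotcv z y)) => k.
(* For [k > 0] the bound on [z - k y], divided by [k], gives the claim; at [k = 0] the claim is
   [0 <= 2 <z, y>], which is read off from the bound with [k = 1]. *)
have [->|k0] := posnP k.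
  rewrite mul0r; have := iterM 1%N; have := dotcv_ge0 y.
  by rewrite !(dotcvBl, dotcvBr, dotcvZl, dotcvZr) (dotcvC y z); nra.
have := iterM k; rewrite !(dotcvBl, dotcvBr, dotcvZl, dotcvZr) (dotcvC y z).
rewrite -subr_ge0 => h.
have k0R : (0 : R) < k%:R by rewrite ltr0n.
rewrite -subr_ge0 -(pmulr_rge0 _ k0R); lra.
Qed.

(** Kernel and image of [1 - M] meet trivially, so by rank-nullity they are complementary. The
    transpose passes to the row spaces on which [kermx] acts. *)
Lemma contraction_decomp M : (forall x, dotcv (M *m x) (M *m x) <= dotcv x x) ->
  forall x, exists y z, x = y + (z - M *m z) /\ M *m y = y.
Proof.
move=> cM x; pose A := (1%:M - M)^T.
have kA (u : 'rV[R]_N) : u *m A = 0 -> M *m u^T = u^T.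
  move=> uA; apply/esym/eqP; rewrite -subr_eq0 -[X in X - _]mul1mx -mulmxBl.
  by rewrite -[_ *m _]trmxK trmx_mul trmxK uA trmx0.
have capA : (kermx A :&: A)%MS = 0.
  apply/eqP/rowV0P => v; rewrite sub_capmx => /andP[/sub_kermxP vA /submxP[u vu]].
  apply: trmx_inj; rewrite trmx0; apply: (contraction_ker_im (z := u^T) cM (kA _ vA)).
  by rewrite vu trmx_mul trmxK mulmxBl mul1mx.
have full : row_full (kermx A + A)%MS.
  by rewrite /row_full mxrank_disjoint_sum// mxrank_ker subnK// rank_leq_row.
have /sub_addsmxP[[u v] /= e] := submx_full x^T full.
exists ((u *m kermx A)^T), (v^T); split.
  by rewrite -[LHS]trmxK e linearD /= (trmx_mul v) trmxK mulmxBl mul1mx.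
by apply: kA; rewrite -mulmxA mulmx_ker mulmx0.
Qed.

Lemma contraction_iter M k x : (forall x, dotcv (M *m x) (M *m x) <= dotcv x x) ->
  dotcv (iter k (mulmx M) x) (iter k (mulmx M) x) <= dotcv x x.
Proof. by move=> cM; elim: k => //= k IHk; exact: le_trans (cM _) IHk. Qed.

(** The coboundary telescopes along the orbit: the sum of [<M^k x, p>] over [k < n] is
    [n <y, p> + <z, p> - <M^n z, p>]. It is nonnegative and the last two terms are bounded, so
    dividing by [n] gives the sign: [y] is the Cesaro limit of the orbit of [x]. *)
Lemma cesaro_ge0 M (pos : set 'cV[R]_N) p x y z :
  (forall x, dotcv (M *m x) (M *m x) <= dotcv x x) ->
  (forall x, pos x -> pos (M *m x)) -> (forall x, pos x -> 0 <= dotcv x p) ->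
  pos x -> x = y + (z - M *m z) -> M *m y = y -> 0 <= dotcv y p.
Proof.
move=> cM posM posp px xE My.
have pos_iter k : pos (iter k (mulmx M) x) by elim: k => //= k; exact: posM.
have iterE k : iter k (mulmx M) x =
    y + (iter k (mulmx M) z - iter k.+1 (mulmx M) z).
  by elim: k => //= k ->; rewrite mulmxDr My mulmxBr.
have sum_ge0 n : 0 <= n%:R * dotcv y p + dotcv z p - dotcv (iter n (mulmx M) z) p.
  elim: n => [|n IHn]; first by rewrite mul0r add0r subrr.
  apply: (le_trans (addr_ge0 IHn (posp _ (pos_iter n)))).
  by rewrite iterE dotcvDl dotcvBl -natr1; lra.
rewrite -oppr_le0; apply: (@archi_le0 _ (dotcv z p + enorm z * enorm p)) => n.
have := sum_ge0 n.
have : `|dotcv (iter n (mulmx M) z) p| <= enorm z * enorm p.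
  apply: le_trans (normr_dotcv_le _ _) _; rewrite ler_wpM2r ?enorm_ge0//.
  by rewrite ler_sqrt ?contraction_iter// dotcv_ge0.
by rewrite ler_norml => /andP[]; lra.
Qed.

End contraction.

Section mean_ergodic.
Context {dT : measure_display} {T : measurableType dT} {R : realType}.
Variable (P : probability T R) (N : nat) (B : T -> 'M[R]_N).
Implicit Types x y z : 'cV[R]_N.
Hypothesis mB : forall i j, measurable_fun setT (fun w => B w i j).
Hypothesis isoB : forall w x y, dotcv (B w *m x) (B w *m y) = dotcv x y.

Definition mean_mx : 'M[R]_N := \matrix_(i, j) \int[P]_w B w i j.

Let B_bound w i j : `|B w i j| <= 1.
Proof.
rewrite -mulmx_delta_col.
rewrite -(ler_pXn2r (n := 2))// ?nnegrE// expr1n real_normK ?num_real//.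
by rewrite (le_trans (sqr_coord_le _ _))// isoB dotcv_delta mxE !eqxx.
Qed.

Lemma L1_isometric_entry i j : L1 P (fun w => B w i j).
Proof. exact: L1_bounded. Qed.

Let measurable_Bx x i : measurable_fun setT (fun w => (B w *m x) i 0).
Proof.
rewrite (_ : (fun _ => _) = (fun w => \sum_j B w i j * x j 0)); last first.
  by apply/funext => w; rewrite mxE.
by apply: measurable_sum => j; exact: measurable_funM.
Qed.

Let Bx_bound x w i : `|(B w *m x) i 0| <= enorm x.
Proof.
rewrite -(ler_pXn2r (n := 2))// ?nnegrE ?enorm_ge0// real_normK ?num_real//.
by rewrite enorm_sqr -(isoB w) sqr_coord_le.
Qed.

Let L1Bx x i : L1 P (fun w => (B w *m x) i 0).
Proof. exact: L1_bounded. Qed.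

Lemma mean_mxE x i : (mean_mx *m x) i 0 = \int[P]_w (B w *m x) i 0.
Proof.
rewrite mxE.
under [RHS]eq_Rintegral do rewrite mxE.
rewrite Er_sum => [|j]; last by apply: L1Zr; exact: L1_isometric_entry.
by apply: eq_bigr => j _; rewrite mxE ErZr//; exact: L1_isometric_entry.
Qed.

Let L1dot x y : L1 P (fun w => dotcv (B w *m x) y).
Proof.
by apply: L1_sum => i; exact: L1Zr.
Qed.

Lemma dotcv_mean_mx x y : dotcv (mean_mx *m x) y = \int[P]_w dotcv (B w *m x) y.
Proof.
rewrite /dotcv Er_sum => [|i]; last exact: L1Zr.
by apply: eq_bigr => i _; rewrite mean_mxE ErZr.
Qed.

(** Jensen in each coordinate: the square of a mean is at most the mean of the square. *)
Lemma mean_mx_contraction x : dotcv (mean_mx *m x) (mean_mx *m x) <= dotcv x x.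
Proof.
have L2 i : L1 P (fun w => (B w *m x) i 0 ^+ 2).
  apply: (@L1_bounded _ _ _ _ _ (enorm x ^+ 2)); first exact: measurable_funX.
  by move=> w; rewrite normrX ler_pXn2r// nnegrE enorm_ge0.
apply: (@le_trans _ _ (\sum_i \int[P]_w ((B w *m x) i 0 ^+ 2))).
  by apply: ler_sum => i _; rewrite -expr2 mean_mxE; exact: Er_sqr.
rewrite -Er_sum// -[leRHS](Er_cst P); apply: Er_le; [exact: L1_sum|exact: L1_cst|].
by move=> w; rewrite -(isoB w) /dotcv; under eq_bigr do rewrite expr2.
Qed.

Lemma mean_ergodic_decomp x : exists y z,
  x = y + (z - mean_mx *m z) /\ mean_mx *m y = y.
Proof. exact: contraction_decomp mean_mx_contraction x. Qed.

(** Equality case of the contraction: the mean of [|B x - x|^2] is [2 |x|^2 - 2 <M x, x>], which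
    vanishes when [x] is fixed in mean. *)
Lemma mean_mx_fixed_ae x : mean_mx *m x = x -> {ae P, forall w, B w *m x = x}.
Proof.
move=> Mx.
have E0 : \int[P]_w dotcv (B w *m x - x) (B w *m x - x) = 0.
  transitivity (\int[P]_w (2 * dotcv x x - 2 * dotcv (B w *m x) x)).
    apply: eq_Rintegral => w _.
    by rewrite !(dotcvBl, dotcvBr) isoB (dotcvC x (B w *m x)); lra.
  rewrite ErB; [|exact: L1_cst|exact: L1Z].
  by rewrite Er_cst ErZ// -dotcv_mean_mx Mx subrr.
have : {ae P, forall w, dotcv (B w *m x - x) (B w *m x - x) = 0}.
  apply: Er_eq0 => // [|w]; last exact: dotcv_ge0.
  rewrite (_ : (fun _ => _) = (fun w => 2 * dotcv x x - 2 * dotcv (B w *m x) x)).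
    by apply: L1B; [exact: L1_cst|exact: L1Z].
  apply/funext => w.
  by rewrite !(dotcvBl, dotcvBr) isoB (dotcvC x (B w *m x)); lra.
by apply: filterS => w /dotcv_eq0/eqP; rewrite subr_eq0 => /eqP.
Qed.

(** A vector fixed by almost every isometry [B w] is fixed by the transpose of the mean too. Hence
    coboundaries are orthogonal to fixed vectors. *)
Lemma mean_mx_fixed_adj x y : mean_mx *m y = y -> dotcv (mean_mx *m x) y = dotcv x y.
Proof.
move=> My; rewrite dotcv_mean_mx -[RHS](Er_cst P).
apply: Er_ae_eq => //; first exact: L1_measurable (L1dot x y).
by apply: filterS (mean_mx_fixed_ae My) => w e; rewrite -(isoB w x y) e.
Qed.

End mean_ergodic.

(** * Conjugation and the Frobenius inner product *)

Section conjugation.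
Context {R : realType} {d : nat}.
Implicit Types A B D Q S t : 'M[R]_d.

Definition mxcol A : 'cV[R]_(d * d) := (mxvec A)^T.

(* [conj_mx t *m mxcol A = mxcol (t *m A *m t^T)], see [conj_mxE]: conjugation
   by an orthogonal [t] is an isometry for the Frobenius inner product, so the
   mean ergodic decomposition applies to it. *)
Definition conj_mx t : 'M[R]_(d * d) := (lin_mulmxr t^T *m lin_mulmx t)^T.

Lemma mxcolK (x : 'cV[R]_(d * d)) : mxcol (vec_mx x^T) = x.
Proof. by rewrite /mxcol vec_mxK trmxK. Qed.

Lemma mxcol_inj : injective mxcol.
Proof. by move=> A B /trmx_inj /(can_inj mxvecK). Qed.

Lemma mxcolE A i j : mxcol A (mxvec_index i j) 0 = A i j.
Proof. by rewrite mxE mxvecE. Qed.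

Lemma mxcolD A B : mxcol (A + B) = mxcol A + mxcol B.
Proof. by rewrite /mxcol !linearD. Qed.

Lemma mxcolB A B : mxcol (A - B) = mxcol A - mxcol B.
Proof. by rewrite /mxcol !linearB. Qed.

Lemma dotcv_mxcol A B : dotcv (mxcol A) (mxcol B) = \tr (A *m B^T).
Proof.
rewrite /dotcv (reindex _ (curry_mxvec_bij _ _)) /=.
transitivity (\sum_i \sum_j A i j * B i j).
  by rewrite pair_bigA; apply: eq_bigr => -[i j] _; rewrite /= !mxcolE.
by apply: eq_bigr => i _; rewrite mxE; apply: eq_bigr => j _; rewrite mxE.
Qed.

Lemma conj_mxE t A : conj_mx t *m mxcol A = mxcol (t *m A *m t^T).
Proof.
rewrite /conj_mx /mxcol -trmx_mul mulmxA; congr (_^T).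
by rewrite mul_vec_lin /= mul_vec_lin /= mulmxA.
Qed.

Lemma conj_mx_iso t : t^T *m t = 1%:M ->
  forall x y, dotcv (conj_mx t *m x) (conj_mx t *m y) = dotcv x y.
Proof.
move=> tt x y; rewrite -(mxcolK x) -(mxcolK y) !conj_mxE !dotcv_mxcol.
set A := vec_mx _; set B := vec_mx _.
rewrite !trmx_mul trmxK !mulmxA -!(mulmxA _ t^T t) tt !mulmx1.
by rewrite mxtrace_mulC !mulmxA tt mul1mx.
Qed.

(** A quadratic form is the Frobenius product with a rank-one matrix; the transpose is kept to match
    [dotcv_mxcol]. *)
Lemma qform_tr Q u : dotcv u (Q *m u) = \tr (Q *m (u *m u^T)^T).
Proof. by rewrite trmx_mul trmxK mulmxA mxtrace_mulC mulmxA trace_mx11 dotcvE mulmxA. Qed.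

Lemma measurable_conj_mx (dT : measure_display) (T : measurableType dT)
    (t : T -> 'M[R]_d) :
  (forall i j, measurable_fun setT (fun w => t w i j)) ->
  forall k l, measurable_fun setT (fun w => conj_mx (t w) k l).
Proof.
move=> mt k l; pose A : 'M[R]_d := vec_mx (delta_mx l 0 : 'cV_(d * d))^T.
(* Column [l] of [conj_mx t] is the conjugate of an elementary matrix; the [enum_val] terms decode
   [k] into its pair of matrix indices. *)
have -> : (fun w => conj_mx (t w) k l) =
    (fun w => (t w *m A *m (t w)^T) (enum_val (cast_ord (esym (mxvec_cast d d)) k)).1
       (enum_val (cast_ord (esym (mxvec_cast d d)) k)).2).
  apply/funext => w.
  rewrite -mulmx_delta_col.
  rewrite -(mxcolK (delta_mx l 0)) conj_mxE.
  by case/mxvec_indexP: k => i j; rewrite mxcolE; congr fun_of_matrix;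
    rewrite /mxvec_index cast_ordK enum_rankK.
move: (_.1) (_.2) => i j.
rewrite (_ : (fun _ => _) =
  (fun w => \sum_b (\sum_a t w i a * A a b) * t w j b)); last first.
  by apply/funext => w; rewrite mxE; apply: eq_bigr => b _; rewrite !mxE.
apply: measurable_sum => b; apply: measurable_funM => //.
by apply: measurable_sum => a; exact: measurable_funM.
Qed.

End conjugation.

Section random_conjugation.
Context {dT : measure_display} {T : measurableType dT} {R : realType} {d : nat}.
Variables (P : probability T R) (t : T -> 'M[R]_d).
Implicit Types Q D S : 'M[R]_d.
Hypothesis mt : forall i j, measurable_fun setT (fun w => t w i j).
Hypothesis tt : forall w, (t w)^T *m t w = 1%:M.

Let K w := conj_mx (t w).
Let mK i j : measurable_fun setT (fun w => K w i j).
Proof. exact: measurable_conj_mx. Qed.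
Let isoK w x y : dotcv (K w *m x) (K w *m y) = dotcv x y.
Proof. exact: conj_mx_iso. Qed.

Definition mean_conj Q : 'M[R]_d :=
  \matrix_(i, j) \int[P]_w (t w *m Q *m (t w)^T) i j.

Let mean_conjE Q : mxcol (mean_conj Q) = mean_mx P K *m mxcol Q.
Proof.
apply/matrixP => k l; rewrite (ord1 l) mean_mxE//.
case/mxvec_indexP: k => i j; rewrite mxcolE mxE.
by apply: eq_Rintegral => w _; rewrite conj_mxE mxcolE.
Qed.

Lemma mean_conj_decomp Q : exists Q0 D,
  Q = Q0 + (D - mean_conj D) /\ mean_conj Q0 = Q0.
Proof.
have [y [z [e f]]] := mean_ergodic_decomp P mK isoK (mxcol Q).
exists (vec_mx y^T), (vec_mx z^T); split; apply: mxcol_inj.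
  by rewrite mxcolD mxcolB mean_conjE !mxcolK.
by rewrite mean_conjE mxcolK.
Qed.

Lemma mean_conj_fixed_ae Q : mean_conj Q = Q ->
  {ae P, forall w, t w *m Q *m (t w)^T = Q}.
Proof.
move=> MQ; have : mean_mx P K *m mxcol Q = mxcol Q by rewrite -mean_conjE MQ.
by move/(mean_mx_fixed_ae mK isoK); apply: filterS => w; rewrite conj_mxE => /mxcol_inj.
Qed.

(** The coboundary [D - mean_conj D] is Frobenius-orthogonal to every fixed [S]. *)
Lemma mean_conj_fixed_tr Q Q0 D S : Q = Q0 + (D - mean_conj D) ->
  mean_conj S = S -> \tr (Q *m S^T) = \tr (Q0 *m S^T).
Proof.
move=> QE MS; have MS' : mean_mx P K *m mxcol S = mxcol S by rewrite -mean_conjE MS.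
rewrite -!dotcv_mxcol QE mxcolD mxcolB mean_conjE dotcvDl dotcvBl.
by rewrite (mean_mx_fixed_adj mK isoK _ MS') subrr addr0.
Qed.

Lemma mean_conj_tr Q : mean_conj Q^T = (mean_conj Q)^T.
Proof.
apply/matrixP => i j; rewrite !mxE; apply: eq_Rintegral => w _.
rewrite (_ : t w *m Q^T *m (t w)^T = (t w *m Q *m (t w)^T)^T) ?mxE//.
by rewrite !trmx_mul trmxK mulmxA.
Qed.

(** Uniqueness of the decomposition: comparing those of [Q] and [Q^T] shows that [Q0^T - Q0] is both
    fixed and the coboundary of [D - D^T], hence zero. *)
Lemma mean_conj_fixed_sym Q Q0 D : Q = Q0 + (D - mean_conj D) ->
  mean_conj Q0 = Q0 -> Q^T = Q -> Q0^T = Q0.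
Proof.
move=> QE MQ0 Qsym; apply/eqP; rewrite -subr_eq0; apply/eqP.
have cM := mean_mx_contraction P mK isoK.
apply: mxcol_inj; rewrite -[mxcol 0](_ : 0 = _); last by rewrite /mxcol !linear0.
apply: (@contraction_ker_im _ _ (mean_mx P K) _ (mxcol (D - D^T)) cM).
  by rewrite mxcolB mulmxBr -!mean_conjE mean_conj_tr MQ0.
rewrite mxcolB (mulmxBr _ (mxcol D)) -!mean_conjE -!mxcolB mean_conj_tr; congr mxcol.
have e : Q0^T + (D^T - (mean_conj D)^T) = Q0 + (D - mean_conj D).
  by rewrite -linearB -linearD /= -QE Qsym.
have -> : Q0^T = Q0 + (D - mean_conj D) - (D^T - (mean_conj D)^T).
  by rewrite -e addrK.
rewrite addrAC (addrC Q0) addrK !opprB addrACA [RHS]addrACA.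
by rewrite (addrC (- mean_conj D)).
Qed.

(** The positive semidefinite cone, described by the tests [v *m v^T], is preserved by conjugation
    and by averaging, so it contains the Cesaro limit [Q0]. *)
Lemma mean_conj_fixed_psd Q Q0 D : Q = Q0 + (D - mean_conj D) ->
  mean_conj Q0 = Q0 -> (forall u, 0 <= dotcv u (Q *m u)) ->
  forall u, 0 <= dotcv u (Q0 *m u).
Proof.
move=> QE MQ0 Qpos u; rewrite qform_tr -dotcv_mxcol.
pose pos : set 'cV[R]_(d * d) := 
  [set x | forall v : 'cV[R]_d, 0 <= dotcv x (mxcol (v *m v^T))].
apply: (@cesaro_ge0 _ _ (mean_mx P K) pos _ (mxcol Q) _ (mxcol D)).
- exact: mean_mx_contraction.
- move=> x posx v; rewrite dotcv_mean_mx//; apply: Er_ge0 => w.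
  rewrite -(mxcolK x) conj_mxE dotcv_mxcol -qform_tr -!mulmxA.
  rewrite dotcvC dotcv_mull dotcvC.
  by rewrite qform_tr -dotcv_mxcol mxcolK; exact: posx.
- by move=> x; apply.
- by move=> v; rewrite dotcv_mxcol -qform_tr.
- by rewrite -mean_conjE -mxcolB -mxcolD -QE.
- by rewrite -mean_conjE MQ0.
Qed.

(* [S] is the projection of [u u^T] onto the fixed points of the conjugation
   operator, which is self-dual on them. *)
Lemma dual_fixed_form Q Q0 D u : Q = Q0 + (D - mean_conj D) ->
  mean_conj Q0 = Q0 -> exists S, [/\ S^T = S, forall v, 0 <= dotcv v (S *m v),
    mean_conj S = S, \tr S = dotcv u u & dotcv u (Q0 *m u) = \tr (Q *m S^T)].
Proof.
move=> QE MQ0; have [S [D' [uE MS]]] := mean_conj_decomp (u *m u^T).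
(* The identity is a fixed matrix because [t] is orthogonal; pairing with it shows that the
   projection preserves traces, so [S] does not vanish when [u != 0]. *)
have M1 : mean_conj 1%:M = 1%:M.
  apply/matrixP => i j; rewrite mxE.
  under eq_Rintegral => w _ do rewrite mulmx1 (mulmx1C (tt w)).
  by rewrite Er_cst.
exists S; split => //.
- by apply: mean_conj_fixed_sym uE MS _; rewrite trmx_mul trmxK.
- apply: mean_conj_fixed_psd uE MS _ => v.
  rewrite -mulmxA [_^T *m v]mx11_scalar -dotcvE mul_mx_scalar dotcvZr.
  by rewrite (dotcvC v) -expr2 sqr_ge0.
- have := mean_conj_fixed_tr uE M1; rewrite trmx1 !mulmx1 => <-.
  by rewrite mxtrace_mulC trace_mx11 dotcvE.
- rewrite (mean_conj_fixed_tr QE MS) qform_tr.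
  have := mean_conj_fixed_tr uE MQ0.
  by rewrite -!dotcv_mxcol dotcvC => ->; rewrite dotcvC.
Qed.

End random_conjugation.

(** * Elementary estimates *)

Section trig_bounds.
Context {R : realType}.
Implicit Types a b x y : R.

Lemma sin_mvt b : 0 <= b -> exists2 c, 0 <= c <= b & sin b = cos c * b.
Proof.
move=> b0.
have [|c cb e] := @MVT_segment R sin cos 0 b b0 (fun x _ => is_derive_sin x).
  by apply: continuous_subspaceT => x; exact: continuous_sin.
by exists c; [move: cb; rewrite in_itv|move: e; rewrite sin0 !subr0].
Qed.

Lemma ler_norm_sin b : `|sin b| <= `|b|.
Proof.
wlog b0 : b / 0 <= b => [h|].
  have [|b0] := leP 0 b; first exact: h.
  by have := h (- b); rewrite sinN !normrN; apply; rewrite oppr_ge0 ltW.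
have [c _ ->] := sin_mvt b0.
by rewrite normrM ler_piMl// cos_max.
Qed.

Lemma sqr_sin_le b : sin b ^+ 2 <= b ^+ 2.
Proof.
by rewrite -(real_normK (num_real (sin b))) -(real_normK (num_real b)) ler_pXn2r ?nnegrE// ler_norm_sin.
Qed.

Lemma one_sub_cosE b : 1 - cos b = 2 * sin (b / 2) ^+ 2.
Proof.
have := cos_mulr2n (b / 2); rewrite (_ : (b / 2) *+ 2 = b) => [->|]; last by rewrite mulr2n; lra.
by rewrite cos2sin2 mulr2n; lra.
Qed.

Lemma one_sub_cos_bound b : 0 <= 1 - cos b <= b ^+ 2 / 2.
Proof.
rewrite one_sub_cosE; have := sqr_ge0 (sin (b / 2)); have := sqr_sin_le (b / 2).
by rewrite expr_div_n => h1 h2; apply/andP; split; lra.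
Qed.

Lemma sin_sub_bound b : `|sin b - b| <= `|b| ^+ 3 / 2.
Proof.
wlog b0 : b / 0 <= b => [h|].
  have [|b0] := leP 0 b; first exact: h.
  have := h (- b); rewrite sinN -opprD !normrN; apply; rewrite oppr_ge0 ltW//.
have [c /andP[c0 cb] ->] := sin_mvt b0.
rewrite (ger0_norm b0) -{2}[b]mul1r -mulrBl normrM (ger0_norm b0) mulrC exprS -mulrA ler_wpM2l//.
have /andP[h1 h2] := one_sub_cos_bound c.
rewrite distrC ger0_norm// (le_trans h2)// ler_pM2r ?invr_gt0//.
by rewrite ler_pXn2r ?nnegrE// (le_trans c0).
Qed.

(** By the half-angle formula the middle term is [2 (x^2 - sin^2 x)] at [x = b / 2]; each factor of
    this difference of squares is then estimated. *)
Lemma cos_sub_bound b : 0 <= cos b - 1 + b ^+ 2 / 2 <= `|b| ^+ 4 / 8.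
Proof.
rewrite -(real_normK (num_real b)) -cos_norm.
have := normr_ge0 b; move: `|b| => {}b b0; have := one_sub_cosE b => e.
have h2 := sqr_sin_le (b / 2); have h3 := ler_norm_sin (b / 2).
have := sin_sub_bound (b / 2); move: h3.
rewrite (@ger0_norm _ (b / 2)) ?divr_ge0// !ler_norml => /andP[h3 h4] /andP[h5 h6].
set s := sin (b / 2) in e h2 h3 h4 h5 h6.
have -> : cos b - 1 + b ^+ 2 / 2 = 2 * ((b / 2 - s) * (b / 2 + s)) by lra.
have k1 : 0 <= b / 2 - s by lra.
have k2 : 0 <= b / 2 + s by lra.
apply/andP; split; first by rewrite !mulr_ge0.
have k3 : (b / 2 - s) * (b / 2 + s) <= ((b / 2) ^+ 3 / 2) * b.
  by apply: ler_pM => //; lra.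
lra.
Qed.

(** The minimum joins the cubic estimate for small [b] to a quadratic one for large [b], so that the
    bound is integrable under a second moment alone. *)
Lemma cos_taylor2 a b :
  `|cos (a + b) - (cos a - b * sin a - b ^+ 2 / 2 * cos a)| <=
  3 * (b ^+ 2 * Num.min 1 `|b|).
Proof.
have -> : cos (a + b) - (cos a - b * sin a - b ^+ 2 / 2 * cos a) =
  cos a * (cos b - 1 + b ^+ 2 / 2) - sin a * (sin b - b) by rewrite cosD; lra.
have bound : `|cos a * (cos b - 1 + b ^+ 2 / 2) - sin a * (sin b - b)| <=
    (cos b - 1 + b ^+ 2 / 2) + `|sin b - b|.
  apply: (le_trans (ler_normB _ _)); rewrite !normrM.
  have /andP[c0 _] := cos_sub_bound b; rewrite (ger0_norm c0).
  by apply: lerD; rewrite ler_piMl// ?cos_max ?sin_max.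
apply: (le_trans bound).
have /andP[c0 c1] := cos_sub_bound b; have s1 := sin_sub_bound b.
have n0 := normr_ge0 b; rewrite -(real_normK (num_real b)) in c0 c1 *.
have [b1|b1] := lerP 1 `|b|.
  rewrite mulr1; have := ler_normB (sin b) b; have := sin_max b; have := cos_le1 b; nra.
have : `|b| ^+ 4 <= `|b| ^+ 3 by rewrite ler_wiXn2l// ltW.
rewrite (_ : `|b| ^+ 2 * `|b| = `|b| ^+ 3); last by rewrite -exprSr.
have : 0 <= `|b| ^+ 3 by rewrite exprn_ge0.
lra.
Qed.

Lemma cos_lipschitz x y : `|cos x - cos y| <= `|x - y|.
Proof.
have -> : cos x - cos y = - 2 * sin ((x + y) / 2) * sin ((x - y) / 2).
  have -> : cos x = cos ((x + y) / 2 + (x - y) / 2) by congr cos; lra.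
  have -> : cos y = cos ((x + y) / 2 - (x - y) / 2) by congr cos; lra.
  by rewrite cosD cosB; lra.
rewrite !normrM normrN.
have := ler_norm_sin ((x - y) / 2); rewrite normrM (ger0_norm (_ : 0 <= 2^-1))//.
have := sin_max ((x + y) / 2); have := normr_ge0 (sin ((x - y) / 2)).
have -> : `|2| = 2 :> R by rewrite ger0_norm.
have := normr_ge0 (sin ((x + y) / 2)); nra.
Qed.

Lemma expRN_bound x : 0 <= x -> `|1 - x - expR (- x)| <= x ^+ 2.
Proof.
move=> x0; have h1 := expR_ge1Dx (- x); have h2 := expR_ge1Dx x.
rewrite ler_norml; apply/andP; split; last by have := sqr_ge0 x; lra.
have e0 := expR_gt0 (- x).
have : expR (- x) * expR x = 1 by rewrite -expRD addNr expR0.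
have : expR (- x) * (1 + x) <= expR (- x) * expR x by rewrite ler_pM2l.
move=> h3 h4; rewrite h4 in h3.
have x1 : 0 < 1 + x by lra.
rewrite -subr_ge0 -(pmulr_lge0 _ x1).
have := exprn_ge0 3 x0; rewrite !exprS expr0; nra.
Qed.

End trig_bounds.

(** * Steps of the walk *)

Section identical_distribution.
Context {dT : measure_display} {T : measurableType dT} {dS : measure_display}
  {S : measurableType dS} {R : realType} {P : probability T R}.
Variable X : nat -> {RV P >-> S}.
Hypothesis Xident : identically_distributed X.
Implicit Type f : S -> R.

Let ge0_integral_ident m (f : S -> \bar R) : measurable_fun setT f ->
  (forall s, (0 <= f s)%E) ->
  (\int[P]_w f (X m w) = \int[P]_w f (X 0%N w))%E.
Proof.
move=> mf f0; rewrite -!(ge0_integral_distribution (P := P) _ mf f0).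
by apply: eq_measure_integral => A mA _; exact: Xident.
Qed.

Lemma L1_ident m f : measurable_fun setT f ->
  L1 P (fun w => f (X 0%N w)) -> L1 P (fun w => f (X m w)).
Proof.
move=> mf /integrableP[_ fi]; apply/integrableP; split.
  by apply/measurable_EFinP; exact: measurableT_comp.
rewrite (ge0_integral_ident m (f := fun s => `|f s|%:E))//.
by apply/measurable_EFinP; exact: measurableT_comp.
Qed.

Lemma Er_ident m f : measurable_fun setT f -> L1 P (fun w => f (X 0%N w)) ->
  \int[P]_w f (X m w) = \int[P]_w f (X 0%N w).
Proof.
move=> mf fi; congr fine.
have mf' : measurable_fun setT (EFin \o f) by exact/measurable_EFinP.
rewrite -(integral_distribution (X := X m) mf' (L1_ident m mf fi)).
rewrite -(integral_distribution (X := X 0%N) mf' fi).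
by apply: eq_measure_integral => A mA _; exact: Xident.
Qed.

Lemma ae_ident m (A : set S) : measurable A ->
  {ae P, forall w, A (X 0%N w)} -> {ae P, forall w, A (X m w)}.
Proof.
move=> mA /negligibleP.
have mX k : measurable (X k @^-1` (~` A)).
  by apply: measurable_preimage => //; exact: measurableC.
move=> /(_ (mX 0%N)) h; apply/negligibleP; first exact: mX.
rewrite -h; exact: (Xident m 0%N (measurableC mA)).
Qed.

End identical_distribution.

Lemma ae_ident_mx (dT : measure_display) (T : measurableType dT) (dS : measure_display)
    (S : measurableType dS) (R : realType) (P : probability T R)
    (X : nat -> {RV P >-> S}) m p q (f : S -> 'M[R]_(p, q)) (A : 'M[R]_(p, q)) :
  identically_distributed X -> mx_measurable f ->
  {ae P, forall w, f (X 0%N w) = A} -> {ae P, forall w, f (X m w) = A}.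
Proof.
move=> Xident mf; apply: (ae_ident Xident m (A := [set s | f s = A])).
have -> : [set s | f s = A] =
    \bigcap_(ij in [set: 'I_p * 'I_q]) ((fun s => f s ij.1 ij.2) @^-1` [set A ij.1 ij.2]).
  apply/seteqP; split => s /=; first by move=> e ij _ /=; rewrite e.
  by move=> h; apply/matrixP => i j; exact: (h (i, j)).
apply: fin_bigcap_measurable => // ij _; apply: measurable_preimage; first exact: mf.
exact: measurable_set1.
Qed.

Section past_sums.
Context {dT : measure_display} {T : measurableType dT} {dS : measure_display}
  {S : measurableType dS} {R : realType} {P : probability T R}.
Variable X : nat -> {RV P >-> S}.
Hypotheses (Xindep : mutually_independent X) (Xident : identically_distributed X).
Variables (J : {fset nat}) (m : nat) (I : finType) (h : I -> T -> R)
  (f : I -> S -> R).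
Hypotheses (mJ : m \notin J)
  (mh : forall i, measurable_fun setT (h i : past X J -> R))
  (hi : forall i, L1 P (h i)) (mf : forall i, measurable_fun setT (f i))
  (fi : forall i, L1 P (fun w => f i (X 0%N w))).

Let fim i : L1 P (fun w => f i (X m w)).
Proof. exact: (L1_ident Xident). Qed.

Lemma L1_past_sum : L1 P (fun w => \sum_i h i w * f i (X m w)).
Proof. by apply: L1_sum => i; apply: (L1_past Xindep mJ). Qed.

(** This plays the role of conditioning on the past: in a finite sum of products, each factor
    depending on the present step is replaced by its mean. *)
Lemma Er_past_sum : \int[P]_w (\sum_i h i w * f i (X m w)) =
  \int[P]_w (\sum_i h i w * \int[P]_w f i (X 0%N w)).
Proof.
rewrite !Er_sum; last 2 first.
- by move=> i; exact: L1Zr.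
- by move=> i; apply: (L1_past Xindep mJ).
apply: eq_bigr => i _; rewrite ErZr// (Er_past Xindep mJ)//.
by rewrite (Er_ident Xident).
Qed.

End past_sums.

Lemma dotcv_quad (R : realType) d (u : 'cV[R]_d) (A : 'M[R]_d) :
  dotcv u (A *m u) = \sum_(ij : 'I_d * 'I_d) (u ij.1 0 * u ij.2 0) * A ij.1 ij.2.
Proof.
rewrite -(pair_bigA _ (fun i j => u i 0 * u j 0 * A i j))/=.
apply: eq_bigr => i _; rewrite mxE mulr_sumr; apply: eq_bigr => j _.
by rewrite -mulrA; congr (_ * _); rewrite mulrC.
Qed.

Lemma measurable_cos_comp (dT : measure_display) (T : measurableType dT)
    (R : realType) (f : T -> R) :
  measurable_fun setT f -> measurable_fun setT (fun w => cos (f w)).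
Proof.
by move=> mf; apply: (measurableT_comp _ mf); apply: continuous_measurable_fun; exact: continuous_cos.
Qed.

Lemma measurable_sin_comp (dT : measure_display) (T : measurableType dT)
    (R : realType) (f : T -> R) :
  measurable_fun setT f -> measurable_fun setT (fun w => sin (f w)).
Proof.
by move=> mf; apply: (measurableT_comp _ mf); apply: continuous_measurable_fun; exact: continuous_sin.
Qed.

(** * Expansion of one step *)

Section one_step.
Context {dT : measure_display} {T : measurableType dT} {dS : measure_display}
  {S : measurableType dS} {R : realType} {P : probability T R} {d : nat}.
Variable X : nat -> {RV P >-> S}.
Hypotheses (Xindep : mutually_independent X) (Xident : identically_distributed X).
Variables (th : S -> 'M[R]_d) (tr : S -> 'cV[R]_d).
Hypotheses (mth : mx_measurable th) (mtr : mx_measurable tr).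
Hypothesis thO : forall s, (th s)^T *m th s = 1%:M.
Hypothesis tr2 : L1 P (fun w => dotcv (tr (X 0%N w)) (tr (X 0%N w))).
Hypothesis tr0 : forall i, \int[P]_w tr (X 0%N w) i 0 = 0.

Definition cov_mx : 'M[R]_d :=
  \matrix_(i, j) \int[P]_w (tr (X 0%N w) i 0 * tr (X 0%N w) j 0).
Let C := cov_mx.

Let mtrX m i : measurable_fun setT (fun w => tr (X m w) i 0).
Proof. exact: (measurableT_comp (mtr i 0)). Qed.

Lemma L1_tr_sqr m : L1 P (fun w => dotcv (tr (X m w)) (tr (X m w))).
Proof.
apply: (L1_ident Xident m (f := fun s => dotcv (tr s) (tr s))) => //.
exact: measurable_dotcv.
Qed.

Lemma L1_tr_prod m i j : L1 P (fun w => tr (X m w) i 0 * tr (X m w) j 0).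
Proof.
have h k : L1 P (fun w => tr (X m w) k 0 ^+ 2).
  apply: L1_le (L1_tr_sqr m); first exact: measurable_funX.
  by move=> w; rewrite ger0_norm ?sqr_ge0// sqr_coord_le.
by apply: L1_mul.
Qed.

Lemma L1_tr m i : L1 P (fun w => tr (X m w) i 0).
Proof.
apply: L1_of_sqr => //.
by have := L1_tr_prod m i i; under [X in _.-integrable _ (_ \o X) -> _]eq_fun do rewrite -expr2.
Qed.

Lemma L1_enorm_tr m : L1 P (fun w => enorm (tr (X m w))).
Proof.
apply: L1_of_sqr.
  by apply: measurable_enorm => i j; rewrite (ord1 j).
by under [X in _.-integrable _ (_ \o X)]eq_fun do rewrite enorm_sqr; exact: L1_tr_sqr.
Qed.

Variables (J : {fset nat}) (m : nat) (rot : T -> 'M[R]_d) (ps : T -> 'cV[R]_d).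
Hypothesis mJ : m \notin J.
Hypothesis mrot : mx_measurable (rot : past X J -> 'M[R]_d).
Hypothesis mps : mx_measurable (ps : past X J -> 'cV[R]_d).
Hypothesis rotO : forall w, (rot w)^T *m rot w = 1%:M.
Variables (C0 D : 'M[R]_d).
Hypothesis CE : C = C0 + (D - mean_conj P (fun w => th (X 0%N w)) D).
Hypothesis rotC0 : {ae P, forall w, rot w *m C0 *m (rot w)^T = C0}.
Variables (u : 'cV[R]_d) (a c : R).
Hypothesis c0 : 0 <= c.

(** Pulling [u] back by the accumulated rotation gives a direction [p] that depends on the past
    alone, so the phase increment [be] pairs past with present. Primes mark values after the step;
    since [p'] is the transpose of [th] applied to [p], [eta'] is the form of [th D th^T] at [p]. *)
Let al w := c * dotcv u (ps w) + a.
Let p w : 'cV[R]_d := (rot w)^T *m u.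
Let be w := c * dotcv (p w) (tr (X m w)).
Let eta w := dotcv (p w) (D *m p w).
Let p' w : 'cV[R]_d := (rot w *m th (X m w))^T *m u.
Let eta' w := dotcv (p' w) (D *m p' w).
Let al' w := c * dotcv u (ps w + rot w *m tr (X m w)) + a.
Let q := dotcv u (C0 *m u).
Hypothesis q0 : 0 <= q.

Let al'E w : al' w = al w + be w.
Proof. by rewrite /al' /al /be dotcvDr /p dotcv_mull trmxK; lra. Qed.

Let mp : mx_measurable (p : past X J -> 'cV[R]_d).
Proof.
apply: mx_measurableM; first exact: mx_measurable_tr.
exact: mx_measurable_cst.
Qed.

Let mal : measurable_fun setT (al : past X J -> R).
Proof.
apply: measurable_funD => //; apply: measurable_funM => //.
by apply: measurable_dotcv => //; exact: mx_measurable_cst.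
Qed.

Let rotOr w : rot w *m (rot w)^T = 1%:M.
Proof. exact: mulmx1C. Qed.

Let p_norm w : dotcv (p w) (p w) = dotcv u u.
Proof. by rewrite /p dotcv_mull trmxK mulmxA rotOr mul1mx. Qed.

Let p'_norm w : dotcv (p' w) (p' w) = dotcv u u.
Proof.
rewrite /p' dotcv_mull trmxK trmx_mul -!mulmxA (mulmxA (th _)).
by rewrite (mulmx1C (thO _)) mul1mx mulmxA rotOr mul1mx.
Qed.

Let p_bound w i : `|p w i 0| <= enorm u.
Proof.
rewrite -(ler_pXn2r (n := 2))// ?nnegrE ?enorm_ge0// real_normK ?num_real//.
by rewrite enorm_sqr -(p_norm w) sqr_coord_le.
Qed.

Definition form_bound (Q : 'M[R]_d) (v : 'cV[R]_d) : R :=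
  \sum_(ij : 'I_d * 'I_d) enorm v ^+ 2 * `|Q ij.1 ij.2|.
Let K := form_bound D u.

Lemma form_bound_le (Q : 'M[R]_d) (v x : 'cV[R]_d) : dotcv x x = dotcv v v ->
  `|dotcv x (Q *m x)| <= form_bound Q v.
Proof.
move=> xv; rewrite dotcv_quad; apply: (le_trans (ler_norm_sum _ _ _)).
apply: ler_sum => -[i j] _ /=; rewrite normrM ler_wpM2r// normrM expr2.
have h k : `|x k 0| <= enorm v.
  rewrite -(ler_pXn2r (n := 2))// ?nnegrE ?enorm_ge0// real_normK ?num_real//.
  by rewrite enorm_sqr -xv sqr_coord_le.
exact: ler_pM.
Qed.

Lemma form_bound_ge0 (Q : 'M[R]_d) (v : 'cV[R]_d) : 0 <= form_bound Q v.
Proof. by apply: sumr_ge0 => i _; rewrite mulr_ge0// exprn_ge0// enorm_ge0. Qed.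

Let eta_bound w : `|eta w| <= K.
Proof. exact: form_bound_le. Qed.

Let eta'_bound w : `|eta' w| <= K.
Proof. exact: form_bound_le. Qed.

Let be_bound w : `|be w| <= c * enorm u * enorm (tr (X m w)).
Proof.
rewrite /be normrM (ger0_norm c0) -mulrA ler_wpM2l//.
by rewrite (le_trans (normr_dotcv_le _ _))// /enorm p_norm.
Qed.

(** The first-order term vanishes because the translation of the step is centred and independent of
    the past. *)
Let Er_lin (phi : T -> R) : measurable_fun setT (phi : past X J -> R) ->
  (forall w, `|phi w| <= 1) ->
  L1 P (fun w => phi w * be w) /\ \int[P]_w (phi w * be w) = 0.
Proof.
move=> mphi phi1.
have e w : phi w * be w =
    \sum_i (c * phi w * p w i 0) * tr (X m w) i 0.
  rewrite /be /dotcv !mulr_sumr; apply: eq_bigr => i _; lra.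
have mh i : measurable_fun setT ((fun w => c * phi w * p w i 0) : past X J -> R).
  by apply: measurable_funM; [exact: measurable_funM|exact: mp].
have hi i : L1 P (fun w => c * phi w * p w i 0).
  apply: (@L1_bounded _ _ _ _ _ (c * enorm u)); first exact: past_measurable (mh i).
  move=> w; rewrite -mulrA normrM (ger0_norm c0) ler_wpM2l// normrM.
  by rewrite -[leRHS]mul1r ler_pM.
split.
  under [X in _.-integrable _ (_ \o X)]eq_fun do rewrite e.
  by apply: (@L1_past_sum _ _ _ _ _ _ X Xindep Xident J m _ _ (fun i s => tr s i 0)) => // i; exact: L1_tr.
under eq_Rintegral do rewrite e.
rewrite (@Er_past_sum _ _ _ _ _ _ X Xindep Xident J m _ _ (fun i s => tr s i 0))//; last first.
  by move=> i; exact: L1_tr.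
under eq_Rintegral do under eq_bigr do rewrite tr0 mulr0.
by rewrite big1_eq Er_cst.
Qed.

Let Er_quad (phi : T -> R) (G : S -> 'M[R]_d) :
  measurable_fun setT (phi : past X J -> R) -> (forall w, `|phi w| <= 1) ->
  mx_measurable G -> (forall i j, L1 P (fun w => G (X 0%N w) i j)) ->
  L1 P (fun w => phi w * dotcv (p w) (G (X m w) *m p w)) /\
  \int[P]_w (phi w * dotcv (p w) (G (X m w) *m p w)) =
  \int[P]_w (phi w * dotcv (p w) ((\matrix_(i, j) \int[P]_w G (X 0%N w) i j) *m p w)).
Proof.
move=> mphi phi1 mG Gi.
have e (A : 'M[R]_d) w : phi w * dotcv (p w) (A *m p w) =
    \sum_(ij : 'I_d * 'I_d) (phi w * (p w ij.1 0 * p w ij.2 0)) * A ij.1 ij.2.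
  rewrite dotcv_quad mulr_sumr; apply: eq_bigr => ij _; lra.
have mh (ij : 'I_d * 'I_d) :
    measurable_fun setT ((fun w => phi w * (p w ij.1 0 * p w ij.2 0)) : past X J -> R).
  by apply: measurable_funM => //; apply: measurable_funM; exact: mp.
have hi (ij : 'I_d * 'I_d) : L1 P (fun w => phi w * (p w ij.1 0 * p w ij.2 0)).
  apply: (@L1_bounded _ _ _ _ _ (1 * (enorm u * enorm u))).
    exact: past_measurable (mh ij).
  by move=> w; rewrite !normrM; apply: ler_pM => //; exact: ler_pM.
split.
  under [X in _.-integrable _ (_ \o X)]eq_fun do rewrite e.
  by apply: (@L1_past_sum _ _ _ _ _ _ X Xindep Xident J m _ _ (fun ij s => G s ij.1 ij.2)).
under eq_Rintegral do rewrite e.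
rewrite (@Er_past_sum _ _ _ _ _ _ X Xindep Xident J m _ _ (fun ij s => G s ij.1 ij.2))//.
apply: eq_Rintegral => w _; rewrite e; apply: eq_bigr => ij _.
by rewrite !mxE.
Qed.

Let mcos : measurable_fun setT ((fun w => cos (al w)) : past X J -> R).
Proof. exact: measurable_cos_comp. Qed.

Let msin : measurable_fun setT ((fun w => sin (al w)) : past X J -> R).
Proof. exact: measurable_sin_comp. Qed.

Let cos1 w : `|cos (al w)| <= 1. Proof. exact: cos_max. Qed.
Let sin1 w : `|sin (al w)| <= 1. Proof. exact: sin_max. Qed.

Let cosbe2 : L1 P (fun w => cos (al w) * be w ^+ 2) /\
  \int[P]_w (cos (al w) * be w ^+ 2) =
  c ^+ 2 * \int[P]_w (cos (al w) * dotcv (p w) (C *m p w)).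
Proof.
have e w : cos (al w) * be w ^+ 2 = c ^+ 2 *
    (cos (al w) * dotcv (p w) ((tr (X m w) *m (tr (X m w))^T) *m p w)).
  rewrite -(mulmxA (tr _)) [_^T *m p w]mx11_scalar -dotcvE mul_mx_scalar dotcvZr.
  by rewrite (dotcvC (tr _)) /be; lra.
have GE s i j : (tr s *m (tr s)^T) i j = tr s i 0 * tr s j 0.
  by rewrite mxE big_ord1 mxE.
have [||h1 h2] := @Er_quad (fun w => cos (al w)) (fun s => tr s *m (tr s)^T) mcos cos1.
- by apply: mx_measurableM => //; exact: mx_measurable_tr.
- move=> i j; under [X in _.-integrable _ (_ \o X)]eq_fun do rewrite GE.
  exact: L1_tr_prod.
split.
  by under [X in _.-integrable _ (_ \o X)]eq_fun do rewrite e; exact: L1Z.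
under eq_Rintegral do rewrite e.
rewrite ErZ// h2; congr (_ * _); apply: eq_Rintegral => w _.
congr (_ * dotcv _ (_ *m _)); apply/matrixP => i j; rewrite !mxE.
by apply: eq_Rintegral => w' _; rewrite GE.
Qed.

Let coseta' : L1 P (fun w => cos (al w) * eta' w) /\
  \int[P]_w (cos (al w) * eta' w) = \int[P]_w (cos (al w) *
    dotcv (p w) (mean_conj P (fun w => th (X 0%N w)) D *m p w)).
Proof.
have e w : eta' w = dotcv (p w) ((th (X m w) *m D *m (th (X m w))^T) *m p w).
  rewrite /eta' (_ : p' w = (th (X m w))^T *m p w); last first.
    by rewrite /p' /p trmx_mul mulmxA.
  by rewrite dotcv_mull trmxK !mulmxA.
have mG : mx_measurable (fun s => th s *m D *m (th s)^T).
  apply: mx_measurableM; last exact: mx_measurable_tr.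
  by apply: mx_measurableM => //; exact: mx_measurable_cst.
have [|h1 h2] := @Er_quad (fun w => cos (al w)) (fun s => th s *m D *m (th s)^T) mcos cos1 mG.
  (* Conjugation by an orthogonal matrix preserves the Frobenius norm, so the norm of [D] bounds
     every entry of the conjugate. *)
  move=> i j; apply: (@L1_bounded _ _ _ _ _ (Num.sqrt (\tr (D *m D^T)))).
    exact: (measurableT_comp (mG i j)).
  move=> w; rewrite -(ler_pXn2r (n := 2))// ?nnegrE ?sqrtr_ge0// real_normK ?num_real//.
  rewrite -dotcv_mxcol sqr_sqrtr ?dotcv_ge0// -(conj_mx_iso (thO (X 0%N w))).
  by rewrite conj_mxE -mxcolE sqr_coord_le.
split.
  by under [X in _.-integrable _ (_ \o X)]eq_fun do rewrite e.
under eq_Rintegral do rewrite e.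
rewrite h2; apply: eq_Rintegral => w _.
by congr (_ * dotcv _ (_ *m _)); apply/matrixP => i j; rewrite !mxE.
Qed.

Let mrotT : mx_measurable rot.
Proof. by move=> i j; exact: past_measurable (mrot i j). Qed.
Let mthX : mx_measurable (fun w => th (X m w)).
Proof. by move=> i j; exact: (measurableT_comp (mth i j)). Qed.
Let mtrXm : mx_measurable (fun w => tr (X m w)).
Proof. by move=> i j; exact: (measurableT_comp (mtr i j)). Qed.
Let mpT : mx_measurable p.
Proof. by move=> i j; exact: past_measurable (mp i j). Qed.
Let mbe : measurable_fun setT be.
Proof. by apply: measurable_funM => //; exact: measurable_dotcv. Qed.
Let malT : measurable_fun setT al. Proof. exact: past_measurable mal. Qed.
Let mal' : measurable_fun setT al'.
Proof. by rewrite (funext al'E); exact: measurable_funD. Qed.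
Let meta : measurable_fun setT eta.
Proof.
by apply: measurable_dotcv => //; exact: mx_measurableM.
Qed.
Let meta' : measurable_fun setT eta'.
Proof.
have mp' : mx_measurable p'.
  apply: mx_measurableM; last exact: mx_measurable_cst.
  by apply: mx_measurable_tr; exact: mx_measurableM.
by apply: measurable_dotcv => //; exact: mx_measurableM.
Qed.

(** This identity dictates the corrector. The part [C0] contributes the constant [q], as the
    accumulated rotation fixes [C0]; the coboundary contributes the form of [D] at [p] minus its
    average after one more step, that is, the terms in [eta] and [eta']. *)
Let Ecosalp : \int[P]_w (cos (al w) * dotcv (p w) (C *m p w)) =
  q * \int[P]_w cos (al w) + \int[P]_w (cos (al w) * eta w)
  - \int[P]_w (cos (al w) * eta' w).
Proof.
have bd (Q : 'M[R]_d) : L1 P (fun w => cos (al w) * dotcv (p w) (Q *m p w)).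
  apply: (@L1_bounded _ _ _ _ _ (1 * form_bound Q u)).
    apply: measurable_funM; first exact: measurable_cos_comp.
    by apply: measurable_dotcv => //; exact: mx_measurableM.
  by move=> w; rewrite normrM; apply: ler_pM => //; exact: form_bound_le.
have [_ ->] := coseta'.
rewrite CE; set TD := mean_conj _ _ _.
transitivity (\int[P]_w (cos (al w) * dotcv (p w) (C0 *m p w) +
   (cos (al w) * eta w - cos (al w) * dotcv (p w) (TD *m p w)))).
  by apply: eq_Rintegral => w _; rewrite /eta mulmxDl mulmxBl dotcvDr dotcvBr; lra.
rewrite ErD//; last by apply: L1B => //; exact: bd.
rewrite ErB//; last exact: bd.
rewrite addrA; congr (_ + _ - _).
rewrite -ErZ; last first.
  by apply: (@L1_bounded _ _ _ _ _ 1) => //; exact: measurable_cos_comp.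
apply: Er_ae_eq.
- by apply: L1_measurable (bd C0).
- by apply: measurable_funM => //; exact: measurable_cos_comp.
apply: filterS rotC0 => w rC; rewrite mulrC; congr (_ * _).
rewrite /q -{2}rC /p dotcv_mull trmxK -!mulmxA.
by [].
Qed.

Definition truncated_moment : R := \int[P]_w
  (enorm (tr (X 0%N w)) ^+ 2 * Num.min 1 (c * enorm u * enorm (tr (X 0%N w)))).

(** The four terms are the costs, divided by [c ^+ 2], of replacing [1 - x] by [exp(-x)] at
    [x = c^2 q / 2], of the Taylor remainder, of exchanging the phases [al] and [al'] in front of
    [eta'], and of multiplying the corrector by [exp(-x)]. *)
Definition step_error : R :=
  c ^+ 2 * q ^+ 2 / 4 + 3 * enorm u ^+ 2 * truncated_moment +
  K * (c * enorm u * \int[P]_w enorm (tr (X 0%N w))) / 2 + c ^+ 2 * q * K / 4.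

Let rem w := cos (al' w) -
  (cos (al w) - be w * sin (al w) - be w ^+ 2 / 2 * cos (al w)).

Let trunc (s : S) := enorm (tr s) ^+ 2 * Num.min 1 (c * enorm u * enorm (tr s)).

Let mtrunc : measurable_fun setT trunc.
Proof.
have me := measurable_enorm mtr.
apply: measurable_funM; first exact: measurable_funX.
by apply: measurable_minr => //; exact: measurable_funM.
Qed.

Let cu0 s : 0 <= c * enorm u * enorm (tr s).
Proof. by rewrite !mulr_ge0 ?enorm_ge0. Qed.

Let trunc_ge0 s : 0 <= trunc s.
Proof. by rewrite mulr_ge0 ?sqr_ge0// le_min ler01 cu0. Qed.

Let L1_trunc k : L1 P (fun w => trunc (X k w)).
Proof.
apply: L1_le (L1_tr_sqr k); first exact: measurableT_comp.
move=> w; rewrite ger0_norm//.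
rewrite /trunc -enorm_sqr -[leRHS]mulr1 ler_wpM2l ?sqr_ge0//.
by rewrite ge_min lexx.
Qed.

Let rem_bound w : `|rem w| <= 3 * (c ^+ 2 * enorm u ^+ 2) * trunc (X m w).
Proof.
rewrite /rem al'E; apply: (le_trans (cos_taylor2 _ _)).
rewrite -mulrA ler_pM2l// /trunc mulrA; apply: ler_pM.
- exact: sqr_ge0.
- by rewrite le_min ler01 normr_ge0.
- rewrite -!exprMn -(real_normK (num_real (be w))) ler_pXn2r// nnegrE//.
- by rewrite le_min !ge_min lexx /= be_bound orbT.
Qed.

Let mrem : measurable_fun setT rem.
Proof.
have mc := measurable_cos_comp malT; have ms := measurable_sin_comp malT.
apply: measurable_funB; first exact: measurable_cos_comp.
apply: measurable_funB; first by apply: measurable_funB => //; exact: measurable_funM.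
by do 2 (apply: measurable_funM => //); exact: measurable_funX.
Qed.

Let L1_rem : L1 P rem.
Proof. by apply: (L1_le mrem rem_bound); apply: L1Z; exact: L1_trunc. Qed.

Let Erem_bound : `|\int[P]_w rem w| <= 3 * (c ^+ 2 * enorm u ^+ 2) * truncated_moment.
Proof.
apply: (le_trans (Er_norm_le mrem _ rem_bound)).
  by apply: L1Z; exact: L1_trunc.
rewrite ErZ; last exact: L1_trunc.
by rewrite (Er_ident Xident m mtrunc (L1_trunc 0%N)).
Qed.

Let Ecosal' : \int[P]_w cos (al' w) = \int[P]_w cos (al w)
  - c ^+ 2 / 2 * \int[P]_w (cos (al w) * dotcv (p w) (C *m p w)) + \int[P]_w rem w.
Proof.
have [i1 e1] := Er_lin msin sin1; have [i2 e2] := cosbe2.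
have i0 : L1 P (fun w => cos (al w)).
  by apply: (@L1_bounded _ _ _ _ _ 1) => //; exact: measurable_cos_comp.
have i3 := L1Z (1 / 2) i2.
transitivity (\int[P]_w (cos (al w) - sin (al w) * be w
    - (1 / 2) * (cos (al w) * be w ^+ 2) + rem w)).
  by apply: eq_Rintegral => w _; rewrite /rem; lra.
rewrite ErD//; last by apply: L1B => //; exact: L1B.
rewrite (ErB (L1B i0 i1) i3) (ErB i0 i1) ErZ// e1 e2; lra.
Qed.

Lemma one_step_estimate :
  `|\int[P]_w (cos (al' w) * (1 - c ^+ 2 / 2 * eta' w))
    - expR (- (c ^+ 2 * q / 2)) * \int[P]_w (cos (al w) * (1 - c ^+ 2 / 2 * eta w))|
  <= c ^+ 2 * step_error.
Proof.
have mc := measurable_cos_comp malT; have mc' := measurable_cos_comp mal'.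
have i0 : L1 P (fun w => cos (al w)) by apply: (@L1_bounded _ _ _ _ _ 1).
have i0' : L1 P (fun w => cos (al' w)).
  by apply: (@L1_bounded _ _ _ _ _ 1) => // w; exact: cos_max.
have b1 (f g : T -> R) : measurable_fun setT f -> measurable_fun setT g ->
    (forall w, `|f w| <= 1) -> (forall w, `|g w| <= K) -> L1 P (fun w => f w * g w).
  move=> mf mg f1 g1; apply: (@L1_bounded _ _ _ _ _ (1 * K)); first exact: measurable_funM.
  by move=> w; rewrite normrM; exact: ler_pM.
have cos1' w : `|cos (al' w)| <= 1 by exact: cos_max.
have i1 := b1 _ _ mc meta cos1 eta_bound.
have i2 := b1 _ _ mc meta' cos1 eta'_bound.
have i3 := b1 _ _ mc' meta' cos1' eta'_bound.
have -> : \int[P]_w (cos (al' w) * (1 - c ^+ 2 / 2 * eta' w)) =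
    \int[P]_w cos (al' w) - c ^+ 2 / 2 * \int[P]_w (cos (al' w) * eta' w).
  rewrite -ErZ// -ErB//; last exact: L1Z.
  by apply: eq_Rintegral => w _; lra.
have -> : \int[P]_w (cos (al w) * (1 - c ^+ 2 / 2 * eta w)) =
    \int[P]_w cos (al w) - c ^+ 2 / 2 * \int[P]_w (cos (al w) * eta w).
  rewrite -ErZ// -ErB//; last exact: L1Z.
  by apply: eq_Rintegral => w _; lra.
rewrite Ecosal' Ecosalp.
have e1 : \int[P]_w (cos (al w) * eta' w) - \int[P]_w (cos (al' w) * eta' w) =
    \int[P]_w ((cos (al w) - cos (al' w)) * eta' w).
  by rewrite -ErB//; apply: eq_Rintegral => w _; lra.
have e2 : `|\int[P]_w ((cos (al w) - cos (al' w)) * eta' w)| <=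
    K * (c * enorm u * \int[P]_w enorm (tr (X 0%N w))).
  have me : measurable_fun setT (fun s => enorm (tr s)) by exact: measurable_enorm.
  rewrite -(Er_ident Xident m me (L1_enorm_tr 0%N)) mulrA -ErZ; last exact: L1_enorm_tr.
  apply: Er_norm_le.
  - by apply: measurable_funM => //; exact: measurable_funB.
  - by apply: L1Z; exact: L1_enorm_tr.
  move=> w; rewrite normrM mulrC -mulrA; apply: ler_pM => //.
  apply: (le_trans (cos_lipschitz _ _)); rewrite al'E opprD addNKr normrN.
  exact: be_bound.
have e3 : `|\int[P]_w cos (al w)| <= 1 by exact: Er_bound.
have e4 : `|\int[P]_w (cos (al w) * eta w)| <= K.
  apply: Er_bound; first exact: measurable_funM.
  by move=> w; rewrite normrM -[leRHS]mul1r; exact: ler_pM.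
set x := c ^+ 2 * q / 2.
have x0 : 0 <= x by rewrite /x !mulr_ge0 ?sqr_ge0.
have e5 := expRN_bound x0.
have e6 : `|1 - expR (- x)| <= x.
  have := expR_ge1Dx (- x); have : expR (- x) <= 1 by rewrite -expR0 ler_expR oppr_le0.
  by move=> ? ?; rewrite ger0_norm; lra.
have e7 := Erem_bound.
move: e1 e2 e3 e4 e5 e6 e7.
set A := \int[P]_w cos (al w); set A1 := \int[P]_w (cos (al w) * eta w).
set A2 := \int[P]_w (cos (al w) * eta' w).
set A3 := \int[P]_w (cos (al' w) * eta' w).
set A4 := \int[P]_w ((_ - _) * _); set A5 := \int[P]_w rem w.
set l := expR (- x) => e1 e2 e3 e4 e5 e6 e7.
(* The terms in [D] of order [c ^+ 2] cancel up to the differences [A2 - A3], which is [A4], and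
   [(1 - l) * A1]; both are small with [c]. *)
have -> : A - c ^+ 2 / 2 * (q * A + A1 - A2) + A5 - c ^+ 2 / 2 * A3
    - l * (A - c ^+ 2 / 2 * A1) =
  (1 - x - l) * A + A5 + c ^+ 2 / 2 * A4 - c ^+ 2 / 2 * ((1 - l) * A1).
  by rewrite -e1 /x; lra.
have c20 : 0 <= c ^+ 2 / 2 by rewrite divr_ge0 ?sqr_ge0.
have f1 : `|(1 - x - l) * A| <= x ^+ 2 * 1 by rewrite normrM ler_pM.
have f2 : `|c ^+ 2 / 2 * A4| <= c ^+ 2 / 2 * (K * (c * enorm u * \int[P]_w enorm (tr (X 0%N w)))).
  by rewrite normrM (ger0_norm c20) ler_wpM2l.
have f3 : `|c ^+ 2 / 2 * ((1 - l) * A1)| <= c ^+ 2 / 2 * (x * K).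
  by rewrite normrM (ger0_norm c20) ler_wpM2l// normrM ler_pM.
apply: (le_trans (ler_normB _ _)); apply: (le_trans (lerD (ler_normD _ _) f3)).
apply: (le_trans (lerD (lerD (ler_normD _ _) f2) (lexx _))).
rewrite /step_error.
apply: (@le_trans _ _ (x ^+ 2 * 1 + 3 * (c ^+ 2 * enorm u ^+ 2) * truncated_moment +
  c ^+ 2 / 2 * (K * (c * enorm u * \int[P]_w enorm (tr (X 0%N w)))) + c ^+ 2 / 2 * (x * K))).
  by rewrite !lerD.
rewrite /x; lra.
Qed.

End one_step.

Lemma cvg_invsqrt (R : realType) : (Num.sqrt (n%:R : R))^-1 @[n --> \oo] --> (0 : R).
Proof.
apply/cvgr0Pnorm_lt => e e0; near=> n.
have n0 : e ^- 2 < n%:R :> R by near: n; exact: nbhs_infty_gtr.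
have s0 : 0 < Num.sqrt (n%:R : R).
  by rewrite sqrtr_gt0 (lt_trans _ n0)// invr_gt0 exprn_gt0.
rewrite ger0_norm ?invr_ge0 ?sqrtr_ge0// invf_plt ?posrE//.
rewrite -(@ger0_norm _ e^-1) ?invr_ge0 ?(ltW e0)// -sqrtr_sqr ltr_sqrt ?exprVn//.
by rewrite (lt_trans _ n0)// invr_gt0 exprn_gt0.
Unshelve. all: by end_near. Qed.

(** As [l <= 1], earlier errors are never amplified and merely add up. *)
Lemma linear_recursion_bound (R : realType) (G : nat -> R) (l e : R) n :
  0 <= l <= 1 -> 0 <= e ->
  (forall k, (k < n)%N -> `|G k.+1 - l * G k| <= e) ->
  `|G n - l ^+ n * G 0%N| <= n%:R * e.
Proof.
move=> /andP[l0 l1] e0; elim: n => [_|n IHn h].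
  by rewrite expr0 mul1r subrr normr0 mul0r.
have -> : G n.+1 - l ^+ n.+1 * G 0%N =
    (G n.+1 - l * G n) + l * (G n - l ^+ n * G 0%N) by rewrite exprS; lra.
apply: (le_trans (ler_normD _ _)); rewrite -natr1 mulrDl mul1r addrC.
apply: lerD; last exact: h.
rewrite normrM (ger0_norm l0).
have := IHn (fun k kn => h k (ltnW kn)); have := normr_ge0 (G n - l ^+ n * G 0%N); nra.
Qed.

(** * Iteration over the n steps *)

Section chain.
Context {dT : measure_display} {T : measurableType dT} {dS : measure_display}
  {S : measurableType dS} {R : realType} {P : probability T R} {d : nat}.
Variable X : nat -> {RV P >-> S}.
Hypotheses (Xindep : mutually_independent X) (Xident : identically_distributed X).
Variables (th : S -> 'M[R]_d) (tr : S -> 'cV[R]_d).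
Hypotheses (mth : mx_measurable th) (mtr : mx_measurable tr).
Hypothesis thO : forall s, (th s)^T *m th s = 1%:M.
Hypothesis tr2 : L1 P (fun w => dotcv (tr (X 0%N w)) (tr (X 0%N w))).
Hypothesis tr0 : forall i, \int[P]_w tr (X 0%N w) i 0 = 0.

(* The [n] steps are composed from the last to the first: at each stage the
   rotation accumulated so far is independent of the translation it is applied
   to, so that [rev_pos] has centred increments. *)
Fixpoint rev_rot n k w : 'M[R]_d :=
  if k is k'.+1 then rev_rot n k' w *m th (X (n - k'.+1)%N w) else 1%:M.

Fixpoint rev_pos n k w : 'cV[R]_d :=
  if k is k'.+1 then rev_pos n k' w + rev_rot n k' w *m tr (X (n - k'.+1)%N w)
  else 0.

Definition rev_idx n k : {fset nat} := [fset (n - (nat_of_ord j).+1)%N | j : 'I_k]%fset.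

(** The bound [k < n] guards against truncated subtraction, which for [k >= n > 0] would return the
    used index 0 again. *)
Lemma rev_idx_notin n k : (k < n)%N -> (n - k.+1)%N \notin rev_idx n k.
Proof.
move=> kn; apply/imfsetP => -[j /= _] e; have jk := ltn_ord j.
have := congr1 (subn n) e; rewrite !subKn// ?(ltn_trans jk)// => -[kj].
by move: jk; rewrite -kj ltnn.
Qed.

Lemma rev_idxS n k : {subset rev_idx n k <= rev_idx n k.+1}.
Proof.
move=> i /imfsetP[j /= _ ->].
by apply/imfsetP; exists (widen_ord (leqnSn k) j).
Qed.

Lemma rev_idx_last n k : (n - k.+1)%N \in rev_idx n k.+1.
Proof. by apply/imfsetP; exists (@ord_max k). Qed.

Let past_mxS n k m' n' (f : T -> 'M[R]_(m', n')) :
  mx_measurable (f : past X (rev_idx n k) -> 'M[R]_(m', n')) ->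
  mx_measurable (f : past X (rev_idx n k.+1) -> 'M[R]_(m', n')).
Proof. by move=> mf i j; apply: pastS (mf i j); exact: rev_idxS. Qed.

Let past_mx_last n k m' n' (f : S -> 'M[R]_(m', n')) : mx_measurable f ->
  mx_measurable ((fun w => f (X (n - k.+1)%N w)) : past X (rev_idx n k.+1) -> 'M[R]_(m', n')).
Proof.
by move=> mf i j; apply: (@past_comp _ _ _ _ _ _ X _ _ (fun s => f s i j)); [exact: rev_idx_last|exact: mf].
Qed.

Lemma past_rev_rot n k :
  mx_measurable (rev_rot n k : past X (rev_idx n k) -> 'M[R]_d).
Proof.
elim: k => [|k IHk]; first exact: mx_measurable_cst.
by apply: mx_measurableM; [exact: past_mxS|exact: past_mx_last].
Qed.

Lemma past_rev_pos n k :
  mx_measurable (rev_pos n k : past X (rev_idx n k) -> 'cV[R]_d).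
Proof.
elim: k => [|k IHk]; first exact: mx_measurable_cst.
apply: mx_measurableD; first exact: past_mxS.
by apply: mx_measurableM; [apply: past_mxS; exact: past_rev_rot|exact: past_mx_last].
Qed.

Lemma rev_rotO n k w : (rev_rot n k w)^T *m rev_rot n k w = 1%:M.
Proof.
elim: k => [|k IHk] /=; first by rewrite trmx1 mulmx1.
by rewrite trmx_mul -mulmxA (mulmxA _^T (rev_rot n k w)) IHk mul1mx thO.
Qed.

Let mX m : mx_measurable (fun w => th (X m w)).
Proof. by move=> i j; exact: (measurableT_comp (mth i j)). Qed.

Variables (C0 D : 'M[R]_d).
Hypothesis CE : cov_mx X tr = C0 + (D - mean_conj P (fun w => th (X 0%N w)) D).
Hypothesis C0fix : mean_conj P (fun w => th (X 0%N w)) C0 = C0.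

Let thC0 m : {ae P, forall w, th (X m w) *m C0 *m (th (X m w))^T = C0}.
Proof.
apply: (@ae_ident_mx _ _ _ _ _ _ _ _ _ _ (fun s => th s *m C0 *m (th s)^T)) => //.
  apply: mx_measurableM; last exact: mx_measurable_tr.
  by apply: mx_measurableM => //; exact: mx_measurable_cst.
by apply: mean_conj_fixed_ae C0fix => //; exact: mX.
Qed.

Lemma rev_rotC0 n k :
  {ae P, forall w, rev_rot n k w *m C0 *m (rev_rot n k w)^T = C0}.
Proof.
elim: k => [|k IHk]; first by apply: aeW => w; rewrite /= mul1mx trmx1 mulmx1.
apply: filterS2 IHk (thC0 (n - k.+1)%N) => w e1 e2 /=.
by rewrite trmx_mul -!mulmxA (mulmxA (th _) C0) (mulmxA (th _ *m C0)) e2 mulmxA.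
Qed.

Variables (u : 'cV[R]_d) (a : R).
Let q := dotcv u (C0 *m u).
Hypothesis q0 : 0 <= q.

Lemma rev_pos_cf_bound n c : 0 <= c -> n%:R * c ^+ 2 = 1 ->
  `|\int[P]_w cos (c * dotcv u (rev_pos n n w) + a) - expR (- (q / 2)) * cos a|
  <= step_error X tr C0 D u c + c ^+ 2 * form_bound D u.
Proof.
move=> c0 nc.
pose al k w := c * dotcv u (rev_pos n k w) + a.
pose eta k w := dotcv ((rev_rot n k w)^T *m u) (D *m ((rev_rot n k w)^T *m u)).
(* The corrector [eta] absorbs the coboundary [D - mean_conj D] in the
   decomposition of the covariance, leaving only the invariant part [C0]. *)
pose G k := \int[P]_w (cos (al k w) * (1 - c ^+ 2 / 2 * eta k w)).
have step k : (k < n)%N -> `|G k.+1 - expR (- (c ^+ 2 * q / 2)) * G k| <=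
    c ^+ 2 * step_error X tr C0 D u c.
  move=> kn; have kJ := rev_idx_notin kn.
  exact: (one_step_estimate Xindep Xident mth mtr thO tr2 tr0 kJ (@past_rev_rot n k)
    (@past_rev_pos n k) (rev_rotO n k) CE (rev_rotC0 n k) a c0 q0).
have l01 : 0 <= expR (- (c ^+ 2 * q / 2)) <= 1.
  by rewrite expR_ge0 -expR0 ler_expR oppr_le0 divr_ge0// mulr_ge0// sqr_ge0.
have err0 : 0 <= c ^+ 2 * step_error X tr C0 D u c.
  have K0 := form_bound_ge0 D u; have u0 := enorm_ge0 u.
  rewrite mulr_ge0 ?sqr_ge0// /step_error !addr_ge0//.
  - by rewrite divr_ge0// mulr_ge0 ?sqr_ge0.
  - rewrite !mulr_ge0 ?sqr_ge0//; apply: Er_ge0 => w.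
    by rewrite mulr_ge0 ?sqr_ge0// le_min ler01 !mulr_ge0 ?enorm_ge0.
  - rewrite divr_ge0// !mulr_ge0//; apply: Er_ge0 => w; exact: enorm_ge0.
  - by rewrite divr_ge0// !mulr_ge0// ?sqr_ge0.
(* With [n c^2 = 1] the multiplier raised to the power [n] is [exp(-q/2)], and the [n] errors of
   size [c^2 * step_error] add up to one [step_error]. *)
have := linear_recursion_bound l01 err0 step.
rewrite mulrA nc mul1r -expRM_natl.
rewrite mulrN 2!mulrA nc mul1r.
have G0 : G 0%N = cos a * (1 - c ^+ 2 / 2 * dotcv u (D *m u)).
  rewrite /G /al /eta /= dotcv0r mulr0 add0r trmx1 mul1mx.
  by rewrite Er_cst.
rewrite G0 => h.
have mal : measurable_fun setT (al n).
  have mps : mx_measurable (rev_pos n n).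
    by move=> i j; exact: past_measurable (@past_rev_pos n n i j).
  apply: measurable_funD => //; apply: measurable_funM => //.
  by apply: measurable_dotcv => //; exact: mx_measurable_cst.
have meta : measurable_fun setT (eta n).
  have mrot : mx_measurable (rev_rot n n).
    by move=> i j; exact: past_measurable (@past_rev_rot n n i j).
  have mp : mx_measurable (fun w => (rev_rot n n w)^T *m u).
    by apply: mx_measurableM; [exact: mx_measurable_tr|exact: mx_measurable_cst].
  by apply: measurable_dotcv => //; apply: mx_measurableM => //; exact: mx_measurable_cst.
have mc : measurable_fun setT (fun w => cos (al n w)) by exact: measurable_cos_comp.
have K1 w : `|eta n w| <= form_bound D u.
  apply: form_bound_le; rewrite dotcv_mull trmxK mulmxA.
  by rewrite (mulmx1C (rev_rotO n n w)) mul1mx.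
have i1 : L1 P (fun w => cos (al n w)).
  by apply: (@L1_bounded _ _ _ _ _ 1) => // w; exact: cos_max.
have i2 : L1 P (fun w => cos (al n w) * eta n w).
  apply: (@L1_bounded _ _ _ _ _ (1 * form_bound D u)); first exact: measurable_funM.
  by move=> w; rewrite normrM ler_pM// cos_max.
have GE : G n = \int[P]_w cos (al n w) - c ^+ 2 / 2 * \int[P]_w (cos (al n w) * eta n w).
  rewrite /G -ErZ// -ErB//; last exact: L1Z.
  by apply: eq_Rintegral => w _; lra.
have e2 : `|\int[P]_w (cos (al n w) * eta n w)| <= form_bound D u.
  apply: Er_bound; first exact: measurable_funM.
  by move=> w; rewrite normrM -[leRHS]mul1r ler_pM// cos_max.
have e3 : `|expR (- (q / 2)) * (cos a * dotcv u (D *m u))| <= form_bound D u.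
  rewrite normrM -[leRHS]mul1r ler_pM//.
    by rewrite ger0_norm ?expR_ge0// -expR0 ler_expR oppr_le0 divr_ge0.
  by rewrite normrM -[leRHS]mul1r ler_pM// ?cos_max// form_bound_le.
rewrite GE in h.
set A := \int[P]_w cos _ in h *; set B := \int[P]_w (_ * _) in h e2.
set E := expR _ in h e3 *.
(* The corrector is removed at both ends of the chain, each time at cost at most
   [c^2 / 2 * form_bound D u]. *)
have -> : A - E * cos a = (A - c ^+ 2 / 2 * B - E * (cos a * (1 - c ^+ 2 / 2 * dotcv u (D *m u))))
   + (c ^+ 2 / 2 * B - c ^+ 2 / 2 * (E * (cos a * dotcv u (D *m u)))) by lra.
apply: (le_trans (ler_normD _ _)); apply: lerD => //.
have c20 : 0 <= c ^+ 2 / 2 by rewrite divr_ge0 ?sqr_ge0.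
have scaled (y : R) : `|y| <= form_bound D u -> `|c ^+ 2 / 2 * y| <= c ^+ 2 / 2 * form_bound D u.
  by move=> ?; rewrite normrM (ger0_norm c20) ler_wpM2l.
have := scaled _ e2; have := scaled _ e3; have := ler_normB (c ^+ 2 / 2 * B)
  (c ^+ 2 / 2 * (E * (cos a * dotcv u (D *m u)))); lra.
Qed.

Lemma step_error_cvg (c : nat -> R) : (forall n, 0 <= c n) -> c n @[n --> \oo] --> (0 : R) ->
  step_error X tr C0 D u (c n) @[n --> \oo] --> (0 : R).
Proof.
move=> c0 cc.
have cc2 : c n ^+ 2 @[n --> \oo] --> (0 : R).
  rewrite -[X in _ --> X](mul0r (0 : R)); exact: cvgM.
(* Dominated convergence: the minimum tends to 0 pointwise, and the integrand stays below the
   integrable [|tr|^2]. *)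
have ct : truncated_moment X tr u (c n) @[n --> \oo] --> (0 : R).
  pose f n w := enorm (tr (X 0%N w)) ^+ 2 * Num.min 1 (c n * enorm u * enorm (tr (X 0%N w))).
  have mtrX : mx_measurable (fun w => tr (X 0%N w)).
    by move=> i j; exact: (measurableT_comp (mtr i j)).
  have me : measurable_fun setT (fun w => enorm (tr (X 0%N w))) by exact: measurable_enorm.
  have := @Er_cvg _ _ _ P f (fun=> 0) (fun w => dotcv (tr (X 0%N w)) (tr (X 0%N w))).
  rewrite Er_cst; apply => //.
  - move=> n; apply: measurable_funM; first exact: measurable_funX.
    by apply: measurable_minr => //; exact: measurable_funM.
  - move=> w; rewrite -[X in _ --> X](mulr0 (enorm (tr (X 0%N w)) ^+ 2)).
    apply: cvgM; first exact: cvg_cst.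
    apply: (@squeeze_cvgr _ _ _ _ (fun=> 0) (fun n => c n * (enorm u * enorm (tr (X 0%N w))))).
    - by apply: nearW => n; rewrite -mulrA le_min ler01 ge_min lexx orbT mulr_ge0// mulr_ge0// enorm_ge0.
    - exact: cvg_cst.
    - rewrite -(mul0r (enorm u * enorm (tr (X 0%N w)))); exact: cvgMr_tmp.
  - move=> n w; rewrite ger0_norm.
      by rewrite -enorm_sqr -[leRHS]mulr1 ler_wpM2l ?sqr_ge0// ge_min lexx.
    by rewrite mulr_ge0 ?sqr_ge0// le_min ler01 !mulr_ge0 ?enorm_ge0.
rewrite /step_error.
rewrite [X in _ --> X](_ : _ = 0 * q ^+ 2 / 4 + 3 * enorm u ^+ 2 * 0 +
  form_bound D u * (0 * enorm u * \int[P]_w enorm (tr (X 0%N w))) / 2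
  + 0 * q * form_bound D u / 4); last by lra.
apply: cvgD; last by do 3 apply: cvgMr_tmp.
apply: cvgD; last by apply: cvgMr_tmp; apply: cvgMl_tmp; do 2 apply: cvgMr_tmp.
by apply: cvgD; [do 2 apply: cvgMr_tmp|exact: cvgMl_tmp].
Qed.

Fixpoint fwd_pos (y0 : 'cV[R]_d) l w : 'cV[R]_d :=
  if l is l'.+1 then th (X l' w) *m fwd_pos y0 l' w + tr (X l' w) else y0.

(** The reversal holds for every outcome and not just in law: the same affine maps are composed,
    grouped from the last one. *)
Lemma fwd_pos_rev y0 n k w : (k <= n)%N ->
  fwd_pos y0 n w = rev_rot n k w *m fwd_pos y0 (n - k) w + rev_pos n k w.
Proof.
elim: k => [_|k IHk kn]; first by rewrite subn0 mul1mx addr0.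
rewrite (IHk (ltnW kn)) -(subnSK kn) /= mulmxDr mulmxA -!addrA.
by congr (_ + _); rewrite addrC.
Qed.

Lemma fwd_posE y0 n w : fwd_pos y0 n w = rev_rot n n w *m y0 + rev_pos n n w.
Proof. by rewrite (fwd_pos_rev y0 w (leqnn n)) subnn. Qed.

Let mrev_pos n k : mx_measurable (rev_pos n k).
Proof. by move=> i j; exact: past_measurable (@past_rev_pos n k i j). Qed.

Let mrev_rot n k : mx_measurable (rev_rot n k).
Proof. by move=> i j; exact: past_measurable (@past_rev_rot n k i j). Qed.

Lemma measurable_fwd_pos y0 n : mx_measurable (fwd_pos y0 n).
Proof.
rewrite (funext (fwd_posE y0 n)); apply: mx_measurableD => //.
by apply: mx_measurableM => //; exact: mx_measurable_cst.
Qed.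

Let rot_norm n k w x : dotcv (rev_rot n k w *m x) (rev_rot n k w *m x) = dotcv x x.
Proof. by rewrite dotcv_mull mulmxA rev_rotO mul1mx. Qed.

Let rotT_norm n k w x :
  dotcv ((rev_rot n k w)^T *m x) ((rev_rot n k w)^T *m x) = dotcv x x.
Proof. by rewrite dotcv_mull trmxK mulmxA (mulmx1C (rev_rotO n k w)) mul1mx. Qed.

Let V := \int[P]_w dotcv (tr (X 0%N w)) (tr (X 0%N w)).

(** The increments are orthogonal: the cross term pairs the centred translation of the new step with
    [r], a function of the past. Rotations do not change norms. *)
Lemma rev_pos_sqr n k : (k <= n)%N ->
  L1 P (fun w => dotcv (rev_pos n k w) (rev_pos n k w)) /\
  \int[P]_w dotcv (rev_pos n k w) (rev_pos n k w) = k%:R * V.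
Proof.
elim: k => [_|k IHk kn].
  split.
    apply: (@L1_bounded _ _ _ _ _ 0) => [|w]; first exact: measurable_dotcv.
    by rewrite dotcv0l normr0.
  by rewrite mul0r -[RHS](Er_cst P); apply: eq_Rintegral => w _; rewrite dotcv0l.
have [i1 e1] := IHk (ltnW kn).
pose r w := (rev_rot n k w)^T *m rev_pos n k w.
pose m := (n - k.+1)%N.
have mr : mx_measurable (r : past X (rev_idx n k) -> 'cV[R]_d).
  by apply: mx_measurableM; [apply: mx_measurable_tr; exact: past_rev_rot|exact: past_rev_pos].
have i2 i : L1 P (fun w => r w i 0).
  apply: L1_of_sqr; first exact: past_measurable (mr i 0).
  apply: L1_le i1 => [|w]; first by apply: measurable_funX; exact: past_measurable (mr i 0).
  by rewrite ger0_norm ?sqr_ge0// -(rotT_norm n k w) sqr_coord_le.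
have mJ := rev_idx_notin kn.
have i3 : L1 P (fun w => dotcv (r w) (tr (X m w))).
  apply: (@L1_past_sum _ _ _ _ _ _ X Xindep Xident (rev_idx n k) m _ (fun i w => r w i 0)
    (fun i s => tr s i 0)) => // i; exact: (L1_tr Xident mtr tr2).
have e3 : \int[P]_w dotcv (r w) (tr (X m w)) = 0.
  rewrite (@Er_past_sum _ _ _ _ _ _ X Xindep Xident (rev_idx n k) m _ (fun i w => r w i 0)
    (fun i s => tr s i 0))//; last by move=> i; exact: (L1_tr Xident mtr tr2).
  under eq_Rintegral do under eq_bigr do rewrite tr0 mulr0.
  by rewrite big1_eq Er_cst.
have i4 := L1_tr_sqr Xident mtr tr2 m.
have e w : dotcv (rev_pos n k.+1 w) (rev_pos n k.+1 w) =
    dotcv (rev_pos n k w) (rev_pos n k w) + (2 * dotcv (r w) (tr (X m w)) +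
      dotcv (tr (X m w)) (tr (X m w))).
  have -> : dotcv (r w) (tr (X m w)) = dotcv (rev_pos n k w) (rev_rot n k w *m tr (X m w)).
    by rewrite /r dotcv_mull trmxK.
  rewrite /= -/m !(dotcvDl, dotcvDr) rot_norm.
  by rewrite (dotcvC (rev_rot _ _ _ *m _)); lra.
split.
  under [X in _.-integrable _ (_ \o X)]eq_fun do rewrite e.
  by apply: L1D => //; apply: L1D => //; exact: L1Z.
under eq_Rintegral do rewrite e.
rewrite ErD//; last by apply: L1D => //; exact: L1Z.
rewrite ErD//; last exact: L1Z.
rewrite ErZ// e3 e1 mulr0 add0r -natr1 mulrDl mul1r; congr (_ + _).
by apply: (Er_ident Xident m (f := fun s => dotcv (tr s) (tr s))) => //; exact: measurable_dotcv.
Qed.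

Let c_ n : R := (Num.sqrt n%:R)^-1.

Let c_ge0 n : 0 <= c_ n. Proof. by rewrite invr_ge0 sqrtr_ge0. Qed.

Let c_sqr n : (0 < n)%N -> n%:R * c_ n ^+ 2 = 1.
Proof. by move=> n0; rewrite exprVn sqr_sqrtr ?mulfV// pnatr_eq0 -lt0n. Qed.

Lemma fwd_pos_tight y0 n :
  L1 P (fun w => dotcv (c_ n *: fwd_pos y0 n w) (c_ n *: fwd_pos y0 n w)) /\
  \int[P]_w dotcv (c_ n *: fwd_pos y0 n w) (c_ n *: fwd_pos y0 n w)
    <= 2 * dotcv y0 y0 + 2 * V.
Proof.
have [i1 e1] := rev_pos_sqr (leqnn n).
have V0 : 0 <= V by apply: Er_ge0 => w; exact: dotcv_ge0.
have i2 : L1 P (fun w => c_ n ^+ 2 * (2 * dotcv y0 y0 +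
    2 * dotcv (rev_pos n n w) (rev_pos n n w))).
  by apply: L1Z; apply: L1D; [exact: L1_cst|exact: L1Z].
have le w : dotcv (c_ n *: fwd_pos y0 n w) (c_ n *: fwd_pos y0 n w) <=
    c_ n ^+ 2 * (2 * dotcv y0 y0 + 2 * dotcv (rev_pos n n w) (rev_pos n n w)).
  rewrite dotcvZl dotcvZr mulrA -expr2 ler_wpM2l ?sqr_ge0// fwd_posE.
  have := dotcv_ge0 (rev_rot n n w *m y0 - rev_pos n n w).
  rewrite !(dotcvBl, dotcvBr, dotcvDl, dotcvDr) rot_norm (dotcvC (rev_pos n n w)); lra.
have i3 : L1 P (fun w => dotcv (c_ n *: fwd_pos y0 n w) (c_ n *: fwd_pos y0 n w)).
  apply: L1_le i2 => [|w]; last by rewrite ger0_norm ?dotcv_ge0.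
  have m1 : mx_measurable (fun w => c_ n *: fwd_pos y0 n w).
    by apply: mx_measurableZ; exact: measurable_fwd_pos.
  exact: measurable_dotcv.
split => //; apply: (le_trans (Er_le i3 i2 le)).
rewrite ErZ; last by apply: L1D; [exact: L1_cst|exact: L1Z].
rewrite ErD; [|exact: L1_cst|exact: L1Z].
rewrite Er_cst ErZ// e1.
(* At [n = 0] the scale is 0, by the convention [0^-1 = 0]. *)
have [->|n0] := posnP n.
  by rewrite /c_ sqrtr0 invr0 expr0n mul0r addr_ge0// mulr_ge0 ?dotcv_ge0.
have := c_sqr n0; have := sqr_ge0 (c_ n); have y2 := dotcv_ge0 y0.
have n1 : (1 : R) <= n%:R by rewrite ler1n.
move: (c_ n ^+ 2) (n%:R : R) n1 => b N N1 b0 Nb.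
have b1 : b <= 1 by nra.
have -> : b * (2 * dotcv y0 y0 + 2 * (N * V)) = 2 * (b * dotcv y0 y0) + 2 * (N * b * V) by lra.
rewrite Nb; nra.
Qed.

Lemma fwd_pos_cf y0 :
  \int[P]_w cos (dotcv u (c_ n *: fwd_pos y0 n w) + a) @[n --> \oo] -->
  expR (- (q / 2)) * cos a.
Proof.
have cc : c_ n @[n --> \oo] --> (0 : R) by exact: cvg_invsqrt.
pose b n := step_error X tr C0 D u (c_ n) + c_ n * c_ n * form_bound D u +
  c_ n * (enorm u * enorm y0).
have b0 : b n @[n --> \oo] --> (0 : R).
  rewrite [X in _ --> X](_ : 0 = 0 + 0 * 0 * form_bound D u + 0 * (enorm u * enorm y0)); last by lra.
  apply: cvgD; last exact: cvgMr_tmp.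
  apply: cvgD; last by apply: cvgMr_tmp; exact: cvgM.
  exact: step_error_cvg.
apply/cvgrPdist_le => e e0; have /cvgr0Pnorm_le/(_ e e0) := b0.
move=> be; near=> n; rewrite distrC.
have n0 : (0 < n)%N by near: n; exact: nbhs_infty_gt.
have be' : `|b n| <= e by near: n.
apply: le_trans be'; apply: le_trans (ler_norm _).
have := rev_pos_cf_bound (c_ge0 n) (c_sqr n0); rewrite expr2 => h1.
have mpos : mx_measurable (rev_pos n n) by [].
have mfwd := measurable_fwd_pos y0 n.
have i1 : L1 P (fun w => cos (dotcv u (c_ n *: fwd_pos y0 n w) + a)).
  apply: (@L1_bounded _ _ _ _ _ 1) => [|w]; last exact: cos_max.
  apply: measurable_cos_comp; apply: measurable_funD => //.
  by apply: measurable_dotcv; [exact: mx_measurable_cst|exact: mx_measurableZ].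
have i2 : L1 P (fun w => cos (c_ n * dotcv u (rev_pos n n w) + a)).
  apply: (@L1_bounded _ _ _ _ _ 1) => [|w]; last exact: cos_max.
  apply: measurable_cos_comp; apply: measurable_funD => //.
  by apply: measurable_funM => //; apply: measurable_dotcv => //; exact: mx_measurable_cst.
(* The starting point enters only through its rotated image, of constant norm, so it shifts the
   phase by [O(c_ n)]. *)
have h2 : `|\int[P]_w cos (dotcv u (c_ n *: fwd_pos y0 n w) + a) -
    \int[P]_w cos (c_ n * dotcv u (rev_pos n n w) + a)| <= c_ n * (enorm u * enorm y0).
  rewrite -ErB//; apply: Er_bound => [|w].
    by apply: measurable_funB; exact: (L1_measurable (P := P)).
  apply: (le_trans (cos_lipschitz _ _)).
  have -> : dotcv u (c_ n *: fwd_pos y0 n w) + a - (c_ n * dotcv u (rev_pos n n w) + a) =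
      c_ n * dotcv u (rev_rot n n w *m y0).
    by rewrite dotcvZr fwd_posE dotcvDr; lra.
  rewrite normrM (ger0_norm (c_ge0 n)) ler_wpM2l//.
  by apply: (le_trans (normr_dotcv_le _ _)); rewrite /enorm rot_norm.
rewrite /b; move: h1 h2; set A := \int[P]_w _; set B := \int[P]_w _ => h1 h2.
rewrite (_ : B - _ = (B - A) + (A - expR (- (q / 2)) * cos a)); last by lra.
apply: (le_trans (ler_normD _ _)); lra.
Unshelve. all: by end_near. Qed.

End chain.

(** * Weak convergence from characteristic functions *)

(** Only [x] is confined to the cube. Compactness is used through near-coverings with the filter of
    small positive [eta]; row vectors enter because [rV_compact] is about them. *)
Lemma continuous_unif_cube (R : realType) d (f : 'cV[R]_d -> R) (L e : R) :
  continuous f -> 0 < e -> exists2 eta, 0 < eta & forall x y : 'cV[R]_d,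
    (forall i, `|x i 0| <= L) -> (forall i, `|x i 0 - y i 0| <= eta) ->
    `|f x - f y| <= e.
Proof.
move=> cf e0.
have : compact [set v : 'rV[R]_d | forall i, `[(- L), L]%classic (v ord0 i)].
  apply: (@rV_compact _ _ (fun=> `[(- L), L]%classic)) => _.
  exact: segment_compact.
move=> /compact_near_coveringP /(_ R (0 : R)^'+
  (fun eta v => forall y : 'cV[R]_d, (forall i, `|v ord0 i - y i 0| <= eta) ->
     `|f v^T - f y| <= e)).
case.
- move=> v _.
  have e2 : 0 < e / 2 by rewrite divr_gt0.
  have := cf v^T; move=> /cvgrPdist_lt /(_ _ e2) /nbhs_ballP[r /= r0 br].
  have r2 : 0 < r / 2 by rewrite divr_gt0.
  have vr (y : 'cV[R]_d) : (forall i, `|v ord0 i - y i 0| < r) -> `|f v^T - f y| < e / 2.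
    move=> h; apply: br; split => // i j; rewrite (ord1 j) mxE.
    by rewrite -ball_normE; exact: h.
  exists (ball v (r / 2), [set eta | eta < r / 2]).
    split => /=; first exact: nbhsx_ballx.
    exact: nbhs_right_lt.
  move=> [v' eta] /= [[_ bv] etar] y yv.
  have bv' i : `|v ord0 i - v' ord0 i| < r / 2.
    by have := bv ord0 i; rewrite -ball_normE.
  rewrite (_ : f v'^T - f y = (f v^T - f y) - (f v^T - f v'^T)); last by lra.
  apply: (le_trans (ler_normB _ _)).
  suff : `|f v^T - f y| < e / 2 /\ `|f v^T - f v'^T| < e / 2 by lra.
  split; apply: vr => i.
    rewrite (_ : v ord0 i - y i 0 = (v ord0 i - v' ord0 i) + (v' ord0 i - y i 0)); last by lra.
    rewrite (le_lt_trans (ler_normD _ _))//; have := bv' i; have := yv i; lra.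
  by rewrite mxE; have := bv' i; lra.
move=> r /= r0 h; exists (r / 2); first by rewrite divr_gt0.
move=> x y xL xy.
have rb : `|0 - r / 2| < r by rewrite sub0r normrN gtr0_norm ?divr_gt0//; lra.
have r20 : 0 < r / 2 by rewrite divr_gt0.
have := h (r / 2) rb r20 x^T; rewrite trmxK; apply.
- by move=> i /=; rewrite in_itv /= -ler_norml mxE; exact: xL.
- by move=> i; rewrite mxE.
Qed.

(** * Approximation by trigonometric polynomials *)

Section trigonometric_polynomials.
Context {R : realType} {d : nat}.
Implicit Types (F G : 'cV[R]_d -> R) (s : seq (R * 'cV[R]_d * R)).

(** A triple holds amplitude, frequency and phase. Free phases put sines into the real span of these
    cosines and make it closed under products. *)
Definition trig_eval s (x : 'cV[R]_d) : R :=
  \sum_(t <- s) t.1.1 * cos (dotcv t.1.2 x + t.2).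

Definition trig_poly F := exists s, F = trig_eval s.

Lemma trig_poly_cst (c : R) : trig_poly (fun=> c).
Proof.
exists [:: (c, 0, 0)]; apply/funext => x.
by rewrite /trig_eval big_seq1 /= dotcv0l addr0 cos0 mulr1.
Qed.

Lemma trig_polyD F G : trig_poly F -> trig_poly G -> trig_poly (fun x => F x + G x).
Proof.
move=> [s ->] [r ->]; exists (s ++ r).
by apply/funext => x; rewrite /trig_eval big_cat.
Qed.

Lemma trig_polyM F G : trig_poly F -> trig_poly G -> trig_poly (fun x => F x * G x).
Proof.
move=> [s ->] [r ->].
have mono t : trig_poly (fun x : 'cV[R]_d =>
    t.1.1 * cos (dotcv t.1.2 x + t.2) * trig_eval r x).
  exists (flatten [seq [:: (t.1.1 * t'.1.1 / 2, t.1.2 + t'.1.2, t.2 + t'.2);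
    (t.1.1 * t'.1.1 / 2, t.1.2 - t'.1.2, t.2 - t'.2)] | t' <- r]).
  apply/funext => x; rewrite /trig_eval big_flatten big_map mulr_sumr.
  apply: eq_bigr => t' _; rewrite big_cons big_seq1 /= dotcvDl dotcvBl.
  set A := dotcv t.1.2 x; set B := dotcv t'.1.2 x.
  have -> : A + B + (t.2 + t'.2) = (A + t.2) + (B + t'.2) by lra.
  have -> : A - B + (t.2 - t'.2) = (A + t.2) - (B + t'.2) by lra.
  by rewrite (cosD (A + t.2)) cosB; lra.
elim: s => [|t s IHs].
  have := trig_poly_cst 0; congr trig_poly; apply/funext => x.
  by rewrite /trig_eval big_nil mul0r.
have := trig_polyD (mono t) IHs; congr trig_poly; apply/funext => x.
by rewrite /trig_eval big_cons mulrDl.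
Qed.

Lemma trig_poly_sin (c : R) i : trig_poly (fun x : 'cV[R]_d => sin (c * x i 0)).
Proof.
exists [:: (1, c *: delta_mx i 0, - (pi / 2))]; apply/funext => x.
rewrite /trig_eval big_seq1 /= mul1r dotcvZl dotcvC dotcv_delta.
by rewrite cosB cos_pihalf sin_pihalf mulr0 add0r mulr1.
Qed.

End trigonometric_polynomials.

(* [bernstein s l phi m] is the expectation of [phi] at the counts obtained
   from [m] by tossing, for each [i] in [l], a coin of bias [s i]. *)
Section bernstein_operator.
Context {R : realType} {I : eqType}.
Implicit Types (s : I -> R) (l : seq I) (m : I -> nat) (phi psi : (I -> nat) -> R).

Definition incr m (i : I) : I -> nat := fun j => (m j + (j == i))%N.

Fixpoint bernstein s l phi m : R :=
  if l is i :: l' then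
    s i * bernstein s l' phi (incr m i) + (1 - s i) * bernstein s l' phi m
  else phi m.

Variable s : I -> R.
Hypothesis s01 : forall i, 0 <= s i <= 1.

Lemma bernstein_le l phi psi m : (forall k, phi k <= psi k) ->
  bernstein s l phi m <= bernstein s l psi m.
Proof.
move=> h; elim: l m => //= i l IHl m.
have /andP[s0 s1] := s01 i.
by apply: lerD; rewrite ler_wpM2l// subr_ge0.
Qed.

Lemma bernstein_cst l (c : R) m : bernstein s l (fun=> c) m = c.
Proof. by elim: l m => //= i l IHl m; rewrite !IHl; lra. Qed.

Lemma bernsteinD l phi psi m :
  bernstein s l (fun k => phi k + psi k) m = bernstein s l phi m + bernstein s l psi m.
Proof. by elim: l m => //= i l IHl m; rewrite !IHl; lra. Qed.

Lemma bernsteinZ l (c : R) phi m :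
  bernstein s l (fun k => c * phi k) m = c * bernstein s l phi m.
Proof. by elim: l m => //= i l IHl m; rewrite !IHl; lra. Qed.

Lemma bernstein_sum l (J : Type) (r : seq J) (phi : J -> (I -> nat) -> R) m :
  bernstein s l (fun k => \sum_(j <- r) phi j k) m =
  \sum_(j <- r) bernstein s l (phi j) m.
Proof.
elim: r => [|j r IHr].
  rewrite big_nil -[RHS](bernstein_cst l 0 m); congr bernstein.
  by apply/funext => k; rewrite big_nil.
rewrite big_cons -IHr -bernsteinD; congr bernstein.
by apply/funext => k; rewrite big_cons.
Qed.

Lemma bernstein_norm_sub l phi (c : R) psi m : (forall k, `|phi k - c| <= psi k) ->
  `|bernstein s l phi m - c| <= bernstein s l psi m.
Proof.
move=> h; rewrite ler_norml; apply/andP; split.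
  rewrite lerBrDl -(bernstein_cst l c m) -mulN1r -bernsteinZ -bernsteinD.
  by apply: bernstein_le => k; have := h k; rewrite ler_norml => /andP[]; lra.
rewrite lerBlDl -{1}(bernstein_cst l c m) -bernsteinD.
by apply: bernstein_le => k; have := h k; rewrite ler_norml => /andP[]; lra.
Qed.

(** Squared bias plus variance: coordinate [i] receives [count_mem i l] independent tosses, each of
    variance [s i (1 - s i)]. *)
Lemma bernstein_sqr l i (t : R) m :
  bernstein s l (fun k => ((k i)%:R - t) ^+ 2) m =
  ((m i)%:R + (count_mem i l)%:R * s i - t) ^+ 2
    + (count_mem i l)%:R * (s i * (1 - s i)).
Proof.
elim: l m => [|j l IHl] m /=; first by rewrite mul0r mul0r !addr0.
rewrite !IHl /incr natrD (eq_sym j).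
have [->|ij] /= := eqVneq i j; last by rewrite add0n addr0; lra.
rewrite natrD; lra.
Qed.

End bernstein_operator.

Lemma trig_poly_bernstein (R : realType) d (I : eqType) (s : 'cV[R]_d -> I -> R)
    l phi m : (forall i, trig_poly (fun x => s x i)) ->
  trig_poly (fun x => bernstein (s x) l phi m).
Proof.
move=> ts; elim: l m => [|i l IHl] m /=; first exact: trig_poly_cst.
apply: trig_polyD; first exact: trig_polyM.
apply: trig_polyM => //; apply: trig_polyD; first exact: trig_poly_cst.
have := trig_polyM (trig_poly_cst (-1)) (ts i); congr trig_poly.
by apply/funext => x; rewrite mulN1r.
Qed.

(** The difference of sines is [2 cos p sin r] with half-sum [p] and half-difference [r]; on this
    range [cos p >= 1/2] and [|sin r| >= |r| / 2]. It recovers the distance of two points from that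
    of their biases. *)
Lemma sin_expand (R : realType) (a b : R) : `|a| <= 1 -> `|b| <= 1 ->
  `|a - b| <= 4 * `|sin a - sin b|.
Proof.
move=> a1 b1.
set p := (a + b) / 2; set r := (a - b) / 2.
have -> : sin a = sin (p + r) by congr sin; rewrite /p /r; lra.
have -> : sin b = sin (p - r) by congr sin; rewrite /p /r; lra.
rewrite sinD sinB [X in 4 * `|X|](_ : _ = 2 * (cos p * sin r)); last by lra.
have -> : a - b = 2 * r by rewrite /r; lra.
have /andP[a2 a3] : -1 <= a <= 1 by rewrite -ler_norml.
have /andP[b2 b3] : -1 <= b <= 1 by rewrite -ler_norml.
have p1 : p ^+ 2 <= 1 by rewrite /p; nra.
have r1 : `|r| <= 1 by rewrite ler_norml /r; apply/andP; split; lra.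
have /andP[_ cp] := one_sub_cos_bound p.
have cp2 : 1 / 2 <= cos p by lra.
have sr := sin_sub_bound r.
have r3 : `|r| ^+ 3 <= `|r|.
  by rewrite -[leRHS]expr1 ler_wiXn2l.
have : `|r| / 2 <= `|sin r|.
  have := ler_normD (r - sin r) (sin r); rewrite subrK distrC; lra.
move: r {r1} sr r3 => r sr r3 h.
rewrite !normrM (@ger0_norm _ 2)// (@ger0_norm _ (cos p)); last by lra.
have : 1 / 2 * `|sin r| <= cos p * `|sin r| by rewrite ler_wpM2r.
by lra.
Qed.

(** On the cube the biases [(1 + sin (x_i / L)) / 2] determine the point. The Bernstein polynomial
    in these biases is trigonometric, and on the whole space it is an average of values of [f], so
    the bound [M] persists outside the cube, where nothing else is known about [p]. *)
Lemma trig_poly_approx (R : realType) d (f : 'cV[R]_d -> R) (M L e : R) :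
  continuous f -> (forall x, `|f x| <= M) -> 0 < L -> 0 < e ->
  exists p : 'cV[R]_d -> R, [/\ trig_poly p, forall x, `|p x| <= M &
    forall x : 'cV[R]_d, (forall i, `|x i 0| <= L) -> `|p x - f x| <= e].
Proof.
move=> cf fM L0 e0; have M0 : 0 <= M := le_trans (normr_ge0 _) (fM 0).
have e2 : 0 < e / 2 by rewrite divr_gt0.
have [eta eta0 unif] := continuous_unif_cube L cf e2.
(* The factor [16 * L] is [4 * 2 * 2 * L]: 4 from [sin_expand], 2 because biases halve the sine, 2
   for two deviations of size [dl], and [L] from the rescaling. *)
have [dl dl0 etaE] : exists2 dl, 0 < dl & eta = dl * (16 * L).
  exists (eta / (16 * L)); first by rewrite divr_gt0// mulr_gt0.
  by rewrite divfK// gt_eqF// mulr_gt0.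
(* This many tosses bring the Chebyshev term [d M / (2 N dl^2)] below [e / 2]. *)
pose N := (Num.truncn (d%:R * M / (dl ^+ 2 * e))).+1.
have N0 : (0 : R) < N%:R by rewrite ltr0n.
have NM : d%:R * M <= N%:R * (dl ^+ 2 * e).
  have := truncnS_gt (d%:R * M / (dl ^+ 2 * e)).
  by rewrite ltr_pdivrMr ?mulr_gt0 ?exprn_gt0// => /ltW.
pose s (x : 'cV[R]_d) (i : 'I_d) := (1 + sin (L^-1 * x i 0)) / 2.
have s01 x i : 0 <= s x i <= 1.
  by have := sin_geN1 (L^-1 * x i 0); have := sin_le1 (L^-1 * x i 0);
    rewrite /s => ? ?; apply/andP; split; lra.
(* A point of the cube is good for [m] if its biases are near the frequencies [m i / N]. [phi]
   samples [f] at such a point, and at the default 0 if there is none, so it is bounded by [M] in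
   either case. *)
pose good (m : 'I_d -> nat) := [set y : 'cV[R]_d |
  (forall i, `|y i 0| <= L) /\ (forall i, `|(m i)%:R / N%:R - s y i| <= dl)].
pose phi m := f (xget 0 (good m)).
pose l := flatten [seq nseq N i | i <- enum 'I_d].
have count_l i : count_mem i l = N.
  rewrite /l count_flatten -map_comp sumnE big_map big_enum /=.
  rewrite (bigD1 i)//= count_nseq /= eqxx mul1n big1 ?addn0// => j ji.
  by rewrite count_nseq /= (negPf ji) mul0n.
exists (fun x => bernstein (s x) l phi (fun=> 0%N)); split.
- apply: trig_poly_bernstein => i.
  have := trig_polyM (trig_poly_cst (2^-1))
    (trig_polyD (trig_poly_cst 1) (trig_poly_sin L^-1 i)).
  by congr trig_poly; apply/funext => x; rewrite mulrC.
- move=> x; rewrite -[X in `|X|]subr0 -[leRHS](bernstein_cst (s x) l M (fun=> 0%N)).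
  by apply: (bernstein_norm_sub (s01 x)) => k; rewrite subr0; exact: fM.
(* The weight [K] makes the quadratic term at least [2 * M] as soon as one frequency is off by more
   than [dl]; on average that term is a variance, at most [K * N / 4] per coordinate. *)
move=> x xL; pose K := 2 * M / (dl ^+ 2 * N%:R ^+ 2).
have K0 : 0 <= K by apply: divr_ge0; apply: mulr_ge0 => //; exact: sqr_ge0.
have nzN := lt0r_neq0 N0; have nzd := lt0r_neq0 dl0.
have e1 : K * (dl ^+ 2 * N%:R ^+ 2) = 2 * M by rewrite /K divfK// mulf_neq0// expf_neq0.
have phi_bound m : `|phi m - f x| <=
    e / 2 + \sum_i K * ((m i)%:R - N%:R * s x i) ^+ 2.
  have [gx|/existsNP[i /negP]] := pselect (forall i, `|(m i)%:R / N%:R - s x i| <= dl).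
    have [yL ydl] : good m (xget 0 (good m)) by apply: (xgetPex 0); exists x.
    rewrite -[leLHS]addr0 lerD//; last first.
      by apply: sumr_ge0 => i _; rewrite mulr_ge0// sqr_ge0.
    rewrite /phi distrC; apply: unif => // i.
    set y := xget _ _ in yL ydl *.
    have sc (z : 'cV[R]_d) : `|z i 0| <= L -> `|L^-1 * z i 0| <= 1.
      by move=> zL; rewrite normrM gtr0_norm ?invr_gt0// mulrC ler_pdivrMr// mul1r.
    have := sin_expand (sc _ (xL i)) (sc _ (yL i)).
    rewrite -mulrBr normrM gtr0_norm ?invr_gt0// mulrC ler_pdivrMr// => h.
    apply: (le_trans h).
    have -> : sin (L^-1 * x i 0) - sin (L^-1 * y i 0) =
      2 * (((m i)%:R / N%:R - s y i) - ((m i)%:R / N%:R - s x i)) by rewrite /s; lra.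
    rewrite normrM (@ger0_norm _ 2)//.
    have -> : eta = 4 * (2 * (dl + dl)) * L by rewrite etaE; lra.
    by rewrite ler_pM2r// ler_pM2l// ler_pM2l// (le_trans (ler_normB _ _))// lerD.
  rewrite -ltNge => hi.
  apply: (@le_trans _ _ (2 * M)).
    by apply: (le_trans (ler_normB _ _)); have := fM x; have := fM (xget 0 (good m)); rewrite /phi; lra.
  rewrite -[leLHS]add0r lerD ?(ltW e2)// (bigD1 i)//= -[leLHS]addr0 lerD//; last first.
    by apply: sumr_ge0 => j _; rewrite mulr_ge0// sqr_ge0.
  have -> : (m i)%:R - N%:R * s x i = N%:R * ((m i)%:R / N%:R - s x i).
    have mN : N%:R * ((m i)%:R / N%:R) = (m i)%:R :> R by rewrite mulrC divfK ?gt_eqF.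
    by rewrite mulrBr mN.
  rewrite exprMn mulrA.
  have -> : K * N%:R ^+ 2 = 2 * M / dl ^+ 2.
    apply: (mulIf (expf_neq0 2 nzd)).
    by rewrite divfK ?expf_neq0// -e1 -mulrA (mulrC (dl ^+ 2)).
  rewrite -mulrA ler_peMr ?mulr_ge0// ler_pdivlMl ?exprn_gt0// mulr1.
  by rewrite -(real_normK (num_real (_ - _))) ler_pXn2r ?nnegrE ?normr_ge0 ?(ltW dl0) ?(ltW hi).
apply: (le_trans (bernstein_norm_sub (s01 x) l _ phi_bound)).
rewrite bernsteinD bernstein_cst bernstein_sum.
under eq_bigr do rewrite bernsteinZ bernstein_sqr count_l add0r subrr expr0n add0r.
apply: (@le_trans _ _ (e / 2 + \sum_(i < d) K * (N%:R / 4))).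
  rewrite lerD2l; apply: ler_sum => i _; rewrite ler_wpM2l// ler_wpM2l ?(ltW N0)//.
  by have := sqr_ge0 (s x i - 1 / 2); lra.
rewrite sumr_const card_ord -mulr_natl.
suff : d%:R * (K * (N%:R / 4)) <= e / 2 by lra.
have -> : d%:R * (K * (N%:R / 4)) = d%:R * M / (N%:R * dl ^+ 2) / 2.
  apply: (mulIf (_ : N%:R * dl ^+ 2 != 0)); first by rewrite mulf_neq0// expf_neq0.
  rewrite mulrAC [RHS]mulrAC divfK ?mulf_neq0 ?expf_neq0//; nra.
rewrite ler_pM2r// ler_pdivrMr ?mulr_gt0 ?exprn_gt0//.
by rewrite (le_trans NM)// mulrA mulrC.
Qed.

Lemma mx_measurable_id_borel (R : realType) d :
  mx_measurable (id : borel 'cV[R]_d -> 'cV[R]_d).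
Proof.
move=> i j; apply: (@continuous_borel_measurable 'cV[R]_d R (fun x => x i j)).
exact: coord_continuous.
Qed.

Lemma trig_eval_cvg (R : realType) d (E_ : nat -> ('cV[R]_d -> R) -> R)
    (E0 : ('cV[R]_d -> R) -> R) (s : seq (R * 'cV[R]_d * R)) :
  (forall (u : 'cV[R]_d) (a : R), E_ n (fun x => cos (dotcv u x + a)) @[n --> \oo] -->
     E0 (fun x => cos (dotcv u x + a))) ->
  (forall n, E_ n (trig_eval s) =
     \sum_(t <- s) t.1.1 * E_ n (fun x => cos (dotcv t.1.2 x + t.2))) ->
  E0 (trig_eval s) = \sum_(t <- s) t.1.1 * E0 (fun x => cos (dotcv t.1.2 x + t.2)) ->
  E_ n (trig_eval s) @[n --> \oo] --> E0 (trig_eval s).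
Proof.
move=> cf En E0s; rewrite E0s (funext En); elim: s {En E0s} => [|t s IHs].
  by rewrite big_nil; under eq_fun do rewrite big_nil; exact: cvg_cst.
rewrite big_cons; under eq_fun do rewrite big_cons.
by apply: cvgD IHs; exact: cvgMl_tmp.
Qed.

Lemma Er_trig_eval (R : realType) d (dT : measure_display) (T : measurableType dT)
    (P : probability T R) (Z : T -> 'cV[R]_d) (s : seq (R * 'cV[R]_d * R)) :
  mx_measurable Z ->
  L1 P (fun w => trig_eval s (Z w)) /\ \int[P]_w trig_eval s (Z w) =
    \sum_(t <- s) t.1.1 * \int[P]_w cos (dotcv t.1.2 (Z w) + t.2).
Proof.
move=> mZ.
have i1 (u : 'cV[R]_d) (a : R) : L1 P (fun w => cos (dotcv u (Z w) + a)).
  apply: (@L1_bounded _ _ _ _ _ 1) => [|w]; last exact: cos_max.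
  apply: (measurableT_comp (continuous_measurable_fun (@continuous_cos R))).
  apply: measurable_funD => //.
  by apply: measurable_dotcv => //; exact: mx_measurable_cst.
split; first by apply: L1_sum => t; exact: L1Z.
rewrite Er_sum => [|t]; last exact: L1Z.
by apply: eq_bigr => t _; rewrite ErZ.
Qed.

Section weak_convergence_criterion.
Context {dT : measure_display} {T : measurableType dT} {R : realType} {d : nat}.
Variables (P : probability T R) (Z : nat -> T -> 'cV[R]_d)
  (mu : probability (borel 'cV[R]_d) R) (B : R).
Hypothesis mZ : forall n, mx_measurable (Z n).
Hypothesis cf : forall (u : 'cV[R]_d) (a : R),
  \int[P]_w cos (dotcv u (Z n w) + a) @[n --> \oo] -->
  \int[mu]_x cos (dotcv u x + a).
Hypothesis tight : forall n, L1 P (fun w => dotcv (Z n w) (Z n w)) /\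
  \int[P]_w dotcv (Z n w) (Z n w) <= B.

(** A cutoff equal to 1 outside the cube of half-side [k + 1]. Under the laws of [Z n] its mean is
    bounded by the second moment, uniformly in [n]; under [mu] it tends to 0 by domination by 1. *)
Let far k (x : 'cV[R]_d) : R := Num.min 1 (k.+1%:R ^- 2 * dotcv x x).

Let far_ge0 k x : 0 <= far k x.
Proof. by rewrite le_min ler01 mulr_ge0 ?dotcv_ge0// invr_ge0 exprn_ge0. Qed.

Let measurable_far (dT' : measure_display) (T' : measurableType dT')
    (Y : T' -> 'cV[R]_d) k :
  mx_measurable Y -> measurable_fun setT (fun w => far k (Y w)).
Proof.
move=> mY; apply: measurable_minr => //; apply: measurable_funM => //.
exact: measurable_dotcv.
Qed.

Let inv_nat_cvg : (k.+1%:R ^- 2 : R) @[k --> \oo] --> (0 : R).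
Proof.
have h : (k.+1%:R^-1 : R) @[k --> \oo] --> (0 : R) by exact: cvg_harmonic.
rewrite -[X in _ --> X](mulr0 (0 : R)).
by under eq_fun do rewrite -exprVn expr2; exact: cvgM.
Qed.

Let far_cvg : \int[mu]_x far k x @[k --> \oo] --> (0 : R).
Proof.
rewrite -[X in _ --> X](Er_cst mu).
apply: (@Er_cvg _ _ _ mu (fun k x => far k x) (fun=> 0) (fun=> 1)) => //.
- by move=> n; apply: (measurable_far n (@mx_measurable_id_borel R d)).
- move=> x; apply: (@squeeze_cvgr _ _ _ _ (fun=> 0) (fun k => k.+1%:R ^- 2 * dotcv x x)).
  + by apply: nearW => k; rewrite far_ge0/= ge_min lexx orbT.
  + exact: cvg_cst.
  + by rewrite -[X in _ --> X](mul0r (dotcv x x)); exact: cvgMr_tmp.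
- exact: L1_cst.
- by move=> n x; rewrite ger0_norm// ge_min lexx.
Qed.

Lemma cf_weak_cvg :
  weak_cvg (fun n => pushforward P (Z n : T -> borel 'cV[R]_d)) mu.
Proof.
move=> f cf_ [M0 fM0].
have mf : measurable_fun setT (f : borel 'cV[R]_d -> R).
  exact: continuous_borel_measurable.
have mZn n : measurable_fun setT (Z n : T -> borel 'cV[R]_d).
  by apply: measurable_cV => i; exact: mZ.
have mfZ n : measurable_fun setT (fun w => f (Z n w)).
  exact: (measurableT_comp mf (mZn n)).
have [M M_gt0 fM] : exists2 M, 0 < M & forall x, `|f x| <= M.
  exists (`|M0| + 1); first by rewrite ltr_wpDl.
  by move=> x; rewrite (le_trans (fM0 x))// (le_trans (ler_norm M0))// lerDl.
have i1 n : L1 P (fun w => f (Z n w)) by apply: (@L1_bounded _ _ _ _ _ M).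
have i2 : L1 mu f by apply: (@L1_bounded _ _ _ _ _ M).
rewrite Er_EFin//.
have -> : (fun n => \int[pushforward P (Z n : T -> borel 'cV[R]_d)]_x (f x)%:E)%E =
    (fun n => (\int[P]_w f (Z n w))%:E).
  apply/funext => n; rewrite -Er_EFin//.
  rewrite (integral_pushforward (mZn n) (f := fun x => (f x)%:E))//.
    exact/measurable_EFinP.
  exact: (i1 n).
apply/fine_cvgP; split; first exact: nearW.
apply/cvgrPdist_le => e e0.
(* Replacing [f] by [p] costs [e / 5] on the cube and [e / 5] outside it, once for [Z n] and once
   for [mu]; the last fifth is for the convergence of the means of [p]. *)
have e5 : 0 < e / 5 by rewrite divr_gt0.
have B0 : 0 <= B.
  have [_] := tight 0%N; apply: le_trans; apply: Er_ge0 => w; exact: dotcv_ge0.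
have [k [k1 k2]] : exists k : nat, 2 * M * \int[mu]_x far k x <= e / 5 /\
    2 * M * (k.+1%:R ^- 2 * B) <= e / 5.
  have c1 : 2 * M * \int[mu]_x far k x @[k --> \oo] --> (0 : R).
    by rewrite -[X in _ --> X](mulr0 (2 * M)); exact: cvgMl_tmp.
  have c2 : 2 * M * (k.+1%:R ^- 2 * B) @[k --> \oo] --> (0 : R).
    rewrite -[X in _ --> X](mulr0 (2 * M)) -(mul0r B).
    by apply: cvgMl_tmp; exact: cvgMr_tmp.
  have /cvgr0Pnorm_le/(_ _ e5) n1 := c1; have /cvgr0Pnorm_le/(_ _ e5) n2 := c2.
  have [k [k1 k2]] := @filter_ex _ \oo _ _ (filterI n1 n2).
  by exists k; split; apply: le_trans (ler_norm _) _.
have L0 : (0 : R) < k.+1%:R by rewrite ltr0n.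
have [p [[s ps] pM pf]] := trig_poly_approx cf_ fM L0 e5.
have pf_far x : `|p x - f x| <= e / 5 + 2 * M * far k x.
  have [xL|/existsNP[i /negP]] := pselect (forall i, `|x i 0| <= k.+1%:R).
    by rewrite -[leLHS]addr0 lerD ?pf// mulr_ge0// mulr_ge0// ltW.
  rewrite -ltNge => xi.
  have -> : far k x = 1.
    rewrite /far; apply/min_idPl; rewrite ler_pdivlMl ?exprn_gt0// mulr1.
    apply: le_trans (sqr_coord_le x i).
    by rewrite -(real_normK (num_real (x i 0))) ler_pXn2r ?nnegrE// ltW.
  have := ler_normB (p x) (f x); have := fM x; have := pM x; lra.
have mid := @mx_measurable_id_borel R d.
have [ip Ep] := Er_trig_eval mu s mid.
have cp : \int[P]_w p (Z n w) @[n --> \oo] --> \int[mu]_x p x.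
  rewrite ps.
  apply: (@trig_eval_cvg R d (fun n g => \int[P]_w g (Z n w)) (fun g => \int[mu]_x g x)) => //.
  by move=> n; have [_] := Er_trig_eval P s (mZ n).
rewrite -ps in ip.
have ifar (dT' : measure_display) (T' : measurableType dT') (Q : probability T' R)
    (Y : T' -> 'cV[R]_d) : mx_measurable Y -> L1 Q (fun w => far k (Y w)).
  move=> mY; apply: (@L1_bounded _ _ _ _ _ 1) => [|w]; first exact: measurable_far.
  by rewrite ger0_norm// ge_min lexx.
have ifar' (dT' : measure_display) (T' : measurableType dT') (Q : probability T' R)
    (Y : T' -> 'cV[R]_d) : mx_measurable Y ->
    L1 Q (fun w => e / 5 + 2 * M * far k (Y w)).
  by move=> mY; apply: L1D; [exact: L1_cst|apply: L1Z; exact: ifar].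
have d2 : `|\int[mu]_x p x - \int[mu]_x f x| <= e / 5 + e / 5.
  rewrite -ErB//; apply: (le_trans (Er_norm_le _ (ifar' _ _ _ _ mid) _)) => //.
    exact: L1_measurable (L1B ip i2).
  rewrite ErD ?Er_cst ?ErZ ?lerD2l//; [exact: ifar|exact: L1_cst|].
  by apply: L1Z; exact: ifar.
have d1 n : `|\int[P]_w p (Z n w) - \int[P]_w f (Z n w)| <= e / 5 + e / 5.
  have ipn : L1 P (fun w => p (Z n w)).
    by rewrite ps; have [] := Er_trig_eval P s (mZ n).
  have [iZ EZ] := tight n.
  have iZ' : L1 P (fun w => e / 5 + 2 * M * (k.+1%:R ^- 2 * dotcv (Z n w) (Z n w))).
    by apply: L1D; [exact: L1_cst|do 2 apply: L1Z].
  rewrite -ErB//; apply: (le_trans (Er_norm_le _ iZ' _)).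
  - exact: L1_measurable (L1B ipn (i1 n)).
  - move=> w; apply: (le_trans (pf_far _)); rewrite lerD2l ler_wpM2l ?mulr_ge0 ?(ltW M_gt0)//.
    by rewrite ge_min lexx orbT.
  rewrite ErD; [|exact: L1_cst|by do 2 apply: L1Z].
  rewrite Er_cst ErZ; last exact: L1Z.
  rewrite ErZ// lerD2l; apply: le_trans k2.
  by rewrite ler_wpM2l ?mulr_ge0 ?(ltW M_gt0)// ler_wpM2l// invr_ge0 exprn_ge0.
have /cvgrPdist_le/(_ _ e5) near_p := cp.
apply: filterS near_p => n h; have := d1 n.
move: h d2.
set a := \int[mu]_x p x; set b := \int[P]_w p (Z n w).
set x := \int[mu]_x f x; set y := \int[P]_w f (Z n w) => h1 h2 h3.
rewrite (_ : x - y = - (a - x) + (a - b) + (b - y)); last by lra.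
apply: (le_trans (ler_normD _ _)); have := ler_normD (- (a - x)) (a - b).
rewrite normrN; lra.
Qed.

End weak_convergence_criterion.

(** * Gaussian vectors *)

Section standard_normal.
Context {R : realType}.
Local Notation lam := (@lebesgue_measure R).
Local Notation N := (normal_prob (0 : R) 1).

(** The Radon-Nikodym derivative of the normal law agrees almost everywhere with its density, since
    both have the same integrals over measurable sets. *)
Lemma ge0_integral_normal (m s : R) (f : R -> \bar R) : measurable_fun setT f ->
  (forall x, (0 <= f x)%E) ->
  (\int[normal_prob m s]_x f x = \int[lam]_x (f x * (normal_pdf m s x)%:E))%E.
Proof.
move=> mf f0.
have dom := normal_prob_dominates m s.
rewrite -(Radon_Nikodym_SigmaFinite.change_of_variables dom f0 measurableT mf).
set g := Radon_Nikodym_SigmaFinite.f _ _.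
have mg : measurable_fun setT g.
  exact: measurable_int (Radon_Nikodym_SigmaFinite.f_integrable dom).
have mpdf : measurable_fun setT (fun x => (normal_pdf m s x)%:E).
  by apply/measurable_EFinP; exact: measurable_normal_pdf.
apply: ge0_ae_eq_integral => //.
- exact: emeasurable_funM.
- exact: emeasurable_funM.
- by move=> x _; rewrite mule_ge0//; exact: Radon_Nikodym_SigmaFinite.f_ge0.
- by move=> x _; rewrite mule_ge0// lee_fin normal_pdf_ge0.
apply: ae_eqe_mul2l.
apply: integral_ae_eq => //; first exact: Radon_Nikodym_SigmaFinite.f_integrable.
by move=> E _ mE; rewrite -Radon_Nikodym_SigmaFinite.f_integral.
Qed.

Lemma normal_pdf01E (x : R) :
  normal_pdf 0 1 x = normal_peak 1 * expR (- (x ^+ 2 / 2)).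
Proof.
rewrite normal_pdfE ?oner_neq0// /normal_fun subr0 expr1n; congr (_ * expR _).
by rewrite mulNr -mulr_natr mul1r.
Qed.

(** The rescaled image of Lebesgue measure has the right value on half-open intervals, which
    characterizes Lebesgue measure. *)
Lemma ge0_integral_affine (a b : R) (f : R -> \bar R) : 0 < a ->
  measurable_fun setT f -> (forall x, (0 <= f x)%E) ->
  (\int[lam]_x f x = a%:E * \int[lam]_x f (a * x + b)%R)%E.
Proof.
move=> a0 mf f0.
have mg : measurable_fun setT (fun x : measurableTypeR R => (a * x + b : measurableTypeR R)).
  by apply: measurable_funD => //; exact: measurable_funM.
pose nu : {measure set (measurableTypeR R) -> \bar R} := mscale (NngNum (ltW a0))
  (pushforward lam (fun x : measurableTypeR R => (a * x + b : measurableTypeR R))).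
transitivity (\int[nu mg]_x f x)%E.
  apply: eq_measure_integral => A mA _.
  apply: lebesgue_measure_unique => // _ [[u v]] _ <-.
  transitivity (a%:E * lam `]((u - b) / a)%R, ((v - b) / a)%R]%classic)%E.
    rewrite /= !lebesgue_measure_itv /= !lte_fin ltr_pM2r ?invr_gt0// ltrD2r.
    case: ifP => _; last by rewrite mule0.
    by rewrite -!EFinB -EFinM -mulrBl mulrC divfK ?gt_eqF//; congr (_%:E); lra.
  rewrite /nu /mscale /pushforward /=; congr (_ * lam _)%E.
  apply/seteqP; split => x /=; rewrite !in_itv /= ltr_pdivrMr// ler_pdivlMr//;
  by rewrite ltrBlDr lerBrDr (mulrC x).
rewrite /nu ge0_integral_mscale// ge0_integral_pushforward//.
Qed.

Lemma ge0_integral_opp (f : R -> \bar R) : measurable_fun setT f ->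
  (forall x, (0 <= f x)%E) -> (\int[lam]_x f (- x)%R = \int[lam]_x f x)%E.
Proof.
move=> mf f0.
have mN : measurable_fun setT (-%R : measurableTypeR R -> measurableTypeR R).
  exact: oppr_measurable.
transitivity (\int[pushforward lam (-%R : measurableTypeR R -> measurableTypeR R)]_x f x)%E.
  by rewrite ge0_integral_pushforward.
by apply: eq_measure_integral => A mA _; exact: lebesgue_measureN.
Qed.

Let p (x : R) := normal_pdf 0 1 x.

Let p0 x : 0 <= p x. Proof. exact: normal_pdf_ge0. Qed.

Let mp : measurable_fun setT p. Proof. exact: measurable_normal_pdf. Qed.

Lemma normal_opp (f : R -> \bar R) : measurable_fun setT f ->
  (forall x, (0 <= f x)%E) -> (\int[N]_x f (- x)%R = \int[N]_x f x)%E.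
Proof.
move=> mf f0.
have mN : measurable_fun setT (-%R : R -> R) by exact: oppr_measurable.
have mfN : measurable_fun setT (fun x : R => f (- x)) by exact: measurableT_comp mf mN.
rewrite !ge0_integral_normal//.
rewrite -[RHS]ge0_integral_opp; first last.
- by move=> x; rewrite mule_ge0// lee_fin p0.
- by apply: emeasurable_funM => //; exact/measurable_EFinP.
by apply: eq_integral => x _; rewrite !normal_pdf01E sqrrN.
Qed.

Let mp_affine (k b : R) : measurable_fun setT (fun x : R => p (k * x + b)).
Proof.
apply: (measurableT_comp mp).
by apply: measurable_funD => //; exact: measurable_funM.
Qed.

Let integral_p_affine (k b : R) : 0 < k -> (\int[lam]_x (p (k * x + b))%:E = (k^-1)%:E)%E.
Proof.
move=> k0; have := @ge0_integral_affine k b (fun x : R => (p x)%:E) k0.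
rewrite integral_normal_pdf => h.
have {}h : (1 = k%:E * \int[lam]_x (p (k * x + b))%:E)%E.
  by apply: h => [|x]; [exact/measurable_EFinP|rewrite lee_fin].
have i0 : (0 <= \int[lam]_x (p (k * x + b))%:E)%E.
  by apply: integral_ge0 => x _; rewrite lee_fin.
case: (integral _ _ _) i0 h => [r| |] // _.
- by rewrite -EFinM => -[h]; congr (_%:E); rewrite -[RHS]mulr1 h mulKf// gt_eqF.
- by rewrite gt0_muley ?lte_fin.
Qed.

(** For [z = a s + c t] the joint density is the marginal of [z], of standard deviation [r], times a
    Gaussian factor in [t] given [z]. *)
Let completing_square (a c r t z : R) : 0 < a -> 0 < r -> r ^+ 2 = a ^+ 2 + c ^+ 2 ->
  p t * p ((z - c * t) / a) = p (r^-1 * z) * p ((r / a) * t + - (c * z / (r * a))).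
Proof.
move=> a0 r0 rE; rewrite /p !normal_pdf01E.
rewrite mulrACA [RHS]mulrACA -!expRD; congr (_ * expR _).
rewrite (_ : c * z / (r * a) = c * z * r^-1 * a^-1); last by rewrite invfM !mulrA.
have aa : a * a^-1 = 1 by rewrite mulfV// gt_eqF.
have rr : r * r^-1 = 1 by rewrite mulfV// gt_eqF.
move: (a^-1) (r^-1) aa rr => ia ir aa rr.
have k1 : r ^+ 2 * ia ^+ 2 = 1 + c ^+ 2 * ia ^+ 2.
  by rewrite rE mulrDl -exprMn aa expr1n.
have k2 : ir ^+ 2 * r ^+ 2 = 1 by rewrite -exprMn mulrC rr expr1n.
have h1 : t ^+ 2 * (r ^+ 2 * ia ^+ 2) = t ^+ 2 * (1 + c ^+ 2 * ia ^+ 2) by rewrite k1.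
have h2 : (r * ir) * (t * c * z * ia ^+ 2) = t * c * z * ia ^+ 2 by rewrite rr mul1r.
have h4 : z ^+ 2 * ir ^+ 2 * (r ^+ 2 * ia ^+ 2) = z ^+ 2 * ir ^+ 2 * (1 + c ^+ 2 * ia ^+ 2) by rewrite k1.
have h5 : z ^+ 2 * ia ^+ 2 * (ir ^+ 2 * r ^+ 2) = z ^+ 2 * ia ^+ 2 by rewrite k2 mulr1.
lra.
Qed.

Lemma normal_convolution (a c : R) (f : R -> \bar R) : 0 <= a ->
  measurable_fun setT f -> (forall x, (0 <= f x)%E) ->
  (\int[N]_t \int[N]_s f (a * s + c * t)%R =
   \int[N]_x f (Num.sqrt (a ^+ 2 + c ^+ 2) * x)%R)%E.
Proof.
move=> a_ge0 mf f0.
have mlin (k b : R) : measurable_fun setT (fun x : R => k * x + b).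
  by apply: measurable_funD => //; exact: measurable_funM.
have mf_lin (k b : R) : measurable_fun setT (fun x : R => f (k * x + b)).
  exact: measurableT_comp mf (mlin k b).
have mf_mul (k : R) : measurable_fun setT (fun x : R => f (k * x)).
  by have := mf_lin k 0; under eq_fun do rewrite addr0.
(* At [a = 0] the change of variables [z = a s + c t] degenerates; the claim is then the symmetry
   between [c] and [|c|]. *)
move: a_ge0; rewrite le_eqVlt => /predU1P[<-|a0].
  rewrite expr0n add0r sqrtr_sqr.
  under eq_integral => t _.
    under eq_integral do rewrite mul0r add0r.
    rewrite integral_cst// [X in (_ * X)%E](@probability_setT _ _ _ N) mule1.
    over.
  have [c0|c0] := leP 0 c; first by rewrite ger0_norm.
  rewrite ltr0_norm// -normal_opp//.
  by under [RHS]eq_integral do rewrite mulrNN.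
set r := Num.sqrt (a ^+ 2 + c ^+ 2).
have rE : r ^+ 2 = a ^+ 2 + c ^+ 2 by rewrite sqr_sqrtr// addr_ge0// sqr_ge0.
have r0 : 0 < r by rewrite sqrtr_gt0 ltr_pwDl ?sqr_ge0// exprn_gt0.
have pe x : (0 <= (p x)%:E)%E by rewrite lee_fin.
have mpe : measurable_fun setT (fun x : R => (p x)%:E) by exact/measurable_EFinP.
pose h (t z : R) : \bar R := (f z * (a^-1 * (p t * p ((z - c * t) / a)))%:E)%E.
have hpos t z : (0 <= h t z)%E.
  by rewrite mule_ge0// lee_fin !mulr_ge0// invr_ge0 ltW.
have mh : measurable_fun setT (fun tz : R * R => h tz.1 tz.2).
  apply: emeasurable_funM; first exact: measurableT_comp mf (measurable_snd).
  apply/measurable_EFinP; apply: measurable_funM => //.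
  apply: measurable_funM; first exact: measurableT_comp mp measurable_fst.
  apply: (measurableT_comp mp); apply: measurable_funM => //.
  by apply: measurable_funB => //; exact: measurable_funM.
have inner t : (\int[N]_s f (a * s + c * t)%R * (p t)%:E = \int[lam]_z h t z)%E.
  have mht : measurable_fun setT (h t).
    apply: emeasurable_funM => //; apply/measurable_EFinP; apply: measurable_funM => //.
    apply: measurable_funM => //; have := mp_affine a^-1 (- (c * t / a)).
    by under eq_fun do rewrite mulrC -mulrBl.
  rewrite (ge0_integral_affine (c * t) a0 mht)// ge0_integral_normal//.
  have mm : measurable_fun setT (fun x : R => (f (a * x + c * t)%R * (p x)%:E)%E).
    by apply: emeasurable_funM => //; exact: mf_lin.
  have ff x : (0 <= f (a * x + c * t)%R * (p x)%:E)%E by rewrite mule_ge0.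
  rewrite -(ge0_integralZr lam measurableT mm (fun x _ => ff x) (pe t)).
  have mha : measurable_fun setT (fun x : R => h t (a * x + c * t)).
    exact: measurableT_comp mht (mlin _ _).
  rewrite -(ge0_integralZl_EFin lam measurableT (fun x _ => hpos t _) mha (ltW a0)).
  apply: eq_integral => s _; rewrite /h addrK (mulrC a) mulfK ?gt_eqF//.
  rewrite muleCA -!EFinM -muleA -EFinM; congr (_ * _%:E)%E.
  by rewrite !mulrA mulfV ?gt_eqF// mul1r mulrC.
rewrite ge0_integral_normal; first last.
- by move=> t; exact: integral_ge0.
- have mF : measurable_fun setT (fun ts : R * R => f (a * ts.2 + c * ts.1)).
    apply: (measurableT_comp mf); apply: measurable_funD; exact: measurable_funM.
  exact: (measurable_fun_fubini_tonelli_F (m2 := N) _ mF).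
under eq_integral do rewrite inner.
rewrite (fubini_tonelli (m1 := lam) (m2 := lam) (fun tz : R * R => h tz.1 tz.2) mh); last by move=> [].
rewrite ge0_integral_normal//.
pose h' z := (f z * (r^-1 * p (r^-1 * z))%:E)%E.
have mh' : measurable_fun setT h'.
  apply: emeasurable_funM => //; apply/measurable_EFinP; apply: measurable_funM => //.
  by have := mp_affine r^-1 0; under eq_fun do rewrite addr0.
transitivity (\int[lam]_z h' z)%E.
  apply: eq_integral => z _; rewrite /h /=.
  under eq_integral => t _ do rewrite (completing_square t z a0 r0 rE).
  have kk : 0 < r / a by rewrite divr_gt0.
  transitivity (\int[lam]_t ((f z * (a^-1 * p (r^-1 * z))%:E) *
      (p ((r / a) * t + - (c * z / (r * a))))%:E))%E.
    by apply: eq_integral => t _; rewrite -muleA -EFinM !mulrA.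
  have mpa : measurable_fun setT (fun t : R => (p ((r / a) * t + - (c * z / (r * a))))%:E).
    by apply/measurable_EFinP; exact: mp_affine.
  have fz : (0 <= f z * (a^-1 * p (r^-1 * z))%:E)%E.
    by rewrite mule_ge0// lee_fin mulr_ge0// invr_ge0 ltW.
  rewrite (ge0_integralZl lam measurableT mpa (fun x _ => _) fz)//.
  rewrite integral_p_affine// -muleA -EFinM /h'; congr (_ * _%:E)%E.
  rewrite invf_div mulrC mulrA; congr (_ * _).
  by rewrite mulrAC mulfV ?mul1r// gt_eqF.
rewrite (ge0_integral_affine 0 r0 mh'); last first.
  by move=> z; rewrite mule_ge0// lee_fin mulr_ge0// invr_ge0 ltW.
have h'0 z : (0 <= h' z)%E by rewrite mule_ge0// lee_fin mulr_ge0// invr_ge0 ltW.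
have mh'r : measurable_fun setT (fun x : R => h' (r * x + 0)).
  exact: measurableT_comp mh' (mlin _ _).
rewrite -(ge0_integralZl_EFin lam measurableT (fun x _ => h'0 _) mh'r (ltW r0)).
apply: eq_integral => x _; rewrite /h' addr0 mulKf ?gt_eqF//.
rewrite muleCA -EFinM; congr (_ * _%:E)%E.
by rewrite mulrA mulfV ?gt_eqF// mul1r.
Qed.

Lemma normal_sqr_integrable : L1 N (fun x => x ^+ 2).
Proof.
have mx2 : measurable_fun setT (fun x : R => x ^+ 2) by exact: measurable_funX.
apply/integrableP; split; first exact/measurable_EFinP.
have m1 : measurable_fun setT (fun x : R => (x ^+ 2)%:E) by exact/measurable_EFinP.
under eq_integral do rewrite /= ger0_norm ?sqr_ge0//.
rewrite ge0_integral_normal//; last by move=> x; rewrite lee_fin sqr_ge0.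
(* The density of variance 2 is proportional to [exp(-x^2/4)], and
   [x^2 exp(-x^2/2) <= 4 exp(-x^2/4)]; [K] also converts the peak constants. *)
pose s : R := Num.sqrt 2.
have s0 : s != 0 by rewrite gt_eqF// sqrtr_gt0.
pose K := 4 * normal_peak 1 / normal_peak s.
apply: (@le_lt_trans _ _ (\int[lam]_x (K%:E * (normal_pdf 0 s x)%:E))%E).
  apply: ge0_le_integral => //.
  - by move=> x _; rewrite mule_ge0 ?lee_fin ?sqr_ge0.
  - by apply: emeasurable_funM => //; exact/measurable_EFinP.
  - apply: emeasurable_funM => //; apply/measurable_EFinP.
    exact: measurable_normal_pdf.
  move=> x _; rewrite -!EFinM lee_fin normal_pdf01E normal_pdfE// /normal_fun subr0.
  rewrite [leRHS]mulrA /K divfK ?gt_eqF ?normal_peak_gt0//.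
  set E1 := expR _; set E2 := expR _.
  rewrite [leLHS](_ : _ = normal_peak 1 * (x ^+ 2 * E1)); last by lra.
  rewrite [leRHS](_ : _ = normal_peak 1 * (4 * E2)); last by lra.
  rewrite ler_wpM2l ?normal_peak_ge0// /E2.
  have -> : - x ^+ 2 / (s ^+ 2 *+ 2) = x ^+ 2 / 4 - x ^+ 2 / 2.
    by rewrite sqr_sqrtr// -mulr_natr -natrM; lra.
  rewrite expRD mulrA -/E1 ler_wpM2r ?expR_ge0//.
  have := expR_ge1Dx (x ^+ 2 / 4); lra.
rewrite ge0_integralZl//.
- by rewrite integral_normal_pdf mule1 ltry.
- by apply/measurable_EFinP; exact: measurable_normal_pdf.
- by move=> x _; rewrite lee_fin normal_pdf_ge0.
- by rewrite lee_fin !mulr_ge0// ?normal_peak_ge0// invr_ge0 normal_peak_ge0.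
Qed.

(* The value 1 of this constant is never needed: covariances are divided by it
   before Gaussian vectors are built. *)
Definition normal_var : R := \int[N]_x (x ^+ 2).

(** A zero second moment would concentrate the law at 0, a Lebesgue-null set. *)
Lemma normal_var_gt0 : 0 < normal_var.
Proof.
rewrite lt_neqAle Er_ge0 ?andbT; last by move=> x; exact: sqr_ge0.
apply/eqP => /esym /(Er_eq0 normal_sqr_integrable (fun x => sqr_ge0 x)) ae0.
have m0 : measurable (~` [set (0 : R)]) by exact: measurableC.
have N1 : N (~` [set (0 : R)]) = 0%E.
  apply/negligibleP => //; apply: negligibleS ae0.
  by move=> x /= x0 /eqP; rewrite sqrf_eq0 => /eqP.
have N2 : N [set (0 : R)] = 0%E.
  have /null_content_dominatesP := normal_prob_dominates (0 : R) 1.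
  by apply => //; exact: lebesgue_measure_set1.
have e : N setT = (N [set (0 : R)%R] + N (~` [set (0 : R)%R]))%E.
  by rewrite -[in LHS](setUv [set (0 : R)]) measureU// setICr.
have := etrans (esym e) (probability_setT N).
by rewrite N1 N2 adde0 => /eqP; rewrite eq_sym onee_eq0.
Qed.

Lemma normal_mean0 : \int[N]_x x = 0.
Proof.
have iN : L1 N id by apply: L1_of_sqr => //; exact: normal_sqr_integrable.
have mN : measurable_fun setT (-%R : R -> R) by exact: oppr_measurable.
have e : (\int[N]_x x%:E = \int[N]_x (- x)%:E)%E.
  have iN' : N.-integrable setT (EFin \o -%R).
    by have := L1Z (-1) iN; under [X in _.-integrable _ (_ \o X) -> _]eq_fun do rewrite mulN1r.
  have mN' : measurable_fun setT (-%R : measurableTypeR R -> measurableTypeR R) by [].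
  transitivity (\int[pushforward N (-%R : measurableTypeR R -> measurableTypeR R)]_x x%:E)%E; last first.
    by rewrite integral_pushforward.
  apply: eq_measure_integral => A mA _; rewrite /pushforward.
  have mNA : measurable (-%R @^-1` A) by exact: measurable_preimage mN mA.
  have h B : measurable B -> (N B = \int[N]_x (\1_B x)%:E)%E.
    by move=> mB; rewrite integral_indic// setIT.
  apply: (etrans (h _ mA)); apply: (etrans _ (esym (h _ mNA))); rewrite -normal_opp//.
  by apply/measurable_EFinP; exact: measurable_indic.
have : \int[N]_x x = - \int[N]_x x.
  transitivity (\int[N]_x (-1 * x)); last by rewrite ErZ// mulN1r.
  by rewrite /Rintegral e; congr fine; apply: eq_integral => x _; rewrite mulN1r.
lra.
Qed.

Lemma normal_convolution_bounded (a c K : R) (f : R -> R) : 0 <= a ->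
  measurable_fun setT f -> (forall x, `|f x| <= K) ->
  measurable_fun setT (fun t => \int[N]_s f (a * s + c * t)) /\
  \int[N]_t \int[N]_s f (a * s + c * t) =
  \int[N]_x f (Num.sqrt (a ^+ 2 + c ^+ 2) * x).
Proof.
move=> a0 mf fK.
have mlin (k b : R) : measurable_fun setT (fun x : R => k * x + b).
  by apply: measurable_funD => //; exact: measurable_funM.
have mflin (k b : R) : measurable_fun setT (fun x : R => f (k * x + b)).
  exact: measurableT_comp mf (mlin k b).
have iflin (k b : R) : L1 N (fun x : R => f (k * x + b)).
  by apply: (@L1_bounded _ _ _ _ _ K) => [|x]; [exact: mflin|exact: fK].
(* Shifting [f] by its bound reduces the claim to nonnegative integrands; the shift cancels at the
   end. *)
have g0 x : 0 <= f x + K by have := fK x; rewrite ler_norml => /andP[]; lra.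
have mg : measurable_fun setT (fun x => f x + K) by exact: measurable_funD.
have inner t : (\int[N]_s (f (a * s + c * t) + K)%:E =
    (\int[N]_s f (a * s + c * t) + K)%:E)%E.
  rewrite Er_EFin; last by apply: L1D => //; exact: L1_cst.
  by rewrite ErD ?Er_cst//; exact: L1_cst.
have mF : measurable_fun setT (fun t => \int[N]_s f (a * s + c * t)).
  have mF2 : measurable_fun setT (fun ts : R * R => (f (a * ts.2 + c * ts.1) + K)%:E).
    apply/measurable_EFinP; apply: (measurableT_comp mg).
    by apply: measurable_funD; exact: measurable_funM.
  have /measurable_EFinP h' : measurable_fun setT (fun t : R => (\int[N]_s f (a * s + c * t) + K)%:E).
    rewrite -(funext inner).
    by apply: (measurable_fun_fubini_tonelli_F (m2 := N) _ mF2) => x; rewrite lee_fin.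
  rewrite (_ : (fun _ => _) = (fun t => \int[N]_s f (a * s + c * t) + K - K)).
    by apply: measurable_funB.
  by apply/funext => t; rewrite addrK.
split => //.
have iF : L1 N (fun t => \int[N]_s f (a * s + c * t)).
  apply: (@L1_bounded _ _ _ _ _ K) => [|t]; first exact: mF.
  by apply: Er_bound => [|s]; [exact: mflin|exact: fK].
have ir : L1 N (fun x => f (Num.sqrt (a ^+ 2 + c ^+ 2) * x)).
  have := iflin (Num.sqrt (a ^+ 2 + c ^+ 2)) 0.
  by under [X in _.-integrable _ (_ \o X) -> _]eq_fun do rewrite addr0.
have mg' : measurable_fun setT (fun x => (f x + K)%:E) by exact/measurable_EFinP.
have g0' x : (0 <= (f x + K)%:E)%E by rewrite lee_fin.
have h := normal_convolution c a0 mg' g0'.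
have : (\int[N]_t (\int[N]_s f (a * s + c * t) + K)%:E =
    \int[N]_x (f (Num.sqrt (a ^+ 2 + c ^+ 2) * x) + K)%:E)%E.
  by rewrite -h; apply: eq_integral => t _; rewrite inner.
rewrite Er_EFin; last by apply: L1D => //; exact: L1_cst.
rewrite Er_EFin; last by apply: L1D => //; exact: L1_cst.
rewrite !ErD ?Er_cst//; [|exact: L1_cst|exact: L1_cst].
by move=> [] /addIr.
Qed.

End standard_normal.

Section normal_characteristic_function.
Context {R : realType}.
Local Notation N := (normal_prob (0 : R) 1).
Local Notation V := (@normal_var R).

Let trunc (tau : R) : R := \int[N]_x (x ^+ 2 * Num.min 1 `|tau * x|).

Let mcos (k b : R) : measurable_fun setT (fun x : R => cos (k * x + b)).
Proof.
apply: (measurableT_comp (continuous_measurable_fun (@continuous_cos R))).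
by apply: measurable_funD => //; exact: measurable_funM.
Qed.

Let L1_trunc (tau : R) : L1 N (fun x => x ^+ 2 * Num.min 1 `|tau * x|).
Proof.
have m1 : measurable_fun setT (fun x : R => x ^+ 2 * Num.min 1 `|tau * x|).
  apply: measurable_funM; first exact: measurable_funX.
  by apply: measurable_minr => //; apply: measurableT_comp => //; exact: measurable_funM.
apply: (@L1_le _ _ _ N _ (fun x => x ^+ 2)) => [|x|]; [exact: m1| |exact: normal_sqr_integrable].
have m0 : 0 <= Num.min 1 `|tau * x| by rewrite le_min ler01 normr_ge0.
rewrite ger0_norm; last by rewrite mulr_ge0// sqr_ge0.
by rewrite -[leRHS]mulr1 ler_wpM2l ?sqr_ge0// ge_min lexx.
Qed.

Let taylor_step (tau A : R) :
  `|\int[N]_x cos (tau * x + A) - expR (- (tau ^+ 2 * V / 2)) * cos A|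
  <= 3 * (tau ^+ 2 * trunc tau) + (tau ^+ 2 * V / 2) ^+ 2.
Proof.
have iN : L1 N (fun x => x).
  by apply: L1_of_sqr => //; exact: normal_sqr_integrable.
have i2 := @normal_sqr_integrable R.
have ic : L1 N (fun x => cos (tau * x + A)).
  by apply: (@L1_bounded _ _ _ _ _ 1) => [|x]; [exact: mcos|exact: cos_max].
pose rem x := cos (tau * x + A) - (cos A - (tau * sin A) * x - (tau ^+ 2 / 2 * cos A) * x ^+ 2).
have i3 : L1 N (fun x => (tau * sin A) * x) by exact: L1Z.
have i4 : L1 N (fun x => (tau ^+ 2 / 2 * cos A) * x ^+ 2) by exact: L1Z.
have i0 := L1_cst N (cos A).
have i5 := L1B (L1B i0 i3) i4.
have Erem : \int[N]_x cos (tau * x + A) = (1 - tau ^+ 2 * V / 2) * cos A + \int[N]_x rem x.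
  rewrite /rem (ErB ic i5) (ErB (L1B i0 i3) i4) (ErB i0 i3) Er_cst !ErZ//.
  by rewrite normal_mean0 -/V; lra.
have rem_bound x : `|rem x| <= (3 * tau ^+ 2) * (x ^+ 2 * Num.min 1 `|tau * x|).
  have := cos_taylor2 A (tau * x).
  rewrite /rem (addrC (tau * x)) exprMn => h.
  rewrite (_ : cos A - _ - _ = cos A - tau * x * sin A - tau ^+ 2 * x ^+ 2 / 2 * cos A); last by lra.
  by apply: le_trans h _; rewrite -!mulrA.
have h1 : `|\int[N]_x rem x| <= 3 * tau ^+ 2 * trunc tau.
  rewrite -ErZ//; apply: Er_norm_le; [|exact: L1Z|exact: rem_bound].
  exact: (L1_measurable (L1B ic i5)).
have V0 := ltW (@normal_var_gt0 R).
have x0 : 0 <= tau ^+ 2 * V / 2 by rewrite divr_ge0// mulr_ge0// sqr_ge0.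
have h2 := expRN_bound x0.
rewrite Erem; set x := tau ^+ 2 * V / 2 in x0 h2 *; set I := \int[N]_x rem x in h1 *.
rewrite (_ : _ - _ = I + (1 - x - expR (- x)) * cos A); last by lra.
apply: (le_trans (ler_normD _ _)); apply: lerD; first by rewrite mulrA.
by rewrite normrM -[leRHS]mulr1 ler_pM// cos_max.
Qed.

(* A standard normal variable is the sum of [n] independent copies of itself
   scaled by [1 / sqrt n], so its characteristic function satisfies the same
   approximate recursion as that of the walk. *)
Lemma normal_cf (t a : R) :
  \int[N]_x cos (t * x + a) = expR (- (t ^+ 2 * V / 2)) * cos a.
Proof.
pose c_ n : R := (Num.sqrt n%:R)^-1.
pose b n := t ^+ 2 * 3 * trunc (t * c_ n) + t ^+ 2 * t ^+ 2 * V ^+ 2 / 4 * (c_ n * c_ n).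
have bound n : (0 < n)%N ->
    `|\int[N]_x cos (t * x + a) - expR (- (t ^+ 2 * V / 2)) * cos a| <= b n.
  move=> n0; pose tau := t * c_ n.
  have sn : Num.sqrt n%:R != 0 :> R by rewrite gt_eqF// sqrtr_gt0 ltr0n.
  have nc : n%:R * (c_ n * c_ n) = 1.
    by rewrite -expr2 exprVn sqr_sqrtr// mulfV// pnatr_eq0 -lt0n.
  pose e k := \int[N]_x cos (tau * (Num.sqrt k%:R * x) + a).
  pose err := 3 * (tau ^+ 2 * trunc tau) + (tau ^+ 2 * V / 2) ^+ 2.
  have step k : (k < n)%N -> `|e k.+1 - expR (- (tau ^+ 2 * V / 2)) * e k| <= err.
    move=> _; have mf : measurable_fun setT (fun x => cos (tau * x + a)) by exact: mcos.
    (* With coefficients 1 and [sqrt k], a fresh normal variable is added to a sum of [k] of them,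
       so that [e k.+1] arises from [e k] by one [taylor_step]. *)
    have [mF] := @normal_convolution_bounded R 1 (Num.sqrt k%:R) 1 _ ler01 mf (fun x => cos_max _).
    rewrite expr1n sqr_sqrtr// (_ : 1 + k%:R = k.+1%:R); last by rewrite -natr1 addrC.
    move=> e1; rewrite /e -e1 -ErZ; last first.
      apply: (@L1_bounded _ _ _ _ _ 1) => [|x]; last exact: cos_max.
      by under eq_fun do rewrite mulrA; exact: mcos.
    rewrite -ErB; first last.
    - apply: L1Z; apply: (@L1_bounded _ _ _ _ _ 1) => [|x]; last exact: cos_max.
      by under eq_fun do rewrite mulrA; exact: mcos.
    - apply: (@L1_bounded _ _ _ _ _ 1) => // y; apply: Er_bound => [|x]; last exact: cos_max.
      under eq_fun do rewrite mul1r mulrDr -addrA; exact: mcos.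
    apply: Er_bound => [|y].
      apply: measurable_funB => //; apply: measurable_funM => //.
      by under eq_fun do rewrite mulrA; exact: mcos.
    have := taylor_step tau (tau * (Num.sqrt k%:R * y) + a).
    by under eq_Rintegral do rewrite addrA -mulrDr -[X in tau * (X + _)]mul1r.
  have l01 : 0 <= expR (- (tau ^+ 2 * V / 2)) <= 1.
    rewrite expR_ge0 -expR0 ler_expR oppr_le0 divr_ge0// mulr_ge0 ?sqr_ge0//.
    exact: ltW (@normal_var_gt0 R).
  have err0 : 0 <= err by exact: le_trans (normr_ge0 _) (taylor_step tau 0).
  have := linear_recursion_bound l01 err0 step.
  rewrite -expRM_natl mulrN.
  have tn : n%:R * tau ^+ 2 = t ^+ 2.
    by rewrite /tau exprMn mulrCA expr2 (expr2 (c_ n)) nc mulr1.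
  rewrite (_ : n%:R * (tau ^+ 2 * V / 2) = t ^+ 2 * V / 2); last by rewrite -tn; lra.
  have -> : e n = \int[N]_x cos (t * x + a).
    by apply: eq_Rintegral => x _; rewrite /tau mulrA -(mulrA t) mulVf// mulr1.
  have -> : e 0%N = cos a.
    rewrite -[RHS](Er_cst N); apply: eq_Rintegral => x _.
    by rewrite sqrtr0 mul0r mulr0 add0r.
  move=> h; apply: (le_trans h); rewrite /err /b -/tau.
  have -> : t ^+ 2 * t ^+ 2 * V ^+ 2 / 4 * (c_ n * c_ n) = t ^+ 2 * tau ^+ 2 * V ^+ 2 / 4.
    by rewrite /tau exprMn (expr2 (c_ n)); lra.
  by rewrite -tn; lra.
have cc : c_ n @[n --> \oo] --> (0 : R) by exact: cvg_invsqrt.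
have ct : trunc (t * c_ n) @[n --> \oo] --> (0 : R).
  rewrite -[X in _ --> X](Er_cst N).
  apply: (@Er_cvg _ _ _ N (fun n x => x ^+ 2 * Num.min 1 `|t * c_ n * x|) (fun=> 0) (fun x => x ^+ 2)) => //.
  - by move=> n; apply: L1_measurable (L1_trunc _).
  - move=> x; rewrite -[X in _ --> X](mulr0 (x ^+ 2)); apply: cvgMl_tmp.
    apply: (@squeeze_cvgr _ _ _ _ (fun=> 0) (fun n => `|t * c_ n * x|)).
    + by apply: nearW => n; rewrite le_min ler01 normr_ge0 /= ge_min lexx orbT.
    + exact: cvg_cst.
    + rewrite -[X in _ --> X](normr0 R) -(mul0r x) -(mulr0 t).
      by apply: cvg_norm; apply: cvgMr_tmp; exact: cvgMl_tmp.
  - exact: normal_sqr_integrable.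
  - move=> n x; rewrite ger0_norm; last by rewrite mulr_ge0 ?sqr_ge0// le_min ler01 normr_ge0.
    by rewrite -[leRHS]mulr1 ler_wpM2l ?sqr_ge0// ge_min lexx.
have cb : b n @[n --> \oo] --> (0 : R).
  rewrite [X in _ --> X](_ : 0 = t ^+ 2 * 3 * 0 + t ^+ 2 * t ^+ 2 * V ^+ 2 / 4 * (0 * 0)); last by lra.
  by apply: cvgD; apply: cvgMl_tmp => //; exact: cvgM.
apply/eqP; rewrite -subr_eq0 -normr_le0; apply/ler_addgt0Pl => eps eps0.
have /cvgr0Pnorm_le/(_ _ eps0) n1 := cb.
have [n [n0 nb]] := @filter_ex _ \oo _ _ (filterI (nbhs_infty_gt 0) n1).
by rewrite addr0 (le_trans (bound n n0))// (le_trans (ler_norm _)).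
Qed.

Lemma normal_prob_scale (s : R) (B : set R) : 0 < s -> measurable B ->
  N [set x | B (s * x)] = normal_prob 0 s B.
Proof.
move=> s0 mB.
have ms : measurable_fun setT (fun x : R => s * x) by exact: measurable_funM.
have mB' : measurable [set x | B (s * x)] by exact: measurable_preimage ms mB.
transitivity (\int[N]_x (\1_[set x | B (s * x)] x)%:E)%E.
  by rewrite integral_indic// setIT.
transitivity (\int[normal_prob 0 s]_x (\1_B x)%:E)%E; last by rewrite integral_indic// setIT.
have mi (A : set R) : measurable A -> measurable_fun setT (fun x => (\1_A x)%:E : \bar R).
  by move=> mA; apply/measurable_EFinP; exact: measurable_indic.
rewrite !ge0_integral_normal//; [|exact: mi|exact: mi].
have mh : measurable_fun setT (fun x => ((\1_B x)%:E * (normal_pdf 0 s x)%:E)%E).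
  by apply: emeasurable_funM; [exact: mi|apply/measurable_EFinP; exact: measurable_normal_pdf].
rewrite (ge0_integral_affine 0 s0 mh); last first.
  by move=> x; rewrite mule_ge0// lee_fin normal_pdf_ge0.
rewrite -ge0_integralZl_EFin//; last 3 first.
- by move=> x _; rewrite mule_ge0// lee_fin normal_pdf_ge0.
- apply: (measurableT_comp mh); exact: measurable_funD.
- exact: ltW.
apply: eq_integral => x _; rewrite addr0 muleCA -!EFinM !indicE; congr (_%:E).
rewrite (_ : (x \in [set x | B (s * x)]) = (s * x \in B)); last by apply/asboolP/asboolP.
congr (_ * _); rewrite normal_pdf01E normal_pdfE ?gt_eqF// /normal_fun subr0.
have s0' : s != 0 by rewrite gt_eqF.
rewrite mulrA; congr (_ * expR _).
  have -> : normal_peak s = s^-1 * normal_peak 1 :> R.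
    rewrite /normal_peak expr1n mul1r -mulrnAr sqrtrM ?sqr_ge0//.
    by rewrite sqrtr_sqr gtr0_norm// invfM.
  by rewrite mulrA mulfV// mul1r.
rewrite exprMn mulNr; congr (- _).
rewrite -[s ^+ 2 *+ 2]mulr_natr invfM mulrA; congr (_ / _).
by rewrite mulrAC mulfV ?mul1r// expf_neq0.
Qed.

End normal_characteristic_function.

(** * Positive semidefinite forms as sums of squares *)

Section psd_decomposition.
Context {R : realType} {d : nat}.
Implicit Types S : 'M[R]_d.

Let psd S := S^T = S /\ forall u : 'cV[R]_d, 0 <= dotcv u (S *m u).

Lemma psd_cauchy_schwarz S (u w : 'cV[R]_d) : S^T = S ->
  (forall x : 'cV[R]_d, 0 <= dotcv x (S *m x)) ->
  dotcv u (S *m w) ^+ 2 <= dotcv u (S *m u) * dotcv w (S *m w).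
Proof.
move=> Ssym Spsd.
have wu : dotcv w (S *m u) = dotcv u (S *m w) by rewrite dotcvC dotcv_mull Ssym.
have expand t : 0 <= dotcv w (S *m w) + 2 * t * dotcv u (S *m w) + t ^+ 2 * dotcv u (S *m u).
  have := Spsd (w + t *: u).
  rewrite mulmxDr -scalemxAr !(dotcvDl, dotcvDr, dotcvZl, dotcvZr) wu; lra.
have := Spsd u; rewrite le_eqVlt => /predU1P[u0|u0].
  rewrite -u0 mul0r; have [->|/eqP p0] := eqVneq (dotcv u (S *m w)) 0; first by rewrite expr0n.
  have b2 : 2 * dotcv u (S *m w) != 0 by rewrite mulf_neq0//; exact/eqP.
  (* When [u] is isotropic the quadratic in [t] is affine; a nonzero slope would give it the value
     [-1] at this [t]. *)
  have := divfK b2 (- (dotcv w (S *m w) + 1)); set t := _ / _ => tE.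
  by have := expand t; rewrite -u0; lra.
have := expand (- dotcv u (S *m w) / dotcv u (S *m u)).
set b := dotcv u (S *m w); set a := dotcv u (S *m u) in u0 *; set c := dotcv w _.
have ia : a * a^-1 = 1 by rewrite mulfV// gt_eqF.
move=> h; have {}h : 0 <= a * (c + 2 * (- b / a) * b + (- b / a) ^+ 2 * a) by rewrite mulr_ge0// ltW.
move: h; rewrite (_ : a * _ = a * c - 2 * b ^+ 2 * (a * a^-1) + b ^+ 2 * (a * a^-1) ^+ 2); last by lra.
by rewrite ia; lra.
Qed.

(** Cholesky elimination, by induction on the number of nonzero diagonal entries. Cauchy-Schwarz for
    the form keeps the remainder positive semidefinite, and shows that a form with zero diagonal
    vanishes. *)
Lemma psd_sum_squares S : S^T = S -> (forall u : 'cV[R]_d, 0 <= dotcv u (S *m u)) ->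
  exists vs : seq 'cV[R]_d, forall u, dotcv u (S *m u) = \sum_(v <- vs) dotcv u v ^+ 2.
Proof.
move=> Ssym Spsd; have {Ssym Spsd} : psd S by split.
have [n] := ubnP #|[pred i | S i i != 0]|; elim: n S => // n IH S.
rewrite ltnS => leSn hS; have [Ssym Spsd] := hS.
have diag' (A : 'M[R]_d) i : dotcv (delta_mx i 0) (A *m delta_mx i 0) = A i i :> R.
  by rewrite dotcvC dotcv_delta mulmx_delta_col.
have diag := diag' S.
have [i iS|S0] := pickP [pred i | S i i != 0]; last first.
  exists [::] => u; rewrite big_nil.
  have zero w j : dotcv w (S *m delta_mx j 0) = 0.
    have := psd_cauchy_schwarz w (delta_mx j 0) Ssym Spsd.
    rewrite diag; have /eqP -> := negbFE (S0 j).
    by rewrite mulr0 => h; apply/eqP; rewrite -sqrf_eq0 eq_le h sqr_ge0.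
  rewrite /dotcv big1// => j _; rewrite (_ : (S *m u) j 0 = 0) ?mulr0//.
  by rewrite -[LHS]dotcv_delta dotcv_mull Ssym zero.
have si : 0 < S i i by rewrite lt_neqAle eq_sym -diag Spsd andbT diag; exact: iS.
(* Subtracting [v v^T] clears the [i]-th row and column of [S]. *)
pose v := (Num.sqrt (S i i))^-1 *: (S *m (delta_mx i 0 : 'cV_d)).
pose S' := S - v *m v^T.
have vv (u : 'cV[R]_d) : dotcv u (v *m v^T *m u) = dotcv u v ^+ 2.
  by rewrite -mulmxA (mx11_scalar (v^T *m u)) mul_mx_scalar dotcvZr -dotcvE (dotcvC v) expr2.
have S'E u : dotcv u (S' *m u) = dotcv u (S *m u) - dotcv u v ^+ 2.
  by rewrite mulmxBl dotcvBr vv.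
have vsq u : dotcv u v ^+ 2 = (S i i)^-1 * dotcv u (S *m delta_mx i 0) ^+ 2.
  by rewrite dotcvZr exprMn exprVn sqr_sqrtr// ltW.
have hS' : psd S'.
  split; first by rewrite /S' linearB /= trmx_mul trmxK Ssym.
  move=> u; rewrite S'E vsq subr_ge0 ler_pdivrMl// mulrC -diag.
  exact: psd_cauchy_schwarz.
have [|vs vsE] := IH S' _ hS'.
  apply: leq_trans leSn; apply: proper_card; apply/properP; split.
    apply/fintype.subsetP => j; rewrite !inE; apply: contraNneq => Sj.
    have [_ h] := hS'; have := h (delta_mx j 0).
    rewrite S'E diag Sj sub0r oppr_ge0 => h1.
    by rewrite -diag' S'E diag Sj sub0r oppr_eq0 eq_le h1 sqr_ge0.
  exists i; rewrite ?inE// negbK -diag' S'E vsq diag.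
  rewrite expr2 mulKf; first by rewrite subrr.
  by rewrite gt_eqF.
exists (v :: vs) => u; rewrite big_cons -vsE S'E; lra.
Qed.

Lemma psd_form_eq0 S (v : 'cV[R]_d) : S^T = S ->
  (forall u : 'cV[R]_d, 0 <= dotcv u (S *m u)) -> dotcv v (S *m v) = 0 -> S *m v = 0.
Proof.
move=> Ssym Spsd v0; apply: dotcv_eq0.
have := psd_cauchy_schwarz (S *m v) v Ssym Spsd; rewrite v0 mulr0 => h.
by apply/eqP; rewrite -sqrf_eq0 eq_le h sqr_ge0.
Qed.

End psd_decomposition.

Section gaussian_construction.
Context {R : realType} {d : nat}.
Local Notation N := (normal_prob (0 : R) 1).
Local Notation E := 'cV[R]_d.

Lemma gaussian_sum_squares (vs : seq E) :
  exists mu : probability (borel E) R, forall u : E, forall B : set R, measurable B ->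
    mu [set x | B (dotcv u x)] =
    N [set t | B (Num.sqrt (\sum_(v <- vs) dotcv u v ^+ 2) * t)].
Proof.
elim: vs => [|v vs [mu IH]].
  exists (dirac (0 : borel E)) => u B mB.
  transitivity (N [set _ | B 0]); last first.
    by rewrite big_nil sqrtr0; congr (N _); apply: eq_set => t; rewrite mul0r.
  have [B0|B0] := pselect (B 0).
    rewrite [in RHS](_ : [set _ | _] = setT) ?probability_setT; last by apply/seteqP; split.
    by rewrite [LHS]diracE mem_set //= dotcv0r.
  rewrite [in RHS](_ : [set _ | _] = set0) ?measure0; last by apply/seteqP; split.
  by rewrite [LHS]diracE memNset //= dotcv0r.
pose f (z : borel E * measurableTypeR R) : borel E := (z.1 : E) + z.2 *: v.
have mf : measurable_fun setT f.
  apply: measurable_cV => i.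
  rewrite (_ : (fun _ => _) = fun z => (z.1 : E) i 0 + z.2 * v i 0).
    apply: measurable_funD; last exact: measurable_funM.
    exact: measurableT_comp (@mx_measurable_id_borel R d i 0) measurable_fst.
  by apply/funext => z; rewrite !mxE.
pose F : {mfun (borel E * measurableTypeR R)%type >-> borel E} :=
  HB.pack f (isMeasurableFun.Build _ _ _ _ f mf).
pose nu : probability (borel E) R := distribution (mu \x^ N)%E F.
exists nu => u B mB.
have mdot : measurable_fun setT (fun x : borel E => dotcv u x).
  by apply: measurable_dotcv; [exact: mx_measurable_cst|exact: mx_measurable_id_borel].
have mi A : measurable A -> measurable_fun setT (fun x : R => (\1_A x)%:E : \bar R).
  by move=> mA; apply/measurable_EFinP; exact: measurable_indic.
have mBsc (k b : R) : measurable [set t | B (k * t + b)].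
  apply: (@measurable_preimage _ _ _ _ (fun t : R => k * t + b)) => //.
  by apply: measurable_funD => //; exact: measurable_funM.
rewrite big_cons addrC -[dotcv u v ^+ 2]/(dotcv u v ^+ 2).
set q := \sum_(_ <- _) _.
have q0 : 0 <= q by apply: sumr_ge0 => ? _; exact: sqr_ge0.
transitivity (\int[N]_t \int[N]_s (\1_B (Num.sqrt q * s + dotcv u v * t)%R)%:E)%E.
  transitivity (\int[N]_t mu [set x | B (dotcv u x + t * dotcv u v)%R])%E.
    apply: eq_integral => t _ /=; congr (mu _); apply/seteqP; split => x /=.
      by rewrite /ysection /= inE /= /f dotcvDr dotcvZr.
    by rewrite /ysection /= inE /= /f dotcvDr dotcvZr.
  apply: eq_integral => t _.
  have mBt : measurable [set y | B (y + t * dotcv u v)].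
    by have := mBsc 1 (t * dotcv u v); under eq_set do rewrite mul1r.
  rewrite (IH u _ mBt) -/q.
  have := integral_indic N measurableT (mBsc (Num.sqrt q) (t * dotcv u v)).
  rewrite setIT => <-; apply: eq_integral => s _; congr (_%:E).
  by rewrite mulrC !indicE; congr (_%:R); apply/asboolP/asboolP.
rewrite (normal_convolution (dotcv u v) (sqrtr_ge0 q) (mi B mB)); last first.
  by move=> x; rewrite lee_fin.
rewrite sqr_sqrtr//.
have mBs : measurable [set t | B (Num.sqrt (q + dotcv u v ^+ 2) * t)].
  by have := mBsc (Num.sqrt (q + dotcv u v ^+ 2)) 0; under eq_set do rewrite addr0.
have := integral_indic N measurableT mBs; rewrite setIT => <-.
apply: eq_integral => s _; congr (_%:E); rewrite !indicE; congr (_%:R).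
Qed.

Lemma gaussian_exists (C : 'M[R]_d) : C^T = C ->
  (forall u : E, 0 <= dotcv u (C *m u)) ->
  exists mu : probability (borel E) R,
    (forall (u : E) (a : R), \int[mu]_x cos (dotcv u x + a) =
       expR (- (dotcv u (C *m u) / 2)) * cos a) /\
    (forall u : E, 0 < dotcv u (C *m u) -> exists2 s : R, 0 < s &
       forall B : set R, measurable B ->
         pushforward mu (dotcv u) B = normal_prob 0 s B).
Proof.
move=> Csym Cpsd; pose V := @normal_var R; have V0 : 0 < V := @normal_var_gt0 R.
have VC u : dotcv u ((V^-1 *: C) *m u) = V^-1 * dotcv u (C *m u).
  by rewrite -scalemxAl dotcvZr.
have [||vs vsE] := @psd_sum_squares R d (V^-1 *: C).
- by rewrite linearZ /= Csym.
- by move=> u; rewrite VC mulr_ge0// invr_ge0 ltW.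
have [mu muE] := gaussian_sum_squares vs.
have mudot u B : measurable B -> pushforward mu (dotcv u) B =
    N [set t | B (Num.sqrt (V^-1 * dotcv u (C *m u)) * t)].
  by move=> mB; rewrite -VC vsE -muE.
exists mu; split => [u a|u u0]; last first.
  exists (Num.sqrt (V^-1 * dotcv u (C *m u))) => [|B mB].
    by rewrite sqrtr_gt0 mulr_gt0// invr_gt0.
  by rewrite mudot// normal_prob_scale// sqrtr_gt0 mulr_gt0// invr_gt0.
pose s := Num.sqrt (V^-1 * dotcv u (C *m u)).
have sV : s ^+ 2 * V = dotcv u (C *m u).
  by rewrite sqr_sqrtr ?mulr_ge0 ?invr_ge0 ?(ltW V0)// mulrAC mulVf ?mul1r// gt_eqF.
have mdot : measurable_fun setT (fun x : borel E => dotcv u x).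
  by apply: measurable_dotcv; [exact: mx_measurable_cst|exact: mx_measurable_id_borel].
have mdot' : measurable_fun setT (fun x : borel E => dotcv u x : measurableTypeR R) by [].
have ms : measurable_fun setT (fun t : measurableTypeR R => s * t : measurableTypeR R).
  exact: measurable_funM.
have mcos : measurable_fun setT (fun x : measurableTypeR R => cos (x + a)).
  apply: (measurableT_comp (continuous_measurable_fun (@continuous_cos R))).
  exact: measurable_funD.
have icos (dT : measure_display) (T : measurableType dT) (Q : probability T R) (h : T -> R) :
    measurable_fun setT h -> L1 Q (fun w => cos (h w + a)).
  move=> mh; apply: (@L1_bounded _ _ _ _ _ 1) => [|w]; last exact: cos_max.
  exact: measurableT_comp mcos mh.
rewrite -sV -normal_cf /Rintegral; congr fine.
transitivity (\int[pushforward mu (fun x : borel E => dotcv u x : measurableTypeR R)]_y (cos (y + a)%R)%:E)%E.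
  rewrite integral_pushforward//; [exact/measurable_EFinP|exact: icos mdot].
transitivity (\int[pushforward N (fun t : measurableTypeR R => (s * t)%R : measurableTypeR R)]_y
    (cos (y + a)%R)%:E)%E.
  by apply: eq_measure_integral => B mB _; exact: mudot.
rewrite integral_pushforward//; [exact/measurable_EFinP|exact: icos ms].
Qed.

End gaussian_construction.

(** * The central limit theorem *)

Lemma continuous_sum (R : realType) (T : topologicalType) (I : Type) (s : seq I)
  (F : I -> T -> R) : (forall i, continuous (F i)) -> continuous (fun x => \sum_(i <- s) F i x).
Proof.
by move=> cF x; apply: cvg_big => [|i _]; [exact: add_continuous|exact: cF].
Qed.

Lemma continuous_quad (R : realType) d (S : 'M[R]_d) (c : 'cV[R]_d) :
  continuous (fun x : 'cV[R]_d => dotcv (x - c) (S *m (x - c))).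
Proof.
have h k : continuous (fun x : 'cV[R]_d => (x - c) k 0).
  rewrite (_ : (fun _ => _) = (fun x : 'cV[R]_d => x k 0 - c k 0)); last first.
    by apply/funext => x; rewrite !mxE.
  by move=> x; exact: (cvgB (@coord_continuous R d 1 k 0 x) (cvg_cst _)).
rewrite (funext (fun x => dotcv_quad (x - c) S)).
apply: continuous_sum => ij x; exact: (cvgM (cvgM (h _ x) (h _ x)) (cvg_cst _)).
Qed.

Section covariance.
Context {dT : measure_display} {T : measurableType dT} {dS : measure_display}
  {S : measurableType dS} {R : realType} {P : probability T R} {d : nat}.
Variables (X : nat -> {RV P >-> S}) (tr : S -> 'cV[R]_d).
Hypothesis Xident : identically_distributed X.
Hypothesis mtr : mx_measurable tr.
Hypothesis tr2 : L1 P (fun w => dotcv (tr (X 0%N w)) (tr (X 0%N w))).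

Let L1_entry i j : L1 P (fun w => tr (X 0%N w) i 0 * tr (X 0%N w) j 0).
Proof. exact: (L1_tr_prod Xident mtr tr2). Qed.

Lemma cov_mx_form (Q : 'M[R]_d) :
  L1 P (fun w => dotcv (tr (X 0%N w)) (Q *m tr (X 0%N w))) /\
  \tr (cov_mx X tr *m Q^T) = \int[P]_w dotcv (tr (X 0%N w)) (Q *m tr (X 0%N w)).
Proof.
have e w : dotcv (tr (X 0%N w)) (Q *m tr (X 0%N w)) =
    \sum_i \sum_j tr (X 0%N w) i 0 * tr (X 0%N w) j 0 * Q i j.
  apply: eq_bigr => i _; rewrite mxE mulr_sumr; apply: eq_bigr => j _.
  by rewrite (mulrC (Q i j)) mulrA.
rewrite (funext e); split.
  by apply: L1_sum => i; apply: L1_sum => j; exact: L1Zr.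
rewrite Er_sum => [|i]; last by apply: L1_sum => j; exact: L1Zr.
apply: eq_bigr => i _; rewrite mxE Er_sum => [|j]; last exact: L1Zr.
by apply: eq_bigr => j _; rewrite !mxE ErZr.
Qed.

Lemma cov_mx_sym : (cov_mx X tr)^T = cov_mx X tr.
Proof.
apply/matrixP => i j; rewrite !mxE; apply: eq_Rintegral => w _.
by rewrite mulrC.
Qed.

Lemma cov_mx_psd u : 0 <= dotcv u (cov_mx X tr *m u).
Proof.
rewrite qform_tr; have [_ ->] := cov_mx_form (u *m u^T); apply: Er_ge0 => w.
rewrite -mulmxA (mx11_scalar (u^T *m _)) mul_mx_scalar dotcvZr -dotcvE (dotcvC u).
by rewrite -expr2 sqr_ge0.
Qed.

End covariance.

Unset Implicit Arguments.

Theorem theorem1 (R : realType) (d : nat)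
    (dT : measure_display) (T : measurableType dT) (P : probability T R)
    (X : nat -> {RV P >-> borel (Isom R d)}) (x0 : 'cV[R]_d)
    (Xindep : mutually_independent X)
    (Xident : identically_distributed X)
    (Y1_moment2 : (\int[P]_w ((enorm (walk X x0 1 w)) ^+ 2)%:E < +oo)%E)
    (Xnondeg : ~ degenerate P X x0) :
  exists v0 : 'cV[R]_d,
    exists2 mu : probability (borel 'cV[R]_d) R, gaussian mu &
      weak_cvg
        (fun l : nat => pushforward P
           (fun w => (Num.sqrt (l%:R : R))^-1 *: (walk X x0 l w - l%:R *: v0)
              : borel 'cV[R]_d))
        mu.
Proof.
pose th (g : borel (Isom R d)) : 'M[R]_d := isom_lin g.
pose pt (x : 'cV[R]_d) (g : borel (Isom R d)) : 'cV[R]_d := isom_fun g x.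
have mth : mx_measurable th by move=> i j; exact: measurable_isom_lin.
have mpt x : mx_measurable (pt x) by move=> i j; rewrite (ord1 j); exact: measurable_isom_fun.
have thO s : (th s)^T *m th s = 1%:M by exact: isom_lin_orthl.
have ptE x g : pt x g = th g *m x + pt 0 g by exact: isom_funE.
have mX k p q (f : borel (Isom R d) -> 'M[R]_(p, q)) : mx_measurable f ->
    mx_measurable (fun w => f (X k w)).
  by move=> mf i j; exact: (measurableT_comp (mf i j)).
(* A second moment at [x0] gives one at every [x], as [|g x - g x0| = |x - x0|]; the shift [b]
   serves the recentred translation [tr] below. *)
have pt2 x b : L1 P (fun w => dotcv (pt x (X 0%N w) + b) (pt x (X 0%N w) + b)).
  have i0 : L1 P (fun w => dotcv (pt x0 (X 0%N w)) (pt x0 (X 0%N w))).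
    apply/integrableP; split.
      by apply/measurable_EFinP; apply: measurable_dotcv; exact: mX.
    apply: le_lt_trans Y1_moment2; apply: ge0_le_integral => //.
    - apply/measurable_EFinP; apply: measurableT_comp => //.
      by apply: measurable_dotcv; exact: mX.
    - apply/measurable_EFinP; apply: measurable_funX; apply: measurable_enorm.
      exact: (mX 0%N _ _ (pt x0)).
    - by move=> w _; rewrite lee_fin ger0_norm ?dotcv_ge0// enorm_sqr.
  pose K := 2 * (2 * dotcv (x - x0) (x - x0) + 2 * dotcv b b).
  apply: (@L1_le _ _ _ _ _ (fun w => 2 * dotcv (pt x0 (X 0%N w)) (pt x0 (X 0%N w)) + K)).
  - by apply: measurable_dotcv; apply: mx_measurableD; [exact: mX| |exact: mX|];
      exact: mx_measurable_cst.
  - move=> w; rewrite ger0_norm ?dotcv_ge0//.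
    rewrite (_ : pt x _ + b = pt x0 (X 0%N w) + ((pt x (X 0%N w) - pt x0 (X 0%N w)) + b)).
      apply: (le_trans (dotcvD_le _ _)); rewrite lerD2l /K ler_pM2l//.
      by rewrite -(isom_dist (X 0%N w) x x0); exact: dotcvD_le.
    by rewrite addrCA addrA subrK.
  - by apply: L1D; [exact: L1Z|exact: L1_cst].
have pt1 x i : L1 P (fun w => pt x (X 0%N w) i 0).
  have h := pt2 x 0; apply: L1_of_sqr; first exact: (mX 0%N _ _ (pt x)).
  apply: (L1_le _ _ h) => [|w]; first by apply: measurable_funX; exact: (mX 0%N _ _ (pt x)).
  by rewrite addr0 ger0_norm ?sqr_ge0// sqr_coord_le.
pose B w := th (X 0%N w).
have mB i j : measurable_fun setT (fun w => B w i j) by exact: mX.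
have isoB w x y : dotcv (B w *m x) (B w *m y) = dotcv x y by exact: isom_lin_dot.
pose vbar : 'cV[R]_d := \col_i \int[P]_w pt 0 (X 0%N w) i 0.
have [v0 [c [vbarE Mv0]]] := mean_ergodic_decomp P mB isoB vbar.
have thv0 k : {ae P, forall w, th (X k w) *m v0 = v0}.
  apply: (@ae_ident_mx _ _ _ _ _ _ _ _ _ _ (fun g => th g *m v0)) => //.
    by apply: mx_measurableM => //; exact: mx_measurable_cst.
  exact: (mean_mx_fixed_ae mB isoB Mv0).
(* The step seen from the origin [c] with drift [v0] removed. Its mean is [M c + vbar - c - v0],
   which vanishes by [vbarE]. *)
pose tr g := pt c g + (- c - v0).
have mtr : mx_measurable tr by apply: mx_measurableD => //; exact: mx_measurable_cst.
have tr2 : L1 P (fun w => dotcv (tr (X 0%N w)) (tr (X 0%N w))) by exact: pt2.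
have tr0 i : \int[P]_w tr (X 0%N w) i 0 = 0.
  transitivity (\int[P]_w ((B w *m c) i 0 + pt 0 (X 0%N w) i 0 + (- c - v0) i 0)).
    by apply: eq_Rintegral => w _; rewrite /tr ptE !mxE.
  have iB : L1 P (fun w => (B w *m c) i 0).
    have := L1B (pt1 c i) (pt1 0 i); rewrite [X in L1 P X -> _](_ : _ = (fun w => (B w *m c) i 0))//.
    by apply/funext => w; rewrite (ptE c) mxE addrK.
  rewrite ErD; [|by apply: L1D|exact: L1_cst].
  rewrite ErD// Er_cst -mean_mxE//.
  have := congr1 (fun v : 'cV[R]_d => v i 0) vbarE; rewrite [X in X = _]mxE => ->.
  rewrite [(v0 + _) i 0]mxE [(c - _) i 0]mxE [(- (_ *m _)) i 0]mxE.
  rewrite [(- c - v0) i 0]mxE [(- c) i 0]mxE [(- v0) i 0]mxE; lra.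
have walkE l : {ae P, forall w, walk X x0 l w = fwd_pos X th tr (x0 - c) l w + (c + l%:R *: v0)}.
  elim: l => [|l IH]; first by apply: aeW => w /=; rewrite scale0r addr0 subrK.
  apply: filterS2 IH (thv0 l) => w e1 e2 /=.
  rewrite isom_funE -/(th (X l w)) -/(pt 0 (X l w)) e1 /tr (ptE c) !mulmxDr -scalemxAr e2.
  rewrite -natr1 scalerDl scale1r.
  move: (_ *m fwd_pos _ _ _ _ _ _) (_ *m c) (pt 0 _) => y tc p.
  apply/matrixP => i j; rewrite !mxE. lra.
have [C0 [D [CE MC0]]] := mean_conj_decomp P mB (fun w => thO _) (cov_mx X tr).
have C0sym := mean_conj_fixed_sym mB (fun w => thO _) CE MC0 (cov_mx_sym X tr).
have C0psd := mean_conj_fixed_psd mB (fun w => thO _) CE MC0 (cov_mx_psd Xident mtr tr2).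
have C0pd u : u != 0 -> 0 < dotcv u (C0 *m u).
  move=> u0; rewrite lt_neqAle C0psd andbT; apply/eqP => /esym q0; apply: Xnondeg.
  have [S [Ssym Spsd MS trS]] := dual_fixed_form mB (fun w => thO _) u CE MC0.
  have [iS ->] := cov_mx_form Xident mtr tr2 S; rewrite q0 => /esym ES.
  have Str k : {ae P, forall w, S *m tr (X k w) = 0}.
    apply: (@ae_ident_mx _ _ _ _ _ _ _ _ _ _ (fun g => S *m tr g)) => //.
      by apply: mx_measurableM => //; exact: mx_measurable_cst.
    have := Er_eq0 iS (fun w => Spsd _) ES; apply: filterS => w.
    exact: psd_form_eq0.
  have thS k : {ae P, forall w, th (X k w) *m S *m (th (X k w))^T = S}.
    apply: (@ae_ident_mx _ _ _ _ _ _ _ _ _ _ (fun g => th g *m S *m (th g)^T)) => //.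
      apply: mx_measurableM; last exact: mx_measurable_tr.
      by apply: mx_measurableM => //; exact: mx_measurable_cst.
    exact: (mean_conj_fixed_ae mB (fun w => thO _) MS).
  pose form x := dotcv x (S *m x).
  (* The form ignores the translation since [S] kills it, and the rotation since [S] is invariant
     under conjugation. *)
  have formE l : {ae P, forall w, form (fwd_pos X th tr (x0 - c) l w) = form (x0 - c)}.
    elim: l => [|l IH]; first exact: aeW.
    apply: filterS3 IH (Str l) (thS l) => w e1 e2 e3 /=; rewrite -e1 /form.
    set y := fwd_pos _ _ _ _ _ _; set t := th (X l w) in e3 *; set z := tr _ in e2 *.
    have e4 : t^T *m S *m t = S.
      by rewrite -[in LHS]e3 !mulmxA thO mul1mx -mulmxA thO mulmx1.
    rewrite mulmxDr e2 addr0 dotcvDl.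
    have -> : dotcv z (S *m (t *m y)) = 0.
      by rewrite dotcvC dotcv_mull Ssym e2 dotcv0r.
    by rewrite addr0 dotcv_mull !mulmxA e4.
  (* The isometry witnessing degeneracy is the translation by [v0], whose powers follow the
     drift. *)
  pose g : Isom R d := SigSub (mem_set (isometries_translation v0)).
  exists [set x | form (x - c) = form (x0 - c)], g; split.
  - have := @preimage_closed _ _ (fun x : 'cV[R]_d => form (x - c)) [set form (x0 - c)].
    apply; last exact: closed_eq.
    by move=> x _; exact: continuous_quad.
  (* Were the level set everything, the form would be constant, equal to its value 0 at the origin;
     then [\tr S = dotcv u u] would vanish. *)
  - apply/eqP => AT; have form0 x : form x = 0.
      have h y : form (y - c) = form (x0 - c) by have : [set: 'cV[R]_d] y by []; rewrite -AT.
      rewrite -[x](addrK c) h -(h c) subrr /form dotcv0l //.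
    move/eqP: u0; apply; apply: dotcv_eq0; rewrite -trS.
    apply: big1 => i _; rewrite -mulmx_delta_col -dotcv_delta dotcvC; exact: form0.
  - move=> l; apply: filterS2 (walkE l) (formE l) => w e1 e2.
    exists (fwd_pos X th tr (x0 - c) l w + c); first by rewrite /= addrK.
    have it k x : iter k (isom_fun g) x = x + k%:R *: v0.
      elim: k => [|k IH]; first by rewrite scale0r addr0.
      by rewrite iterS IH -natr1 scalerDl scale1r addrA.
    by rewrite it e1 addrA.
have [mu [mucf muN]] := gaussian_exists C0sym C0psd.
exists v0, mu => [u u0|].
  by have [s s0 sE] := muN u (C0pd u u0); exists 0, s.
pose r l : R := (Num.sqrt l%:R)^-1.
pose F l w := fwd_pos X th tr (x0 - c) l w.
have mF l : mx_measurable (F l) by exact: measurable_fwd_pos.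
have mW l : mx_measurable (walk X x0 l).
  elim: l => [|l IH]; first exact: mx_measurable_cst.
  rewrite (_ : walk X x0 l.+1 = fun w => th (X l w) *m walk X x0 l w + pt 0 (X l w)).
    by apply: mx_measurableD; [apply: mx_measurableM => //; exact: mX|exact: mX].
  by apply/funext => w; rewrite /= isom_funE.
pose Z l w := r l *: (walk X x0 l w - l%:R *: v0).
have mZ l : mx_measurable (Z l).
  by apply: mx_measurableZ; apply: mx_measurableD => //; exact: mx_measurable_cst.
(* [Z'] agrees with [Z] almost surely only, because [th] fixes [v0] almost surely. Its shift by
   [r l *: c] fades in the phase and costs a constant in the second moment. *)
pose Z' l w := r l *: F l w + r l *: c.
have mZ' l : mx_measurable (Z' l).
  by apply: mx_measurableD; [exact: mx_measurableZ|exact: mx_measurable_cst].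
have ZE l : {ae P, forall w, Z l w = Z' l w}.
  apply: filterS (walkE l) => w e; rewrite /Z /Z' e -scalerDr; congr (_ *: _).
  by rewrite addrA addrK.
have r01 l : 0 <= r l <= 1.
  rewrite /r invr_ge0 sqrtr_ge0 /=; case: l => [|l]; first by rewrite sqrtr0 invr0.
  by rewrite invf_le1 ?sqrtr_gt0 ?ltr0n// -[leLHS]sqrtr1 ler_wsqrtr// ler1n.
have mcos (Y : T -> 'cV[R]_d) (u : 'cV[R]_d) (a : R) : mx_measurable Y ->
    measurable_fun setT (fun w => cos (dotcv u (Y w) + a)).
  move=> mY; apply: (measurableT_comp (continuous_measurable_fun (@continuous_cos R))).
  by apply: measurable_funD => //; apply: measurable_dotcv => //; exact: mx_measurable_cst.
have icos (Y : T -> 'cV[R]_d) (u : 'cV[R]_d) (a : R) : mx_measurable Y ->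
    L1 P (fun w => cos (dotcv u (Y w) + a)).
  by move=> mY; apply: (@L1_bounded _ _ _ _ _ 1) => [|w]; [exact: mcos|exact: cos_max].
have tight l := fwd_pos_tight Xindep Xident mth mtr thO tr2 tr0 (x0 - c) l.
pose K := 2 * (2 * dotcv (x0 - c) (x0 - c) +
  2 * \int[P]_w dotcv (tr (X 0%N w)) (tr (X 0%N w))) + 2 * dotcv c c.
apply: (@cf_weak_cvg _ _ _ _ P Z mu K) => // [u a|l].
  rewrite mucf.
  have cF := fwd_pos_cf Xindep Xident mth mtr thO tr2 tr0 CE MC0 (C0psd u) (a := a) (x0 - c).
  have cd : (fun l => \int[P]_w cos (dotcv u (Z l w) + a) -
      \int[P]_w cos (dotcv u (r l *: F l w) + a)) n @[n --> \oo] --> (0 : R).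
    have cr : r l * `|dotcv u c| @[l --> \oo] --> (0 : R).
      rewrite -[X in _ --> X](mul0r `|dotcv u c|); apply: cvgMr_tmp.
      exact: cvg_invsqrt.
    apply: norm_cvg0; apply: (@squeeze_cvgr _ _ _ _ (fun=> 0) (fun l => r l * `|dotcv u c|)) => //.
      apply: nearW => l; rewrite normr_ge0 /=.
      rewrite (@Er_ae_eq _ _ _ P _ (fun w => cos (dotcv u (Z' l w) + a))); first last.
      - by apply: filterS (ZE l) => w ->.
      - exact: mcos.
      - exact: mcos.
      have mrF : mx_measurable (fun w => r l *: F l w) by exact: mx_measurableZ.
      rewrite -ErB; [|exact: icos|exact: icos].
      apply: Er_bound => [|w].
        by apply: measurable_funB; exact: mcos.
      apply: (le_trans (cos_lipschitz _ _)); rewrite /Z' dotcvDr.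
      rewrite (_ : _ - _ = dotcv u (r l *: c)); last by lra.
      by rewrite dotcvZr normrM ger0_norm//; have /andP[] := r01 l.
    exact: cvg_cst.
  exact: (cvg_sub0 cd cF).
have [iF EF] := tight l.
have iK : L1 P (fun w => 2 * dotcv (r l *: F l w) (r l *: F l w) + 2 * dotcv c c).
  by apply: L1D; [exact: L1Z|exact: L1_cst].
have mZZ : measurable_fun setT (fun w => dotcv (Z l w) (Z l w)) by exact: measurable_dotcv.
have mZZ' : measurable_fun setT (fun w => dotcv (Z' l w) (Z' l w)) by exact: measurable_dotcv.
have leZ w : dotcv (Z' l w) (Z' l w) <= 2 * dotcv (r l *: F l w) (r l *: F l w) + 2 * dotcv c c.
  apply: (le_trans (dotcvD_le _ _)); rewrite lerD2l ler_pM2l// dotcvZl dotcvZr mulrA.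
  have /andP[r0 r1] := r01 l.
  rewrite -[leRHS]mul1r ler_wpM2r ?dotcv_ge0//.
  by rewrite mulr_ile1.
have iZ' : L1 P (fun w => dotcv (Z' l w) (Z' l w)).
  by apply: (L1_le _ _ iK) => // w; rewrite ger0_norm ?dotcv_ge0.
have ZZ : {ae P, forall w, dotcv (Z l w) (Z l w) = dotcv (Z' l w) (Z' l w)}.
  by apply: filterS (ZE l) => w ->.
split.
  have /integrableP[_ fin] := iZ'; apply/integrableP; split; first exact/measurable_EFinP.
  apply: le_lt_trans fin; rewrite le_eqVlt; apply/orP; left; apply/eqP.
  apply: ae_eq_integral => //.
  - by apply/measurable_EFinP; exact: measurableT_comp.
  - by apply/measurable_EFinP; exact: measurableT_comp.
  - by apply: filterS ZZ => w /= -> _.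
rewrite (Er_ae_eq mZZ mZZ' ZZ); apply: (le_trans (Er_le iZ' iK leZ)).
rewrite ErD; [|exact: L1Z|exact: L1_cst].
by rewrite ErZ// Er_cst /K lerD2r ler_pM2l.
Qed.
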